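(* Let $\Omega\subset\mathbb R^n$ be an open set (not necessarily bounded). Assume that either $\operatorname{div}b+d\le0$ or $-\operatorname{div}c+d\le0$ holds, and that either $b+c\in L^{n,q}(\Omega)$ for some $q\in[n,\infty)$, or $|b+c|^2\in\mathcal K'(\Omega)$. Let $F\in W^{-1,2}(\Omega)$. If $u$ and $v$ are supersolutions of $Lw=F$ in $\Omega$, then $\min(u,v)$ is a supersolution of $Lw=F$ in $\Omega$.
   Context: Setting. $n\ge3$; $A=(a_{ij}):\Omega\to\mathbb R^{n\times n}$, $b,c:\Omega\to\mathbb R^n$, $d:\Omega\to\mathbb R$ are measurable; there are $0<\lambda<\Lambda<\infty$ with $\lambda|\xi|^2\le\langle A(x)\xi,\xi\rangle$ and $\langle A(x)\xi,\eta\rangle\le\Lambda|\xi||\eta|$ for all $\xi,\eta\in\mathbb R^n$ and a.e. $x\in\Omega$. Standing assumption: either $|b|^2,|c|^2,|d|\in\mathcal K'(\Omega)$, or $b,c\in L^{n,\infty}(\Omega)$ and $d\in L^{n/2,\infty}(\Omega)$. Operator. $Lu=-\operatorname{div}(A\nabla u+bu)-c\cdot\nabla u-du$, with bilinear form $\mathcal L(u,v)=\int_\Omega (A\nabla u+bu)\cdot\nabla v-(c\cdot\nabla u+du)v$ for $u\in Y^{1,2}_{\mathrm{loc}}(\Omega)$, $v\in C_c^\infty(\Omega)$; $w\in Y^{1,2}_{\mathrm{loc}}(\Omega)$ is a supersolution of $Lw=F$ in $\Omega$ if $\mathcal L(w,\varphi)\ge\langle F,\varphi\rangle$ for all $0\le\varphi\in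 C_c^\infty(\Omega)$. $\operatorname{div}b+d\le0$ means $\int_\Omega(d\varphi-b\cdot\nabla\varphi)\le0$ for all $0\le\varphi\in C_c^\infty(\Omega)$; $-\operatorname{div}c+d\le0$ means $\int_\Omega(d\varphi+c\cdot\nabla\varphi)\le0$ for all such $\varphi$. Sobolev spaces. $2^*=\frac{2n}{n-2}$; $Y^{1,2}(U)$ is the space of weakly differentiable $u\in L^{2^*}(U)$ with $\nabla u\in L^2(U)$; $u\in Y^{1,2}_{\mathrm{loc}}(\Omega)$ if $u\in Y^{1,2}(K)$ for every compact $K\subset\Omega$. $W^{-1,2}(\Omega)$ is the dual of $W_0^{1,2}(\Omega)$. Function classes. $\vartheta_\Omega(f,r)=\sup_{x\in\mathbb R^n}\int_{B_r(x)\cap\Omega}\frac{|f(y)|}{|x-y|^{n-2}}dy$; $\mathcal K'(\Omega)$ is the set of $f\in L^1(\Omega)$ with $\lim_{r\to0}\vartheta_\Omega(f,r)=0$ and $\sup_{r>0}\vartheta_\Omega(f,r)<\infty$. $\|f\|_{L^{p,q}(\Omega)}=p^{1/q}\left(\int_0^\infty (t\,|\{x\in\Omega:|f|>t\}|^{1/p})^q\frac{dt}{t}\right)^{1/q}$ for $q<\infty$, $\|f\|_{L^{p,\infty}(\Omega)}=\sup_{t>0}t|\{x\in\Omega:|f|>t\}|^{1/p}$. *)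

(* Defs.v *)
From HB Require Import structures.
From mathcomp Require Import all_boot all_order all_algebra.
From mathcomp Require Import all_classical all_reals all_analysis.

Set Implicit Arguments.
Unset Strict Implicit.
Unset Printing Implicit Defensive.

Import Order.TTheory GRing.Theory Num.Theory.
Import numFieldNormedType.Exports.

Local Open Scope classical_set_scope.
Local Open Scope ring_scope.

Section EuclideanSpace.
Context {R : realType} {n : nat}.
Implicit Types x y : 'rV[R]_n.

Definition dotv x y : R := \sum_(i < n) x 0 i * y 0 i.

(* The norm `|x| of the library is the sup norm; it induces the same topology
   as this one. *)
Definition enorm x : R := Num.sqrt (dotv x x).

Definition eball x (r : R) : set 'rV[R]_n := [set y | enorm (x - y) < r].

Definition mulv (A : 'M[R]_n) x : 'rV[R]_n := (A *m x^T)^T.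

End EuclideanSpace.

(* Lebesgue measure on R^n, in its complete (Caratheodory) version: the outer
   measure is the infimum of the total volumes of countable covers by half-open
   boxes, and the measurable sets are the Caratheodory-measurable ones. *)
Section LebesgueOuter.
Context {R : realType} {n : nat}.
Local Open Scope ereal_scope.

(* None stands for the empty set, which is not a product box when n = 0. *)
Definition box (p : option ('rV[R]_n * 'rV[R]_n)) : set 'rV[R]_n :=
  if p is Some (a, b) then [set x | forall i, (a 0 i < x 0 i <= b 0 i)%R]
  else set0.

Definition box_vol (p : option ('rV[R]_n * 'rV[R]_n)) : \bar R :=
  if p is Some (a, b) then (\prod_(i < n) Num.max 0 (b 0 i - a 0 i))%:E else 0.

Definition lebesgue_outer (X : set 'rV[R]_n) : \bar R :=
  ereal_inf [set \sum_(k <oo) box_vol (B k) |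
             B in [set B : nat -> option ('rV[R]_n * 'rV[R]_n) |
                   X `<=` \bigcup_k box (B k)]].

Lemma box_vol_ge0 p : 0 <= box_vol p.
Proof.
case: p => [[a b]|//] /=; rewrite lee_fin; apply: prodr_ge0 => i _.
by rewrite le_max lexx.
Qed.

Lemma lebesgue_outer_ge0 X : 0 <= lebesgue_outer X.
Proof.
apply: le_ereal_inf_tmp => _ [B _ <-].
by apply: nneseries_ge0 => k _ _; exact: box_vol_ge0.
Qed.

Lemma lebesgue_outer0 : lebesgue_outer set0 = 0.
Proof.
apply/eqP; rewrite eq_le lebesgue_outer_ge0 andbT.
apply: ereal_inf_lbound; exists (fun=> None) => //=.
by rewrite eseries0.
Qed.

Lemma le_lebesgue_outer : {homo lebesgue_outer : X Y / X `<=` Y >-> X <= Y}.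
Proof.
move=> X Y XY; apply: ereal_inf_le_tmp => _ [B YB <-].
by exists B => //; exact: subset_trans XY YB.
Qed.

Lemma lebesgue_outer_sigma_subadditive : sigma_subadditive lebesgue_outer.
Proof.
move=> A; have [[i ioo]|] := pselect (exists i, lebesgue_outer (A i) = +oo).
  rewrite (eseries_pinfty _ _ ioo) ?leey// => k _.
  by rewrite -ltNye (lt_le_trans _ (lebesgue_outer_ge0 _)).
rewrite -forallNE => Aoo.
apply/lee_addgt0Pr => e e0.
rewrite (le_trans _ (epsilon_trick _ _ (ltW e0)))//; last first.
  by move=> k; exact: lebesgue_outer_ge0.
pose P k (B : nat -> option ('rV[R]_n * 'rV[R]_n)) :=
  A k `<=` \bigcup_j box (B j) /\
  \sum_(j <oo) box_vol (B j) <= lebesgue_outer (A k) + (e / (2 ^ k.+1)%:R)%:E.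
have [G PG] : {G : nat -> nat -> option ('rV[R]_n * 'rV[R]_n) &
    forall k, P k (G k)}.
  apply: (@choice _ _ P) => k; rewrite /P.
  have fin : lebesgue_outer (A k) \is a fin_num.
    by rewrite ge0_fin_numE ?lebesgue_outer_ge0// ltey; apply/eqP.
  have ek : (0 < e / (2 ^ k.+1)%:R)%R by rewrite divr_gt0// ltr0n expn_gt0.
  have [_ [B AB <-] ltB] := lb_ereal_inf_adherent ek fin.
  by exists B; split => //; exact: ltW.
pose v (ij : nat * nat) := box_vol (uncurry G ij).
have v0 ij : 0 <= v ij by exact: box_vol_ge0.
apply: (@le_trans _ _ (\esum_(i in setT) v i)).
  apply: ereal_inf_lbound => /=.
  have /card_esym/ppcard_eqP[f] := card_nat2.
  exists (uncurry G \o f).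
    move=> t [i _ Ait]; have [j _ Bt] := (PG i).1 _ Ait.
    by exists (f^-1%FUN (i, j)) => //=; rewrite invK ?inE.
  rewrite -(esum_pred_image v _ xpredT) ?[fun=> _]set_true//.
  by rewrite image_eq.
rewrite (_ : esum _ _ = \sum_(i <oo) \sum_(j <oo ) box_vol (G i j)); last first.
  pose J : nat -> set (nat * nat) := fun i => [set (i, j) | j in setT].
  rewrite (_ : setT = \bigcup_k J k); last first.
    by rewrite predeqE => -[a b]; split => // _; exists a => //; exists b.
  rewrite esum_bigcupT//=; last first.
    apply/trivIsetP => i j _ _ ij.
    rewrite predeqE => -[k m] /=; split => //= -[] [_] _ [<-{k} _].
    by move=> [m' _] [] /esym/eqP; rewrite (negbTE ij).
  rewrite -(image_id [set: nat]) -fun_true esum_pred_image//; last first.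
    by move=> k _; exact: esum_ge0.
  apply: eq_eseriesr => /= j _.
  rewrite -(esum_pred_image v (pair j) predT)//=; last first.
    by move=> ? ? _ _; exact: (@can_inj _ _ _ snd).
  by congr esum; rewrite predeqE => -[a b]; split; move=> [i _ <-]; exists i.
apply: lee_nneseries => k _; last exact: (PG k).2.
by move=> _; apply: nneseries_ge0 => m _ _; exact: box_vol_ge0.
Qed.

HB.instance Definition _ := isOuterMeasure.Build R 'rV[R]_n lebesgue_outer
  lebesgue_outer0 lebesgue_outer_ge0 le_lebesgue_outer
  lebesgue_outer_sigma_subadditive.

End LebesgueOuter.

(* 'rV[R]_n with the sigma-algebra of Lebesgue-measurable sets *)
Notation lebRn R n := (caratheodory_type (@lebesgue_outer R n)).

Definition leb {R : realType} {n : nat} : set (lebRn R n) -> \bar R :=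
  lebesgue_outer.

HB.instance Definition _ (R : realType) (n : nat) := isMeasure.Build _ _ _
  (@leb R n)
  (@caratheodory_measure0 R 'rV[R]_n (@lebesgue_outer R n))
  (@caratheodory_measure_ge0 R 'rV[R]_n (@lebesgue_outer R n))
  (@caratheodory_measure_sigma_additive R 'rV[R]_n (@lebesgue_outer R n)).

(* Functions on a subset of R^n are total functions on R^n whose values outside
   of that subset are irrelevant. *)
Section FunctionSpaces.
Context {R : realType} {n : nat}.
Notation Rn := 'rV[R]_n.
Implicit Types (U Omega K : set Rn) (f u v phi : Rn -> R) (g b c : Rn -> Rn).

Definition measurable_on U f := measurable_fun (U : set (lebRn R n)) (f : lebRn R n -> R).

Definition Lp_norm (p : R) U f : \bar R :=
  'N[@leb R n]_(p%:E)[EFin \o (f \_ U)]%E.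

Definition Lp (p : R) U f := measurable_on U f /\ (Lp_norm p U f < +oo)%E.

Definition L1loc Omega f :=
  measurable_on Omega f /\ (forall K, compact K -> K `<=` Omega -> Lp 1 K f).

Definition vmeasurable_on U g := forall i, measurable_on U (fun x => g x 0 i).

(* Lorentz spaces *)

Definition distr U f (t : R) : \bar R := leb [set x | U x /\ t < `|f x|].

Definition Lorentz_norm (p q : R) U f : \bar R :=
  ((p `^ q^-1)%:E *
   (\int[@lebesgue_measure R]_(t in `]0%R, +oo[)
      ((t%:E * distr U f t `^ p^-1) `^ q * (t^-1)%:E)) `^ q^-1)%E.

Definition weak_Lorentz_norm (p : R) U f : \bar R :=
  ereal_sup [set (t%:E * distr U f t `^ p^-1)%E | t in [set t : R | 0 < t]].

Definition Lorentz (p q : R) U f :=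
  measurable_on U f /\ (Lorentz_norm p q U f < +oo)%E.

Definition weak_Lorentz (p : R) U f :=
  measurable_on U f /\ (weak_Lorentz_norm p U f < +oo)%E.

(* The Kato-type class K' *)

Definition vartheta U f (r : R) : \bar R :=
  ereal_sup (range (fun x : Rn =>
    \int[@leb R n]_(y in eball x r `&` U)
      (`|f y| / enorm (x - y) ^+ (n - 2))%:E)%E).

Definition Kato U f :=
  [/\ Lp 1 U f,
      vartheta U f r @[r --> 0^'+] --> 0%E
    & (ereal_sup [set vartheta U f r | r in [set r : R | (0 < r)%R]] < +oo)%E].

(* Test functions *)

Definition partial (i : 'I_n) f : Rn -> R := 'D_(delta_mx 0 i) f.

Definition grad f (x : Rn) : Rn := \row_i partial i f x.

Definition smooth f :=
  forall (s : seq 'I_n) (x : Rn), differentiable (foldr partial f s) x.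

Definition Ccinf Omega phi :=
  let supp := closure [set x | phi x != 0] in
  [/\ smooth phi, compact supp & supp `<=` Omega].

Definition Ccinf_ge0 Omega phi := Ccinf Omega phi /\ forall x, 0 <= phi x.

(* Weak derivatives and Sobolev spaces *)

Definition is_wgrad Omega u g :=
  [/\ L1loc Omega u, forall i, L1loc Omega (fun x => g x 0 i)
    & forall phi i, Ccinf Omega phi ->
        \int[@leb R n]_(x in Omega) (u x * partial i phi x) =
        - \int[@leb R n]_(x in Omega) (g x 0 i * phi x)].

Definition weakly_differentiable Omega u := exists g, is_wgrad Omega u g.

(* The weak gradient, unique up to a null set; it is a junk value when u is not
   weakly differentiable. *)
Definition wgrad Omega u : Rn -> Rn := xget (fun=> 0) [set g | is_wgrad Omega u g].

Definition two_star : R := 2 * n%:R / (n%:R - 2).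

Definition Y12loc Omega u :=
  weakly_differentiable Omega u /\
  forall K, compact K -> K `<=` Omega ->
    Lp two_star K u /\ Lp 2 K (fun x => enorm (wgrad Omega u x)).

Definition W12 Omega u :=
  [/\ weakly_differentiable Omega u, Lp 2 Omega u
    & Lp 2 Omega (fun x => enorm (wgrad Omega u x))].

Definition W12_norm Omega u : \bar R :=
  (Lp_norm 2 Omega u + Lp_norm 2 Omega (fun x => enorm (wgrad Omega u x)))%E.

(* the closure of the test functions in W^{1,2} *)
Definition W012 Omega u :=
  W12 Omega u /\
  forall e : R, 0 < e ->
    exists2 phi, Ccinf Omega phi & (W12_norm Omega (u \- phi)%R < e%:E)%E.

(* The dual of W_0^{1,2}. Boundedness makes F compatible with a.e. equality; the
   values of F outside of W_0^{1,2} are irrelevant. *)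
Definition Wm12 Omega (F : (Rn -> R) -> R) :=
  (forall (a : R) u v, W012 Omega u -> W012 Omega v ->
     F (fun x => a * u x + v x) = a * F u + F v) /\
  (exists C : R, forall u, W012 Omega u -> (`|F u|%R%:E <= C%:E * W12_norm Omega u)%E).

(* The operator L *)

Definition elliptic Omega (A : Rn -> 'M[R]_n) (lambda Lambda : R) :=
  {ae (@leb R n), forall x, Omega x -> forall xi eta : Rn,
     lambda * enorm xi ^+ 2 <= dotv (mulv (A x) xi) xi /\
     dotv (mulv (A x) xi) eta <= Lambda * enorm xi * enorm eta}.

Definition bilinL Omega (A : Rn -> 'M[R]_n) b c (d : Rn -> R) u phi : R :=
  \int[@leb R n]_(x in Omega)
    (dotv (mulv (A x) (wgrad Omega u x) + u x *: b x) (grad phi x)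
     - (dotv (c x) (wgrad Omega u x) + d x * u x) * phi x).

Definition supersolution Omega (A : Rn -> 'M[R]_n) b c (d : Rn -> R)
    (F : (Rn -> R) -> R) w :=
  Y12loc Omega w /\
  forall phi, Ccinf_ge0 Omega phi -> F phi <= bilinL Omega A b c d w phi.

(* div b + d <= 0 in the sense of distributions *)
Definition divD_le0 Omega b (d : Rn -> R) :=
  forall phi, Ccinf_ge0 Omega phi ->
    \int[@leb R n]_(x in Omega) (d x * phi x - dotv (b x) (grad phi x)) <= 0.

End FunctionSpaces.

(* Main.v *)
(* Let [w = v - u] be the difference of the two supersolutions, approximated locally by smooth
   functions [w_j], and let [H_e(t) = (1 + t / sqrt(t^2 + e^2)) / 2] be a smooth step.  Test the
   inequality for [u] with [phi H_e(w_j)], the one for [v] with [phi (1 - H_e(w_j))], and add.  As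
   [j] tends to infinity, the terms in which the gradient falls on the step become
   [- int phi H_e'(w) <A grad w + w b, grad w>].  The part with [A] is nonpositive by ellipticity;
   since [|t H_e'(t)| <= 1] tends to 0 with [e], the part with [b] disappears as [e] tends to 0.
   What is left is the weak form of [min(u, v)].

   The lower order terms are integrable because [V = |b|^2, |c|^2, |d|] satisfy locally the trace
   inequality [int V w^2 <= C (1 + int |grad w|^2)].  When the Newtonian potential [N] of [V] is
   bounded by [M], it follows by integrating the divergence of [w^2 (2M - N) grad N].  When [V] is
   only in weak L^(n/2), this is applied to indicator functions, which gives a capacitary
   inequality, and the level sets of [w] are summed by Maz'ya's truncation. *)

(* Supersolutions are tested with smooth functions only, so the step cannot be composed with [v - u]
   itself; this is why [w_j] appears, and why two limits have to be taken in a fixed order. For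
   fixed [e] the bound [H_e' <= 1/e] is enough for dominated convergence in [j]. Uniformly in [e]
   the term [H_e'(w) <A grad w, grad w>] has no bound, so its sign has to be used before [e] tends
   to 0. The two test functions add up to [phi], so the additivity of [F] restores [F phi]; their
   gradients contain the gradient of the step with opposite signs, so that only the difference of
   the two fluxes, [A grad w + w b], meets it. The trace inequality is proved for test functions
   [w], with the Newtonian kernel smoothed to [(|x|^2 + d^2)^((2-n)/2)]. Minus its Laplacian is
   nonnegative and has a mass near 0 bounded below independently of [d]; this lower bound replaces
   the exact fundamental solution, at the price of a constant. Mollification and Fatou's lemma then
   carry the inequality over to functions that are only locally in a Sobolev space. *)
From HB Require Import structures.
Require Import Defs.
From mathcomp Require Import all_boot all_order all_algebra.
From mathcomp Require Import all_classical all_reals all_analysis.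
From mathcomp Require Import measurable_realfun.
From mathcomp Require Import ring lra.

Set Implicit Arguments.
Unset Strict Implicit.
Unset Printing Implicit Defensive.

Import Order.TTheory GRing.Theory Num.Theory.
Import numFieldNormedType.Exports.

Local Open Scope classical_set_scope.
Local Open Scope ring_scope.

(** * Lebesgue measure on R^n *)

Section LebesgueRn.
Context {R : realType} {n : nat}.
Local Notation Rn := 'rV[R]_n.
Local Notation T := (lebRn R n).

Lemma box_vol_split (i : 'I_n) (c : R) (p : option (Rn * Rn)) :
  exists q r : option (Rn * Rn),
    [/\ box p `&` [set x | x 0 i <= c] `<=` box q,
        box p `&` [set x | c < x 0 i] `<=` box r &
        (box_vol q + box_vol r = box_vol p)%E].
Proof.
case: p => [[a b]|]; last first.
  by exists None, None; split; [move=> x []|move=> x []|rewrite /= adde0].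
pose upd (v : Rn) z : Rn := \row_j if j == i then z else v 0 j.
exists (Some (a, upd b (Num.min (b 0 i) c))), (Some (upd a (Num.max (a 0 i) c), b)).
split => /=.
- move=> x [abx xc] j; rewrite !mxE; have /andP[ax xb] := abx j.
  by case: eqP => [ji|_]; rewrite ?ax//= le_min -ji xb ji xc.
- move=> x [abx xc] j; rewrite !mxE; have /andP[ax xb] := abx j.
  by case: eqP => [ji|_]; rewrite ?xb ?ax// gt_max -ji ax ji xc.
- rewrite -EFinD; congr EFin.
  rewrite (bigD1 i)//= [in X in _ + X](bigD1 i)//= [RHS](bigD1 i)//= !mxE eqxx.
  under eq_bigr => j ji do rewrite mxE (negbTE ji).
  under [in X in _ + X]eq_bigr => j ji do rewrite mxE (negbTE ji).
  rewrite -mulrDl; congr *%R.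
  rewrite /Order.min /Order.max.
  by repeat case: ifPn; rewrite -?leNgt => *; lra.
Qed.

(** This is Caratheodory's criterion for a half-space. By [box_vol_split] a hyperplane cuts every
    box of a cover without changing the total volume, and the two halves of the cover bound the two
    outer measures. *)
Lemma measurable_coord (i : 'I_n) : measurable_fun [set: T] (fun x : Rn => x 0 i).
Proof.
apply: (measurability _ (measurable_realfun.RGenOInfty.measurableE R)) => _ [_ [c ->] <-].
rewrite setTI -[X in measurable X]setCK; apply: measurableC.
apply: le_caratheodory_measurable => X /=.
rewrite setCK [in leLHS](_ : ~` _ = [set x : Rn | x 0 i <= c]); last first.
  by apply/seteqP; split => x /=; rewrite in_itv/= andbT leNgt => /negP.
rewrite [in leLHS](_ : _ @^-1` _ = [set x : Rn | c < x 0 i]); last first.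
  by apply/seteqP; split => x /=; rewrite in_itv/= andbT.
apply: le_ereal_inf_tmp => _ [B XB <-].
have [q /choice[r qr]] := choice (fun k => box_vol_split i c (B k)).
rewrite (eq_eseriesr (fun k _ => esym (let: And3 _ _ e := qr k in e))).
rewrite nneseriesD; last 2 first.
- by move=> k _ _; exact: box_vol_ge0.
- by move=> k _ _; exact: box_vol_ge0.
apply: leeD; apply: ereal_inf_lbound.
  exists q => //= x [/XB[k _ Bk] xc]; exists k => //; have [h1 _ _] := qr k; exact: h1.
exists r => //= x [/XB[k _ Bk] xc]; exists k => //; have [_ h1 _] := qr k; exact: h1.
Qed.


(** An open set is the union of the countably many rational sup-norm balls inside it, and each ball
    is a finite intersection of coordinate slabs. The general map [F] covers both the identity of
    R^n and the subtraction on a product space. *)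
Lemma measurable_preimage_open d (X : measurableType d) (F : X -> Rn) (V : set Rn) :
  (forall i, measurable_fun [set: X] (fun x => F x 0 i)) ->
  open V -> measurable (F @^-1` V).
Proof.
move=> mF oV.
pose Q k : set Rn := if unpickle k is Some (q, r) then
  [set y | ball (map_mx ratr q : Rn) (ratr (r : rat)) y] else set0.
pose G k : set X := if `[< Q k `<=` V >] then F @^-1` Q k else set0.
rewrite (_ : F @^-1` V = \bigcup_k G k); last first.
  apply/seteqP; split => [x Vx|x [k _]]; last first.
    by rewrite /G; case: asboolP => // + h; apply.
  have [e /= e0 eV] : nbhs_ball (F x) V by rewrite nbhs_ballE; exact: oV.
  have /rat_in_itvoo[r /[!in_itv]/= /andP[r0 re]] : 0 < e / 2 by rewrite divr_gt0.
  have hq (i : 'I_n) : exists q : rat, ratr q \in `](F x 0 i - ratr r), (F x 0 i + ratr r)[.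
    by apply: rat_in_itvoo; lra.
  have [q hq'] := choice hq.
  have Bx : ball (map_mx ratr (\row_i q i) : Rn) (ratr (r : rat)) (F x).
    split=> [//|i j]; rewrite !mxE ord1 /ball/= .
    by have := hq' j; rewrite in_itv/= => /andP[h1 h2]; rewrite ltr_norml; lra.
  exists (pickle (\row_i q i, r)) => //.
  rewrite /G /Q pickleK; case: asboolP => [//|nQ]; exfalso; apply: nQ => y By.
  apply: eV; apply: (@le_ball _ _ _ (ratr r + ratr r)); first lra.
  by apply: ball_triangle By; exact: ball_sym.
apply: bigcupT_measurable => k; rewrite /G; case: ifPn => // _; rewrite /Q.
case: unpickle => [[q r]|]; last by rewrite preimage_set0.
have [r0|r0] := ltP 0 (ratr r : R); last first.
  rewrite [X in measurable X](_ : _ = set0)//.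
  by apply/seteqP; split => // x [/= ]; rewrite ltNge r0.
rewrite [X in measurable X](_ : _ = \big[setI/setT]_(i : 'I_n)
   ((fun x => F x 0 i) @^-1` `](ratr (q 0 i) - ratr r), (ratr (q 0 i) + ratr r)[)).
  apply: bigsetI_measurable => i _; rewrite -[X in measurable X]setTI; exact: mF.
apply/seteqP; split => [x [_ h]|x].
  rewrite -bigcap_seq => i _ /=.
  by have := h 0 i; rewrite /ball/= !mxE ltr_norml in_itv/=; lra.
rewrite -bigcap_seq => h; split => // i j; rewrite ord1.
have := h j (mem_index_enum j); rewrite /ball/= !mxE ltr_norml in_itv/=; lra.
Qed.

Lemma measurable_cont_coord d (X : measurableType d) (F : X -> Rn) (g : Rn -> R) :
  (forall i, measurable_fun [set: X] (fun x => F x 0 i)) ->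
  continuous g -> measurable_fun [set: X] (g \o F).
Proof.
move=> mF cg.
apply: (measurability _ (measurable_realfun.RGenOpens.measurableE R)) => _ [_ [a [b ->] <-]].
rewrite setTI comp_preimage; apply: measurable_preimage_open => //.
by move/continuousP : cg; apply; exact: interval_open.
Qed.

Lemma open_measurable_leb (U : set Rn) : open U -> measurable (U : set T).
Proof. exact: (@measurable_preimage_open _ T (fun x => x) U measurable_coord). Qed.

Lemma closed_measurable_leb (U : set Rn) : closed U -> measurable (U : set T).
Proof.
move=> cU; rewrite -[X in measurable X]setCK; apply: measurableC.
by apply: open_measurable_leb; exact: closed_openC.
Qed.

Lemma compact_measurable_leb (U : set Rn) : compact U -> measurable (U : set T).
Proof. by move/compact_closed => cU; apply: closed_measurable_leb; apply: cU; exact: norm_hausdorff. Qed.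

Lemma continuous_measurable (g : Rn -> R) : continuous g ->
  measurable_fun [set: T] (g : T -> R).
Proof. exact: (@measurable_cont_coord _ T (fun x => x) g measurable_coord). Qed.

Lemma leb_box_le (a b : Rn) : (leb (box (Some (a, b)) : set T) <= box_vol (Some (a, b)))%E.
Proof.
apply: ereal_inf_lbound; exists (fun k => if k == 0%N then Some (a, b) else None).
  by move=> x bx; exists 0%N.
rewrite nneseries_recl//; last by move=> k _; exact: box_vol_ge0.
rewrite [X in (_ + X)%E](_ : _ = 0%E) ?adde0// eseries0// => -[|k]//.
Qed.

Definition ofs (h : Rn) (p : option (Rn * Rn)) :=
  if p is Some (a, b) then Some (a + h, b + h) else None.

Lemma lebesgue_outer_shift_le (h : Rn) (X : set Rn) :
  (lebesgue_outer [set x | X (x - h)%R] <= lebesgue_outer X)%E.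
Proof.
apply: le_ereal_inf_tmp => _ [B XB <-].
apply: ereal_inf_lbound; exists (ofs h \o B).
  move=> x /= /XB[k _ Bk]; exists k => //=.
  case: (B k) Bk => [[a b]|//] /= + i => /(_ i); rewrite !mxE; lra.
apply: eq_eseriesr => k _ /=; case: (B k) => [[a b]|//] /=.
by congr EFin; apply: eq_bigr => i _; rewrite !mxE; congr Num.max; ring.
Qed.

Lemma lebesgue_outer_shift (h : Rn) (X : set Rn) :
  lebesgue_outer [set x | X (x + h)] = lebesgue_outer X.
Proof.
apply/eqP; rewrite eq_le; apply/andP; split.
  by have := lebesgue_outer_shift_le (- h) X; under eq_set do rewrite opprK.
have := lebesgue_outer_shift_le h [set x | X (x + h)]; congr (_ <= _)%E.
by congr lebesgue_outer; apply/seteqP; split => x /=; rewrite subrK.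
Qed.

Lemma measurable_shift (h : Rn) : measurable_fun [set: T] ((fun x : Rn => x + h) : T -> T).
Proof.
move=> _ A mA; rewrite setTI; apply: le_caratheodory_measurable => X.
have : lebesgue_outer [set x | X (x - h)] =
    (lebesgue_outer ([set x | X (x - h)%R] `&` A) +
     lebesgue_outer ([set x | X (x - h)%R] `&` ~` A))%E by exact: mA.
rewrite -(lebesgue_outer_shift h) -(lebesgue_outer_shift h (_ `&` A)).
rewrite -(lebesgue_outer_shift h (_ `&` ~` A)).
rewrite (_ : [set x | [set x0 | X (x0 - h)] (x + h)] = X); last first.
  by apply/seteqP; split => x /=; rewrite addrK.
rewrite (_ : [set x | ([set x0 | X (x0 - h)] `&` A) (x + h)] = X `&` [set x | A (x + h)]); last first.
  by apply/seteqP; split => x /=; rewrite addrK.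
rewrite (_ : [set x | ([set x0 | X (x0 - h)] `&` ~` A) (x + h)] = X `&` ~` [set x | A (x + h)]); last first.
  by apply/seteqP; split => x /=; rewrite addrK.
by move=> e; rewrite le_eqVlt; apply/orP; left; apply/eqP; symmetry; exact: e.
Qed.

Lemma leb_shift (h : Rn) (A : set T) : leb [set x : T | A (x + h : Rn)] = leb A.
Proof. exact: lebesgue_outer_shift. Qed.


Definition set_coord (x : Rn) (i : 'I_n) (t : R) : Rn :=
  \row_j if j == i then t else x 0 j.

(* The volume of a box with its first [m] sides replaced by the indicator
   functions of the corresponding intervals: integrating one coordinate after
   the other passes from the covering condition ([m = n]) to volumes ([m = 0]). *)
Definition partial_vol (p : option (Rn * Rn)) (m : nat) (x : Rn) : R :=
  if p is Some (a, b) then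
    \prod_(i < n) (if (i < m)%N then (a 0 i < x 0 i <= b 0 i)%R%:R
                   else Num.max 0 (b 0 i - a 0 i))
  else 0.

Lemma partial_vol_ge0 p m x : 0 <= partial_vol p m x.
Proof.
case: p => [[a b]|//] /=; apply: prodr_ge0 => i _.
by case: ifP => // _; rewrite le_max lexx.
Qed.

Lemma partial_vol_split p (i : 'I_n) (x : Rn) :
  exists2 c : R, 0 <= c & exists J : R * R,
   [/\ (forall t, partial_vol p i.+1 (set_coord x i t) = (J.1 < t <= J.2)%R%:R * c)
   & partial_vol p i x = Num.max 0 (J.2 - J.1) * c].
Proof.
case: p => [[a b]|]; last first.
  by exists 0 => //; exists (0, 0); split => *; rewrite mulr0.
exists (\prod_(j < n | j != i) (if (j < i)%N then (a 0 j < x 0 j <= b 0 j)%R%:R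
                   else Num.max 0 (b 0 j - a 0 j))).
  apply: prodr_ge0 => j _; by case: ifP => // _; rewrite le_max lexx.
exists (a 0 i, b 0 i); split => [t|] /=; rewrite (bigD1 i)//=.
  rewrite ltnSn mxE eqxx; congr *%R; apply: eq_bigr => j ji.
  by rewrite mxE (negbTE ji) ltnS leq_eqVlt val_eqE (negbTE ji).
by rewrite ltnn.
Qed.

Lemma partial_vol_integral p (i : 'I_n) (x : Rn) (D : set R) : measurable D ->
  measurable_fun D (fun t => partial_vol p i.+1 (set_coord x i t)) /\
  (\int[@lebesgue_measure R]_(t in D) (partial_vol p i.+1 (set_coord x i t))%:E
    <= (partial_vol p i x)%:E)%E.
Proof.
move=> mD; have [c c0 [[a b] /= [h ->]]] := partial_vol_split p i x.
have e t : partial_vol p i.+1 (set_coord x i t) = c * \1_(`]a, b]%classic) t.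
  rewrite h mulrC indicE; congr (_ * _); congr (_%:R).
  by rewrite mem_setE in_itv.
split; first by under eq_fun do rewrite e; exact: measurable_funM.
under eq_integral do rewrite e EFinM.
rewrite ge0_integralZl_EFin//; last exact/measurable_EFinP.
rewrite mulrC EFinM lee_wpmul2l ?lee_fin//.
rewrite integral_indic//; apply: (@le_trans _ _ (lebesgue_measure `]a, b]%classic)).
  by apply: le_measure; rewrite ?inE//; exact: measurableI.
rewrite lebesgue_measure_itv/= lte_fin; case: ltP => ab; rewrite ?lee_fin le_max ?lexx ?orbT//.
Qed.

(** Induction on the number [m] of coordinates already integrated. For [m = 0] the point lies in
    some box of the cover, whose product of indicators is 1. The step integrates over the coordinate
    of index [n - m.+1] and exchanges sum and integral. At [m = n] the total volume of the cover is
    bounded below by the volume of the box. *)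
Lemma partial_vol_cover (a b : Rn) (B : nat -> option (Rn * Rn)) :
  (forall i, a 0 i <= b 0 i) -> box (Some (a, b)) `<=` \bigcup_k box (B k) ->
  forall m, (m <= n)%N -> forall x : Rn,
  (forall i : 'I_n, (i < n - m)%N -> a 0 i < x 0 i <= b 0 i) ->
  ((\prod_(i < n | (n - m <= i)%N) (b 0 i - a 0 i))%:E <=
    \sum_(k <oo) (partial_vol (B k) (n - m) x)%:E)%E.
Proof.
move=> ab aB; elim=> [_|m ih mn] x hx.
  rewrite subn0 big1; last by move=> i; rewrite leqNgt ltn_ord.
  have [k _ Bk] : (\bigcup_k box (B k)) x.
    by apply: aB => i; apply: hx; rewrite subn0.
  have v0 j : (0 <= (partial_vol (B j) n x)%:E)%E by rewrite lee_fin partial_vol_ge0.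
  apply: le_trans (nneseries_lim_ge k.+1 (fun j _ _ => v0 j)).
  rewrite big_nat_recr//= -[leLHS]add0e leeD//; first exact: sume_ge0.
  case: (B k) Bk => [[a' b']|//] /= Bk.
  by rewrite lee_fin big1// => i _; rewrite ltn_ord Bk.
have mlt : (n - m.+1 < n)%N by rewrite -subn_gt0 subKn.
pose i0 := Ordinal mlt.
have e0 : (n - m = i0.+1)%N by rewrite /= subnSK.
have /= ih' t : a 0 i0 < t <= b 0 i0 ->
    ((\prod_(i < n | (i0 < i)%N) (b 0 i - a 0 i))%:E <=
     \sum_(k <oo) (partial_vol (B k) i0.+1 (set_coord x i0 t))%:E)%E.
  move=> tab; rewrite -e0; apply: (le_trans _ (ih (ltnW mn) _ _)); first by rewrite e0.
  move=> i; rewrite e0 ltnS leq_eqVlt => /orP[/eqP ii0|lti].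
    by rewrite mxE (_ : i = i0) ?eqxx//; exact/val_inj.
  by rewrite mxE ifF ?hx//; apply/negbTE; rewrite -val_eqE neq_ltn lti.
set D := `]a 0 i0, b 0 i0]%classic.
have mD : measurable D by exact: measurable_itv.
rewrite (bigD1 i0)//= mulrC EFinM.
have -> : (b 0 i0 - a 0 i0)%:E = lebesgue_measure D.
  rewrite lebesgue_measure_itv/= lte_fin; case: ltP => //.
  by have := ab i0 => h1 h2; rewrite (_ : b 0 i0 = a 0 i0) ?subrr//; apply/eqP; rewrite eq_le h1 h2.
rewrite -integral_cst//.
apply: (@le_trans _ _ (\int[@lebesgue_measure R]_(t in D)
    \sum_(k <oo) (partial_vol (B k) i0.+1 (set_coord x i0 t))%:E)%E).
  apply: ge0_le_integral => //.
  - by move=> t _; rewrite lee_fin; apply: prodr_ge0 => i _; rewrite subr_ge0.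
  - apply: ge0_emeasurable_sum => [k t _ _|k _]; first by rewrite lee_fin partial_vol_ge0.
    by apply/measurable_EFinP; have [] := partial_vol_integral (B k) i0 x mD.
  - move=> t; rewrite /D/= in_itv/= => /ih'; apply: le_trans.
    rewrite lee_fin le_eqVlt; apply/orP; left; apply/eqP; apply: eq_bigl => i.
    by rewrite ltn_neqAle andbC -val_eqE /= eq_sym.
rewrite integral_nneseries//; last 2 first.
- by move=> k; apply/measurable_EFinP; have [] := partial_vol_integral (B k) i0 x mD.
- by move=> k t _; rewrite lee_fin partial_vol_ge0.
apply: lee_nneseries => k _.
  by move=> _; apply: integral_ge0 => t _; rewrite lee_fin partial_vol_ge0.
by have [] := partial_vol_integral (B k) i0 x mD.
Qed.

Lemma leb_box_ge (a b : Rn) : (forall i, a 0 i <= b 0 i) ->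
  ((\prod_(i < n) (b 0 i - a 0 i))%:E <= leb (box (Some (a, b)) : set T))%E.
Proof.
move=> ab; apply: le_ereal_inf_tmp => _ [B aB <-].
have := @partial_vol_cover a b B ab aB n (leqnn n) 0 _; rewrite subnn => h.
apply: le_trans (h _) _ => //; apply: lee_nneseries => k _.
  by rewrite lee_fin partial_vol_ge0.
by case: (B k) => [[a' b']|].
Qed.


Lemma rV_norm_le (x : Rn) (r : R) : 0 <= r -> (`|x| <= r) = [forall i, `|x 0 i| <= r].
Proof.
move=> r0; have -> : `|x| = mx_norm x by []; rewrite mx_normrE; apply/bigmax_leP/forallP => [[_ h] i|h].
  exact: (h (0, i)).
by split => // -[j i] _ /=; rewrite ord1.
Qed.

Lemma coord_norm_le (x : Rn) (i : 'I_n) : `|x 0 i| <= `|x|.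
Proof. by have := lexx `|x|; rewrite rV_norm_le// => /forallP. Qed.

(** Cubes play the part of balls: they are the closed balls of the sup norm, and their volume can be
    read off from boxes. *)
Definition cube (x : Rn) (r : R) : set Rn := [set y | `|y - x| <= r].

Lemma cube_closed x r : closed (cube x r).
Proof.
apply: closed_comp (@closed_le R r) => y _.
by apply: (@continuous_comp _ _ _ (fun y : Rn => y - x) Num.norm);
  [apply: continuousB => //; exact: cst_continuous|exact: norm_continuous].
Qed.

Lemma cube_measurable x r : measurable (cube x r : set T).
Proof. exact/closed_measurable_leb/cube_closed. Qed.

(** The slack [r < s] is there because a half-open box misses its lower faces. *)
Lemma leb_cube_le x r s : 0 <= r -> r < s -> (leb (cube x r : set T) <= ((2 * s) ^+ n)%:E)%E.
Proof.
move=> r0 rs; have h : cube x r `<=` box (Some (x - const_mx s, x + const_mx s)).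
  move=> y; rewrite /cube/= rV_norm_le// => /forallP yx i.
  by have := yx i; rewrite !mxE ler_norml => /andP[h1 h2]; apply/andP; split; lra.
apply: le_trans (le_lebesgue_outer h) _; apply: le_trans (leb_box_le _ _) _.
rewrite /= lee_fin (eq_bigr (fun=> 2 * s)) ?prodr_const ?card_ord// => i _.
by rewrite !mxE max_r; lra.
Qed.

Lemma leb_cube_ge x r : 0 <= r -> (((2 * r) ^+ n)%:E <= leb (cube x r : set T))%E.
Proof.
move=> r0; have h : box (Some (x - const_mx r, x + const_mx r)) `<=` cube x r.
  move=> y /= yx; rewrite /cube/= rV_norm_le//; apply/forallP => i.
  by have := yx i; rewrite !mxE ler_norml => /andP[h1 h2]; apply/andP; split; lra.
apply: le_trans (le_lebesgue_outer h); apply: le_trans (leb_box_ge _); last first.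
  by move=> i; rewrite !mxE; lra.
rewrite lee_fin (eq_bigr (fun=> 2 * r)) ?prodr_const ?card_ord// => i _.
by rewrite !mxE; lra.
Qed.

Lemma leb_cube_lty x r : (leb (cube x r : set T) < +oo)%E.
Proof.
apply: (@le_lt_trans _ _ (leb (cube x (Num.max 0 r) : set T))).
  apply: le_lebesgue_outer => y; rewrite /cube/= => h; apply: (le_trans h).
  by rewrite le_max lexx orbT.
have h0 : 0 <= Num.max 0 r by rewrite le_max lexx.
apply: (le_lt_trans (@leb_cube_le x (Num.max 0 r) (Num.max 0 r + 1) h0 _)).
  by rewrite ltrDl.
exact: ltry.
Qed.

Lemma leb_bounded_lty (E : set Rn) (r : R) : (forall x, E x -> `|x| <= r) ->
  (leb (E : set T) < +oo)%E.
Proof.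
move=> h; apply: le_lt_trans (leb_cube_lty 0 r); apply: le_lebesgue_outer => x Ex.
by rewrite /cube/= subr0; exact: h.
Qed.

Lemma leb_sigma_finite : sigma_finite [set: T] (@leb R n).
Proof.
exists (fun k => cube 0 k%:R : set T).
  apply/seteqP; split => // x _; exists (Num.trunc `|x : Rn|).+1 => //.
  by rewrite /cube/= subr0 ltW// truncnS_gt.
move=> k; split; [exact: cube_measurable|exact: leb_cube_lty].
Qed.

Lemma leb_set1 (x : Rn) : (0 < n)%N -> leb [set x : T] = 0%E.
Proof.
move=> n0; apply/eqP; rewrite eq_le measure_ge0 andbT; apply/lee_addgt0Pr => e e0.
rewrite add0e.
have [r [r0 re]] : exists r : R, 0 < r /\ (2 * r) ^+ n <= e.
  exists (Num.min 1 e / 2); split; first by rewrite divr_gt0// lt_min ltr01.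
  rewrite mulrC divfK//; case: n n0 => // m _; rewrite exprS.
  have h1 : Num.min 1 e ^+ m <= 1.
    by rewrite exprn_ile1// ?ge_min ?lexx// le_min ler01 ltW.
  apply: (@le_trans _ _ (Num.min 1 e)); last by rewrite ge_min lexx orbT.
  by apply: ler_piMr => //; rewrite le_min ler01 ltW.
apply: le_trans (_ : (leb (cube x 0 : set T) <= _)%E); last first.
  by apply: le_trans (leb_cube_le x (lexx 0) r0) _; rewrite lee_fin.
by apply: le_lebesgue_outer => y ->; rewrite /cube/= subrr normr0.
Qed.

End LebesgueRn.

HB.instance Definition _ (R : realType) (n : nat) :=
  @Measure_isSigmaFinite.Build _ (lebRn R n) R (@leb R n) (@leb_sigma_finite R n).

Import HBSimple.

(** * Real-valued integrals on an abstract measure space *)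

Section RealIntegral.
Context d (X : measurableType d) (R : realType) (mu : {measure set X -> \bar R}).
Implicit Types f g : X -> R.

Lemma ae_imp (P Q : X -> Prop) : (forall x, P x -> Q x) ->
  {ae mu, forall x, P x} -> {ae mu, forall x, Q x}.
Proof. by move=> PQ; apply: filterS => x; exact: PQ. Qed.

Lemma ae_imp2 (P Q S : X -> Prop) : (forall x, P x -> Q x -> S x) ->
  {ae mu, forall x, P x} -> {ae mu, forall x, Q x} -> {ae mu, forall x, S x}.
Proof. by move=> PQ; apply: filterS2 => x; exact: PQ. Qed.

Lemma measurable_fun_cvgT (F : nat -> X -> R) f : (forall k, measurable_fun setT (F k)) ->
  (forall x, F k x @[k --> \oo] --> f x) -> measurable_fun setT f.
Proof. by move=> mF Ff; apply: (measurable_fun_cvg mF) => x _; exact: Ff. Qed.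

Lemma ae_le_integrable f g : measurable_fun setT f -> mu.-integrable setT (EFin \o g) ->
  {ae mu, forall x, `|f x| <= g x} -> mu.-integrable setT (EFin \o f).
Proof.
move=> mf ig fg; apply/integrableP; split; first exact/measurable_EFinP.
have /integrableP[mg goo] := ig; apply: le_lt_trans goo.
apply: ae_ge0_le_integral => //.
- by apply: measurableT_comp => //; exact/measurable_EFinP.
- exact: measurableT_comp.
- by apply: ae_imp fg => x fg _ /=; rewrite lee_fin (le_trans fg)// ler_norm.
Qed.

Lemma ae_eq_Rintegral f g : measurable_fun setT f -> measurable_fun setT g ->
  {ae mu, forall x, f x = g x} -> \int[mu]_x f x = \int[mu]_x g x.
Proof.
move=> mf mg fg; rewrite /Rintegral; congr fine.
apply: ae_eq_integral => //; [exact/measurable_EFinP|exact/measurable_EFinP|].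
by apply: ae_imp fg => x /= -> _.
Qed.

Lemma Rintegral_indic (A : set X) : measurable A -> \int[mu]_x \1_A x = fine (mu A).
Proof. by move=> mA; rewrite /Rintegral integral_indic// setIT. Qed.

Lemma integrable_indic_lty (A : set X) : measurable A -> (mu A < +oo)%E ->
  mu.-integrable setT (EFin \o \1_A).
Proof.
move=> mA Aoo; apply/integrableP; split; first exact/measurable_EFinP/measurable_indic.
rewrite (eq_integral (fun x => (\1_A x)%:E)); last first.
  by move=> x _ /=; rewrite ger0_norm.
by rewrite integral_indic// setIT.
Qed.

Lemma EFin_Rintegral f : mu.-integrable setT (EFin \o f) ->
  (\int[mu]_x f x)%:E = (\int[mu]_x (f x)%:E)%E.
Proof. by move=> hf; rewrite /Rintegral fineK//; exact: integrable_fin_num. Qed.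

Lemma Rintegral_dct (F : nat -> X -> R) f g : (forall k, measurable_fun setT (F k)) ->
  measurable_fun setT f -> {ae mu, forall x, F k x @[k --> \oo] --> f x} ->
  mu.-integrable setT (EFin \o g) -> (forall k, {ae mu, forall x, `|F k x| <= g x}) ->
  mu.-integrable setT (EFin \o f) /\ \int[mu]_x F k x @[k --> \oo] --> \int[mu]_x f x.
Proof.
move=> mF mf Ff hg Fg.
have [] := @dominated_convergence _ X R mu setT measurableT
  (fun k => EFin \o F k) (EFin \o f) (EFin \o g).
- by move=> k; exact/measurable_EFinP.
- exact/measurable_EFinP.
- by apply: ae_imp Ff => x Ff _; apply: cvg_EFin => //; exact: nearW.
- exact: hg.
- by apply: ae_imp (ae_foralln Fg) => x h k _; rewrite /= lee_fin.
move=> hf _ c; split => //.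
have hF k : mu.-integrable setT (EFin \o F k) by exact: ae_le_integrable (mF k) hg (Fg k).
have : (\int[mu]_x F k x)%:E @[k --> \oo] --> (\int[mu]_x f x)%:E.
  by rewrite EFin_Rintegral//; under eq_fun do rewrite EFin_Rintegral//.
by move/fine_cvgP => [_].
Qed.

Lemma Rintegral_fatou (F : nat -> X -> R) f (C : R) :
  (forall k, mu.-integrable setT (EFin \o F k)) -> measurable_fun setT f ->
  (forall k x, 0 <= F k x) -> (forall k, \int[mu]_x F k x <= C) ->
  {ae mu, forall x, F k x @[k --> \oo] --> f x} ->
  mu.-integrable setT (EFin \o f) /\ \int[mu]_x f x <= C.
Proof.
move=> hF mf F0 FC Ff.
have mF k : measurable_fun setT (EFin \o F k) by exact: measurable_int (hF k).
have h := @fatou _ X R mu setT measurableT (fun k => EFin \o F k) mF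
  (fun k x _ => F0 k x).
have e : {ae mu, forall x, limn_einf ((fun k => EFin \o F k)^~ x) = `|(f x)%:E|%E}.
  apply: ae_imp Ff => x Ff.
  have f0 : 0 <= f x.
    rewrite -(cvg_lim _ Ff)//; apply: limr_ge; first by apply/cvg_ex; exists (f x).
    by apply: nearW => k; exact: F0.
  rewrite /= ger0_norm//.
  have /cvg_limn_einf_sup[-> _]// : (EFin \o F k) x @[k --> \oo] --> (f x)%:E.
  by apply: cvg_EFin => //; exact: nearW.
have hC : (\int[mu]_x `|(f x)%:E| <= C%:E)%E.
  rewrite (@ae_eq_integral _ _ _ mu setT (fun x => limn_einf ((fun k => EFin \o F k)^~ x)) (fun x => `|(f x)%:E|)%E measurableT).
  - apply: (le_trans h); rewrite limn_einf_lim; apply: lime_le; first exact: is_cvg_einfs.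
    apply: nearW => k; apply: ge_ereal_inf; exists (\int[mu]_x (F k x)%:E)%E.
      by exists k => //=.
    by rewrite -EFin_Rintegral// lee_fin.
  - by apply: measurableT_comp => //; exact/measurable_EFinP.
  - rewrite [X in measurable_fun _ X](_ : _ =
        (fun x => - limn_esup (-%E \o (fun k => (F k x)%:E)))%E); last first.
      by apply/funext => x; rewrite limn_esupN oppeK.
    by apply: measurableT_comp => //; apply: measurable_fun_limn_esup => k;
      apply: measurableT_comp => //; exact: mF.
  - by apply: ae_imp e => x -> _.
have hf : mu.-integrable setT (EFin \o f).
  by apply/integrableP; split; [exact/measurable_EFinP|exact: le_lt_trans hC (ltry _)].
split => //; rewrite -lee_fin EFin_Rintegral//; apply: le_trans hC.
apply: le_integral => //; first exact: (integrable_abse hf).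
by move=> x _; rewrite lee_fin ler_norm.
Qed.

Lemma integrable_indic_ltyP (A : set X) : measurable A ->
  mu.-integrable setT (EFin \o (\1_A : X -> R)) -> (mu A < +oo)%E.
Proof.
have e : measurable A -> (\int[mu]_x (EFin \o (\1_A : X -> R)) x = mu A)%E.
  by move=> mA; rewrite integral_indic ?setIT.
by move=> mA /(integrable_lty measurableT); rewrite e.
Qed.

Lemma sfun_approx_integrable f (e : R) : mu.-integrable setT (EFin \o f) -> 0 < e ->
  exists2 g : {sfun X >-> R}, mu.-integrable setT (EFin \o g) &
    \int[mu]_x `|f x - g x| <= e.
Proof.
move=> hf e0; have [g [hg _ c]] := approximation_sfun_integrable measurableT hf.
have hn k : mu.-integrable setT (EFin \o (fun x => `|f x - g k x|)).
  by apply: (integrable_norm (f := fun x => f x - g k x)); exact: (integrableB measurableT hf (hg k)).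
have c' : (\int[mu]_x `|f x - g k x|)%:E @[k --> \oo] --> (0 : R)%:E.
  move: c; apply: cvg_trans; apply: near_eq_cvg; apply: nearW => k.
  by rewrite EFin_Rintegral.
move: c' => /fine_cvgP[_ /cvgrPdist_lt/(_ e e0)[k _ /(_ k (leqnn _))]].
rewrite sub0r normrN /= => h; exists (g k); first exact: hg.
by rewrite ltW// (le_lt_trans _ h)// ler_norm.
Qed.

Section InvariantMap.
Variable phi : X -> X.
Hypothesis mphi : measurable_fun setT phi.
Hypothesis inv : forall A, measurable A -> mu (phi @^-1` A) = mu A.

Lemma ge0_integral_invariant (f : X -> \bar R) : measurable_fun setT f ->
  (forall x, 0 <= f x)%E -> (\int[mu]_x f (phi x) = \int[mu]_x f x)%E.
Proof.
move=> mf f0.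
have := @ge0_integral_pushforward _ _ X X R _ mphi mu setT f measurableT mf (fun x _ => f0 x).
by rewrite preimage_setT => <-; apply: eq_measure_integral => A mA _; exact: inv.
Qed.

Lemma integrable_invariant f : mu.-integrable setT (EFin \o f) ->
  mu.-integrable setT (EFin \o (f \o phi)).
Proof.
move=> hf; have /integrableP[mf foo] := hf; apply/integrableP; split.
  exact: measurableT_comp mf mphi.
by rewrite (ge0_integral_invariant (f := fun x => `|(f x)%:E|%E))//; exact: measurableT_comp.
Qed.

Lemma Rintegral_invariant f : mu.-integrable setT (EFin \o f) ->
  \int[mu]_x f (phi x) = \int[mu]_x f x.
Proof.
move=> hf; have hfh := integrable_invariant hf.
have mf := measurable_int _ hf.
have := @integral_pushforward _ _ X X R _ mphi mu setT _ mf hfh measurableT.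
rewrite preimage_setT /Rintegral => <-; congr fine.
by apply: eq_measure_integral => A mA _; exact: inv.
Qed.

End InvariantMap.

End RealIntegral.

(** A real integral is the finite part of an extended one, so it is 0 when the latter is infinite.
    The integrability of the sections ensures that both iterated integrals are the genuine ones. *)
Lemma Rintegral_tonelli d (X : measurableType d) (R : realType)
    (mu : {sigma_finite_measure set X -> \bar R}) (F : X -> X -> R) :
  measurable_fun setT (fun z : X * X => F z.1 z.2) ->
  (forall x y, 0 <= F x y) ->
  (forall y, mu.-integrable setT (EFin \o F^~ y)) ->
  mu.-integrable setT (EFin \o (fun y => \int[mu]_x F x y)) ->
  (forall x, mu.-integrable setT (EFin \o F x)) ->
  mu.-integrable setT (EFin \o (fun x => \int[mu]_y F x y)) /\
  \int[mu]_x \int[mu]_y F x y = \int[mu]_y \int[mu]_x F x y.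
Proof.
move=> mF F0 iF1 iF2 iF3.
pose G (z : X * X) := (F z.1 z.2)%:E.
have mG : measurable_fun setT G by apply/measurable_EFinP.
have G0 z : (0 <= G z)%E by rewrite lee_fin.
have := fubini_tonelli (m1 := mu) (m2 := mu) G mG G0.
have mGx := measurable_fun_fubini_tonelli_F (m2 := mu) G mG G0.
have e1 x : (\int[mu]_y G (x, y) = (\int[mu]_y F x y)%:E)%E by rewrite EFin_Rintegral.
have e2 y : (\int[mu]_x G (x, y) = (\int[mu]_x F x y)%:E)%E.
  by rewrite (EFin_Rintegral (iF1 y)).
under eq_integral do rewrite e1; under [in X in _ = X]eq_integral do rewrite e2.
rewrite -(EFin_Rintegral iF2) => e.
have h : mu.-integrable setT (EFin \o (fun x => \int[mu]_y F x y)).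
  apply/integrableP; split.
    by move: mGx; apply: eq_measurable_fun => x _; rewrite /= /fubini_F e1.
  rewrite (eq_integral (fun x => (\int[mu]_y F x y)%:E)); last first.
    by move=> x _ /=; rewrite ger0_norm//; exact: Rintegral_ge0.
  by rewrite e ltry.
by split => //; apply: EFin_inj; rewrite EFin_Rintegral.
Qed.

(** * The Lebesgue integral on R^n *)

Section LebesgueIntegral.
Context {R : realType} {n : nat}.
Local Notation Rn := 'rV[R]_n.
Local Notation T := (lebRn R n).
Implicit Types f g h : Rn -> R.

(** The four notions [lae], [lmeas], [lint] and [intg] hide the carrier [lebRn R n] of the
    sigma-algebra, so that later statements concern plain functions on ['rV[R]_n]. *)
Definition lae (P : Rn -> Prop) := {ae (@leb R n), forall x : T, P x}.
Definition lmeas f := measurable_fun [set: T] (f : T -> R).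
Definition lint f := (@leb R n).-integrable [set: T] (EFin \o (f : T -> R)).
Definition intg f : R := \int[@leb R n]_x (f : T -> R) x.

Lemma laeW (P : Rn -> Prop) : (forall x, P x) -> lae P.
Proof. by move=> h; apply: aeW => x; exact: h. Qed.

Lemma lae_imp (P Q : Rn -> Prop) : (forall x, P x -> Q x) -> lae P -> lae Q.
Proof. exact: (@ae_imp _ T R (@leb R n) P Q). Qed.

Lemma lae_imp2 (P Q S : Rn -> Prop) : (forall x, P x -> Q x -> S x) ->
  lae P -> lae Q -> lae S.
Proof. exact: (@ae_imp2 _ T R (@leb R n) P Q S). Qed.

Lemma lae_nat (P : nat -> Rn -> Prop) : (forall k, lae (P k)) ->
  lae (fun x => forall k, P k x).
Proof. by move=> h; exact: ae_foralln. Qed.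

Lemma lae_fin (I : finType) (P : I -> Rn -> Prop) : (forall k, lae (P k)) ->
  lae (fun x => forall k, P k x).
Proof.
move=> h; pose Q k x := if insub k is Some i then P (enum_val (i : 'I_#|I|)) x else True.
have : lae (fun x => forall k, Q k x).
  by apply: lae_nat => k; rewrite /Q; case: insub => [i|]; [exact: h|exact: laeW].
apply: lae_imp => x Qx k; have := Qx (enum_rank k).
by rewrite /Q insubT//= => lt; rewrite (_ : Sub _ _ = enum_rank k) ?enum_rankK//; exact: val_inj.
Qed.

(** Completeness of Lebesgue measure: a set of outer measure zero splits every set additively, hence
    it is measurable in the sense of Caratheodory. *)
Lemma lae_measure0 (N : set Rn) : leb (N : set T) = 0%E -> lae (fun x => ~ N x).
Proof.
move=> N0; have mN : measurable (N : set T).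
  apply: le_caratheodory_measurable => X /=.
  have -> : lebesgue_outer (X `&` N) = 0%E.
    apply/eqP; rewrite eq_le lebesgue_outer_ge0 andbT -N0.
    by apply: le_lebesgue_outer => x [].
  by rewrite add0e; apply: le_lebesgue_outer => x [].
by exists N; split => // x /=; exact: contrapT.
Qed.

Lemma lint_meas f : lint f -> lmeas f.
Proof. by move=> /measurable_int/measurable_EFinP. Qed.

Lemma lmeas_cst c : lmeas (fun=> c).
Proof. exact: measurable_cst. Qed.

Lemma lmeasD f g : lmeas f -> lmeas g -> lmeas (fun x => f x + g x).
Proof. exact: measurable_funD. Qed.

Lemma lmeasB f g : lmeas f -> lmeas g -> lmeas (fun x => f x - g x).
Proof. exact: measurable_funB. Qed.

Lemma lmeasM f g : lmeas f -> lmeas g -> lmeas (fun x => f x * g x).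
Proof. exact: measurable_funM. Qed.

Lemma lmeasX f k : lmeas f -> lmeas (fun x => f x ^+ k).
Proof. by move=> mf; exact: measurable_funX. Qed.

Lemma lmeas_norm f : lmeas f -> lmeas (fun x => `|f x|).
Proof. by move=> mf; exact: measurableT_comp. Qed.

Lemma lmeas_max f g : lmeas f -> lmeas g -> lmeas (fun x => Num.max (f x) (g x)).
Proof. exact: measurable_maxr. Qed.

Lemma lmeas_min f g : lmeas f -> lmeas g -> lmeas (fun x => Num.min (f x) (g x)).
Proof. exact: measurable_minr. Qed.

Lemma lmeas_sum (I : Type) (s : seq I) (F : I -> Rn -> R) :
  (forall i, lmeas (F i)) -> lmeas (fun x => \sum_(i <- s) F i x).
Proof. by move=> h; exact: measurable_sum. Qed.

Lemma lmeas_comp (k : R -> R) f : continuous k -> lmeas f -> lmeas (fun x => k (f x)).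
Proof. by move=> ck mf; apply: measurableT_comp => //; exact: continuous_measurable_fun. Qed.

Lemma lmeas_mcomp (k : R -> R) f : measurable_fun setT k -> lmeas f -> lmeas (fun x => k (f x)).
Proof. by move=> ck mf; exact: measurableT_comp. Qed.

Lemma lmeas_cont f : continuous f -> lmeas f.
Proof. exact: continuous_measurable. Qed.

Lemma lmeas_indic (A : set Rn) : measurable (A : set T) -> lmeas \1_A.
Proof. by move=> mA; exact: measurable_indic. Qed.

Lemma lmeas_restrict (A : set Rn) f : measurable (A : set T) ->
  measurable_on A f <-> lmeas (f \_ A).
Proof.
move=> mA; have := @measurable_restrict _ _ T R A setT f mA measurableT.
by rewrite setTI.
Qed.

Lemma lmeas_cvg (F : nat -> Rn -> R) f : (forall k, lmeas (F k)) ->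
  (forall x, F k x @[k --> \oo] --> f x) -> lmeas f.
Proof. exact: (@measurable_fun_cvgT _ T R F f). Qed.

Lemma lint_dom f g : lmeas f -> lint g -> lae (fun x => `|f x| <= g x) -> lint f.
Proof. exact: (@ae_le_integrable _ T R (@leb R n) f g). Qed.

Lemma lint0 : lint (fun=> 0).
Proof. exact: integrable0. Qed.

Lemma lintD f g : lint f -> lint g -> lint (fun x => f x + g x).
Proof. by move=> hf hg; have := integrableD measurableT hf hg. Qed.

Lemma lintB f g : lint f -> lint g -> lint (fun x => f x - g x).
Proof. by move=> hf hg; have := integrableB measurableT hf hg. Qed.

Lemma lintZ c f : lint f -> lint (fun x => c * f x).
Proof. by move=> hf; have := integrableZl measurableT c hf. Qed.

Lemma lint_norm f : lint f -> lint (fun x => `|f x|).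
Proof. exact: integrable_norm. Qed.

Lemma lint_sum (I : Type) (s : seq I) (F : I -> Rn -> R) :
  (forall i, lint (F i)) -> lint (fun x => \sum_(i <- s) F i x).
Proof.
move=> h; elim: s => [|i s ih].
  by under eq_fun do rewrite big_nil; exact: lint0.
by under eq_fun do rewrite big_cons; exact: lintD.
Qed.

Lemma lintM_bounded c f g : lmeas g -> (forall x, `|g x| <= c) -> lint f ->
  lint (fun x => g x * f x).
Proof.
move=> mg gc hf; apply: (@lint_dom _ (fun x => c * `|f x|)).
- by apply: lmeasM => //; exact: lint_meas.
- exact/lintZ/lint_norm.
- by apply: laeW => x; rewrite normrM ler_wpM2r.
Qed.

Lemma intg_ae_eq f g : lmeas f -> lmeas g -> lae (fun x => f x = g x) -> intg f = intg g.
Proof. exact: (@ae_eq_Rintegral _ T R (@leb R n) f g). Qed.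

Lemma eq_intg f g : f =1 g -> intg f = intg g.
Proof. by move=> fg; congr intg; exact/funext. Qed.

Lemma EFin_intg f : lint f -> (intg f)%:E = (\int[@leb R n]_x (f x)%:E)%E.
Proof. exact: (@EFin_Rintegral _ T R (@leb R n) f). Qed.

Lemma intgD f g : lint f -> lint g -> intg (fun x => f x + g x) = intg f + intg g.
Proof. by move=> hf hg; rewrite /intg RintegralD. Qed.

Lemma intgB f g : lint f -> lint g -> intg (fun x => f x - g x) = intg f - intg g.
Proof. by move=> hf hg; rewrite /intg RintegralB. Qed.

Lemma intgZ c f : lint f -> intg (fun x => c * f x) = c * intg f.
Proof. by move=> hf; rewrite /intg RintegralZl. Qed.

Lemma intgN f : lint f -> intg (fun x => - f x) = - intg f.
Proof. by move=> hf; under eq_intg do rewrite -mulN1r; rewrite intgZ// mulN1r. Qed.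

Lemma intg0 : intg (fun=> 0) = 0.
Proof. by rewrite /intg Rintegral_cst// mul0r. Qed.

Lemma intg_sum (I : Type) (s : seq I) (F : I -> Rn -> R) :
  (forall i, lint (F i)) -> intg (fun x => \sum_(i <- s) F i x) = \sum_(i <- s) intg (F i).
Proof.
move=> h; elim: s => [|i s ih].
  by under eq_intg do rewrite big_nil; rewrite big_nil intg0.
by under eq_intg do rewrite big_cons; rewrite big_cons intgD ?ih//; exact: lint_sum.
Qed.

Lemma le_intg f g : lint f -> lint g -> lae (fun x => f x <= g x) -> intg f <= intg g.
Proof.
move=> hf hg fg; rewrite -subr_ge0 -intgB//.
have hgf := lintB hg hf.
rewrite (@intg_ae_eq _ (fun x => Num.max 0 (g x - f x))); last 3 first.
- exact: lint_meas.
- by apply: lmeas_max; [exact: lmeas_cst|exact: lint_meas].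
- by apply: lae_imp fg => x fg; rewrite max_r// subr_ge0.
by apply: Rintegral_ge0 => x _; rewrite le_max lexx.
Qed.

Lemma intg_ge0 f : (forall x, 0 <= f x) -> 0 <= intg f.
Proof. by move=> h; exact: Rintegral_ge0. Qed.

Lemma le_abs_intg f : lint f -> `|intg f| <= intg (fun x => `|f x|).
Proof. by move=> hf; exact: le_normr_Rintegral. Qed.

Lemma lint_indic (A : set Rn) : measurable (A : set T) -> (leb (A : set T) < +oo)%E ->
  lint \1_A.
Proof. exact: (@integrable_indic_lty _ T R (@leb R n) A). Qed.

Lemma intg_indic (A : set Rn) : measurable (A : set T) -> intg \1_A = fine (leb (A : set T)).
Proof. exact: (@Rintegral_indic _ T R (@leb R n) A). Qed.

Lemma lint_indic_lty (A : set Rn) : measurable (A : set T) -> lint \1_A ->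
  (leb (A : set T) < +oo)%E.
Proof. exact: (@integrable_indic_ltyP _ T R (@leb R n) A). Qed.

Lemma lint_sfun_approx f (e : R) : lint f -> 0 < e ->
  exists2 g : {sfun T >-> R}, lint (g : Rn -> R) & intg (fun x => `|f x - g x|) <= e.
Proof. exact: (@sfun_approx_integrable _ T R (@leb R n) f e). Qed.

Lemma lint_bounded f (M r : R) : lmeas f -> (forall x, `|f x| <= M) ->
  (forall x, r < `|x| -> f x = 0) -> lint f.
Proof.
move=> mf fM f0; apply: (@lint_dom _ (fun x => M * \1_(cube 0 r) x)) => //.
  by apply/lintZ/lint_indic; [exact: cube_measurable|exact: leb_cube_lty].
apply: laeW => x; rewrite indicE; have [xr|xr] := boolP (x \in _); rewrite ?mulr1//.
by rewrite f0 ?normr0 ?mulr0// ltNge; apply: contra xr => xr; rewrite inE /cube/= subr0.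
Qed.

Lemma intg_dct (F : nat -> Rn -> R) f g : (forall k, lmeas (F k)) -> lmeas f ->
  lae (fun x => F k x @[k --> \oo] --> f x) -> lint g ->
  (forall k, lae (fun x => `|F k x| <= g x)) ->
  lint f /\ intg (F k) @[k --> \oo] --> intg f.
Proof. exact: (@Rintegral_dct _ T R (@leb R n) F f g). Qed.

Lemma intg_fatou (F : nat -> Rn -> R) f C : (forall k, lint (F k)) -> lmeas f ->
  (forall k x, 0 <= F k x) -> (forall k, intg (F k) <= C) ->
  lae (fun x => F k x @[k --> \oo] --> f x) -> lint f /\ intg f <= C.
Proof. exact: (@Rintegral_fatou _ T R (@leb R n) F f C). Qed.

Lemma lint_shift (h : Rn) f : lint f -> lint (fun x => f (x + h)).
Proof.
exact: (@integrable_invariant _ T R (@leb R n) _ (@measurable_shift R n h)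
  (fun A _ => leb_shift h A) f).
Qed.

Lemma intg_shift (h : Rn) f : lint f -> intg (fun x => f (x + h)) = intg f.
Proof.
exact: (@Rintegral_invariant _ T R (@leb R n) _ (@measurable_shift R n h)
  (fun A _ => leb_shift h A) f).
Qed.

Lemma lint_tonelli (F : Rn -> Rn -> R) :
  measurable_fun [set: T * T] (fun z : T * T => F z.1 z.2) ->
  (forall x y, 0 <= F x y) ->
  (forall y, lint (F^~ y)) -> lint (fun y => intg (F^~ y)) -> (forall x, lint (F x)) ->
  lint (fun x => intg (F x)) /\ intg (fun x => intg (F x)) = intg (fun y => intg (F^~ y)).
Proof.
exact: (@Rintegral_tonelli _ T R (@leb R n) F).
Qed.

Lemma measurable_fst_comp f : lmeas f -> measurable_fun [set: T * T] (fun z : T * T => f z.1).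
Proof. by move=> mf; apply: (measurableT_comp mf); exact: measurable_fst. Qed.

Lemma measurable_snd_comp f : lmeas f -> measurable_fun [set: T * T] (fun z : T * T => f z.2).
Proof. by move=> mf; apply: (measurableT_comp mf); exact: measurable_snd. Qed.

(** Joint measurability of convolution integrands. Each coordinate of the subtraction is measurable
    on the product, so preimages of open sets are; for continuous [f] no preimage of a null set
    under subtraction has to be considered. *)
Lemma measurable_sub_comp f : continuous f ->
  measurable_fun [set: T * T] (fun z : T * T => f (z.1 - z.2 : Rn)).
Proof.
move=> cf; apply: (@measurable_cont_coord R n _ (T * T)%type (fun z : T * T => (z.1 - z.2 : Rn)) f) => // i.
rewrite (_ : (fun x : T * T => _) =
   (fun x : T * T => (x.1 : Rn) 0 i - (x.2 : Rn) 0 i)); last first.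
  by apply/funext => x; rewrite !mxE.
apply: measurable_funB.
  exact: (measurable_fst_comp (measurable_coord i)).
exact: (measurable_snd_comp (measurable_coord i)).
Qed.

End LebesgueIntegral.

Opaque intg lint lmeas lae.

(** A quadratic remainder is a form of differentiability that survives integration. It serves to
    differentiate convolutions under the integral sign, and to differentiate the bump functions at
    0. *)
Lemma diff_quadratic (R : realType) (V W : normedModType R) (f : V -> W)
    (L : {linear V -> W}) x (C : R) : continuous L ->
  (forall h, `|h| <= 1 -> `|f (h + x) - f x - L h| <= C * `|h| ^+ 2) ->
  differentiable f x /\ 'd f x = L :> (V -> W).
Proof.
move=> Lc hC.
have hL : f \o shift x = cst (f x) + L +o_ 0 id.
  apply/eqaddoP => e e0; near=> h.
  rewrite /= [X in `|X|](_ : _ = f (h + x) - f x - L h); last first.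
    by rewrite opprD addrA.
  have h1 : `|h| <= 1 by near: h; apply: nbhs0_le.
  apply: (le_trans (hC h h1)); rewrite expr2 mulrA ler_wpM2r//.
  have C1 : 0 < `|C| + 1 by rewrite ltr_wpDl.
  apply: (@le_trans _ _ ((`|C| + 1) * `|h|)).
    by rewrite ler_wpM2r// (le_trans (ler_norm _))// lerDl.
  rewrite mulrC -ler_pdivlMr//; near: h; apply: nbhs0_le; exact: divr_gt0.
have e := diff_unique Lc hL.
by split => //; apply/diff_locallyP; split; rewrite e.
Unshelve. all: by end_near. Qed.

(** * Smooth functions *)

Section SmoothCalculus.
Context {R : realType} {n : nat}.
Local Notation Rn := 'rV[R]_n.
Implicit Types (f g : Rn -> R) (x y z v : Rn).

Lemma dotv_continuous (c : Rn) : continuous (dotv c).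
Proof.
rewrite /dotv; elim: (index_enum _) => [|i s ih].
  by under eq_fun do rewrite big_nil; exact: cst_continuous.
have h1 : continuous (fun y : Rn => c 0 i * y 0 i).
  by move=> y; apply: continuousM; [exact: cst_continuous|exact: coord_continuous].
by under eq_fun do rewrite big_cons; move=> x; exact: continuousD (h1 x) (ih x).
Qed.

Lemma dotv_linear (c : Rn) : linear (dotv c).
Proof.
move=> a x y; rewrite /dotv /= scaler_sumr -big_split/=; apply: eq_bigr => i _.
by rewrite !mxE mulrDr mulrCA.
Qed.

Lemma differentiable_quadratic f x (c : Rn) (C : R) :
  (forall h, `|h| <= 1 -> `|f (h + x) - f x - dotv c h| <= C * `|h| ^+ 2) ->
  differentiable f x /\ forall v, 'D_v f x = dotv c v.
Proof.
move=> hC.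
pose linM := GRing.isLinear.Build _ _ _ _ _ (@dotv_linear c).
pose L : {linear Rn -> R} := HB.pack (dotv c) linM.
have [df e] := @diff_quadratic R Rn R f L x C (@dotv_continuous c) hC.
by split => // v; rewrite deriveE// e.
Qed.

Lemma rV_sum_coord (v : Rn) : v = \sum_(i < n) v 0 i *: delta_mx 0 i.
Proof. exact: row_sum_delta. Qed.

Lemma deriveE_partial f x v : differentiable f x ->
  'D_v f x = \sum_(i < n) v 0 i * partial i f x.
Proof.
move=> df; rewrite deriveE// [in LHS](rV_sum_coord v) linear_sum.
by apply: eq_bigr => i _; rewrite linearZ/= /partial deriveE.
Qed.

Lemma is_derive_line f x v (t : R) : differentiable f (x + t *: v) ->
  is_derive t 1 (fun s : R => f (x + s *: v)) ('D_v f (x + t *: v)).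
Proof.
move=> df; have dd := diff_derivable (v := v) df.
have e : (fun h : R => h^-1 *: (((fun s : R => f (x + s *: v)) \o shift t) (h *: 1) - f (x + t *: v))) =
   (fun h : R => h^-1 *: ((f \o shift (x + t *: v)) (h *: v) - f (x + t *: v))).
  apply/funext => h /=; congr (_ *: (f _ - _)).
  by rewrite scalerDl addrCA -scalerA scale1r.
by apply: DeriveDef; rewrite /derivable /derive e.
Qed.

Lemma MVT_rV f x h : (forall y, differentiable f y) ->
  exists2 t : R, 0 <= t <= 1 &
    f (x + h) - f x = \sum_(i < n) h 0 i * partial i f (x + t *: h).
Proof.
move=> df.
have d (t : R) : is_derive t 1 (fun s : R => f (x + s *: h)) ('D_h f (x + t *: h)).
  exact: is_derive_line.
have c : {within `[(0:R), 1], continuous (fun s : R => f (x + s *: h))}.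
  apply: continuous_subspaceT => s.
  by apply: differentiable_continuous; apply/derivable1_diffP; have [] := d s.
have [t t01] := MVT ltr01 (fun t _ => d t) c.
rewrite scale1r scale0r addr0 subr0 mulr1 => h1.
exists t; last by rewrite h1 deriveE_partial.
by move: t01; rewrite in_itv/= => /andP[/ltW -> /ltW ->].
Qed.

Lemma diff_compR (k : R -> R) f x (dk : R) : differentiable f x ->
  is_derive (f x) 1 k dk ->
  differentiable (k \o f) x /\ forall v, 'D_v (k \o f) x = dk * 'D_v f x.
Proof.
move=> df hk; have dk' : differentiable k (f x) by apply/derivable1_diffP; case: hk.
split; first exact: differentiable_comp.
move=> v; rewrite deriveE; last exact: differentiable_comp.
have e : 'd k (f x) = ( *:%R^~ (k^`()%classic (f x))) :> (R -> R) by apply: deriv1E; case: hk.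
by rewrite diff_comp//= e derive1E derive_val mulrC -deriveE.
Qed.

(** Smoothness is graded by order because the derivative of a product, inverse or composite at order
    [k.+1] again contains the original functions, which are available at order [k] by induction. *)
Fixpoint smooth_upto (k : nat) f : Prop :=
  if k is k'.+1 then
    (forall x, differentiable f x) /\ forall i, smooth_upto k' (partial i f)
  else forall x, differentiable f x.

(** In [foldr] the last index of the list is the innermost derivative, which is the one that
    [smooth_upto] peels off; hence the decomposition of lists by [rcons]. *)
Lemma smoothP f : smooth f <-> forall k, smooth_upto k f.
Proof.
split=> [h k|h s].
  elim: k f h => [|k ih] f h; first exact: (h [::]).
  split; first exact: (h [::]).
  by move=> i; apply: ih => s x; have := h (rcons s i) x; rewrite foldr_rcons.
elim/last_ind: s f {h}(h (size s)) => [|s i ih] f; first exact.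
by rewrite size_rcons foldr_rcons => -[_ h]; apply: ih; exact: h.
Qed.

Lemma smooth_uptoW k f : smooth_upto k.+1 f -> smooth_upto k f.
Proof.
by elim: k f => [|k ih] f [df h] //; split => // i; apply: ih; exact: h.
Qed.

Lemma partialD i f g : (forall x, differentiable f x) -> (forall x, differentiable g x) ->
  partial i (fun x => f x + g x) = (fun x => partial i f x + partial i g x).
Proof.
move=> df dg; apply/funext => x; rewrite /partial.
by rewrite -[LHS]/('D_(delta_mx 0 i) (f + g) x) deriveD//; exact: diff_derivable.
Qed.

Lemma partialN i f : (forall x, differentiable f x) ->
  partial i (fun x => - f x) = (fun x => - partial i f x).
Proof.
move=> df; apply/funext => x; rewrite /partial.
by rewrite -[LHS]/('D_(delta_mx 0 i) (- f) x) deriveN//; exact: diff_derivable.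
Qed.

Lemma partialM i f g : (forall x, differentiable f x) -> (forall x, differentiable g x) ->
  partial i (fun x => f x * g x) = (fun x => f x * partial i g x + g x * partial i f x).
Proof.
move=> df dg; apply/funext => x; rewrite /partial.
by rewrite -[LHS]/('D_(delta_mx 0 i) (f * g) x) deriveM//; exact: diff_derivable.
Qed.

Lemma partial_cst i (c : R) : partial i (fun=> c : R) = (fun=> 0) :> (Rn -> R).
Proof. by apply/funext => x; exact: derive_cst. Qed.

Lemma partial_coord i j : partial i (fun x => x 0 j) = (fun=> (i == j)%:R).
Proof.
apply/funext => x; rewrite /partial deriveE; last exact: differentiable_coord.
have lin : linear (fun x : Rn => x 0 j) by move=> a y z; rewrite !mxE.
pose linM := GRing.isLinear.Build _ _ _ _ _ lin.
pose L : {linear Rn -> R} := HB.pack (fun x : Rn => x 0 j) linM.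
rewrite (_ : (fun x : Rn => x 0 j) = L)// diff_lin; last exact: coord_continuous.
by rewrite /L/= mxE eqxx eq_sym.
Qed.

Lemma partial_comp i (k dk : R -> R) f : (forall x, differentiable f x) ->
  (forall x, is_derive (f x) 1 k (dk (f x))) ->
  (forall x, differentiable (k \o f) x) /\
  partial i (fun x => k (f x)) = (fun x => dk (f x) * partial i f x).
Proof.
move=> df dk'; split; first by move=> x; have [] := diff_compR (df x) (dk' x).
by apply/funext => x; have [_] := diff_compR (df x) (dk' x); exact.
Qed.

Lemma smooth_upto_cst k (c : R) : smooth_upto k (fun=> c).
Proof.
elim: k c => [|k ih] c; first by move=> x; exact: differentiable_cst.
by split => [x|i]; [exact: differentiable_cst|rewrite partial_cst].
Qed.

Lemma smooth_upto_coord k i : smooth_upto k (fun x => x 0 i).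
Proof.
case: k => [|k]; first by move=> x; exact: differentiable_coord.
split; first by move=> x; exact: differentiable_coord.
by move=> j; rewrite partial_coord; exact: smooth_upto_cst.
Qed.

Lemma smooth_uptoD k f g : smooth_upto k f -> smooth_upto k g ->
  smooth_upto k (fun x => f x + g x).
Proof.
elim: k f g => [|k ih] f g; first by move=> df dg x; exact: differentiableD.
move=> [df hf] [dg hg]; split => [x|i]; first exact: differentiableD.
by rewrite partialD//; apply: ih; [exact: hf|exact: hg].
Qed.

Lemma smooth_uptoN k f : smooth_upto k f -> smooth_upto k (fun x => - f x).
Proof.
elim: k f => [|k ih] f; first by move=> df x; exact: differentiableN.
move=> [df hf]; split => [x|i]; first exact: differentiableN.
by rewrite partialN//; apply: ih; exact: hf.
Qed.

Lemma smooth_uptoM k f g : smooth_upto k f -> smooth_upto k g ->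
  smooth_upto k (fun x => f x * g x).
Proof.
elim: k f g => [|k ih] f g; first by move=> df dg x; exact: differentiableM.
move=> sf sg; have [df hf] := sf; have [dg hg] := sg.
split => [x|i]; first exact: differentiableM.
rewrite partialM//; apply: smooth_uptoD; apply: ih; [|exact: hg| |exact: hf];
  exact: smooth_uptoW.
Qed.

Lemma partialV i f : (forall x, f x != 0) -> (forall x, differentiable f x) ->
  (forall x, differentiable (fun x => (f x)^-1) x) /\
  partial i (fun x => (f x)^-1) = (fun x => - ((f x)^-1 * (f x)^-1) * partial i f x).
Proof.
move=> f0 df.
apply: (@partial_comp i (fun t => t^-1) (fun t => - (t^-1 * t^-1)) f df) => x.
apply: is_derive_eq; first exact: (@is_deriveV R (fun y : R => y) (f x) 1 1 (f0 x)).
by rewrite /GRing.scale/= mulr1 expr2 invfM.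
Qed.

Lemma smooth_uptoV k f : (forall x, f x != 0) -> smooth_upto k f ->
  smooth_upto k (fun x => (f x)^-1).
Proof.
move=> f0; elim: k f f0 => [|k ih] f f0.
  by move=> df x; apply: differentiableV.
move=> sf; have [df hf] := sf; split => [x|i]; first exact: differentiableV.
have [_ ->] := partialV i f0 df.
have hV : smooth_upto k (fun x => (f x)^-1) by apply: ih => //; exact: smooth_uptoW.
by apply: smooth_uptoM; [apply: smooth_uptoN; exact: smooth_uptoM|exact: hf].
Qed.

Lemma partial_sqrt i f : (forall x, 0 < f x) -> (forall x, differentiable f x) ->
  (forall x, differentiable (fun x => Num.sqrt (f x)) x) /\
  partial i (fun x => Num.sqrt (f x)) = (fun x => (2 * Num.sqrt (f x))^-1 * partial i f x).
Proof.
move=> f0 df; apply: (@partial_comp i Num.sqrt (fun t => (2 * Num.sqrt t)^-1) f df) => x.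
exact: is_derive1_sqrt.
Qed.

Lemma differentiable_sqrt f x : 0 < f x -> differentiable f x ->
  differentiable (fun x => Num.sqrt (f x)) x.
Proof.
by move=> f0 df; have [] := diff_compR df (is_derive1_sqrt f0).
Qed.

Lemma smooth_upto_sqrt k f : (forall x, 0 < f x) -> smooth_upto k f ->
  smooth_upto k (fun x => Num.sqrt (f x)).
Proof.
move=> f0; elim: k f f0 => [|k ih] f f0.
  by move=> df x; apply: differentiable_sqrt.
move=> sf; have [df hf] := sf; split => [x|i]; first exact: differentiable_sqrt.
have [_ ->] := partial_sqrt i f0 df.
apply: smooth_uptoM; last exact: hf.
apply: smooth_uptoV; first by move=> x; rewrite mulf_neq0// sqrtr_eq0 -ltNge.
by apply: smooth_uptoM; [exact: smooth_upto_cst|apply: ih => //; exact: smooth_uptoW].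
Qed.

(* The functions [t^-m exp (-1/t)], extended by 0 to the left of 0: this family
   is closed under differentiation up to linear combinations. *)
Definition bump1 (m : nat) (t : R) : R := if 0 < t then t^-1 ^+ m * expR (- t^-1) else 0.

Lemma bump1_ge0 m t : 0 <= bump1 m t.
Proof. by rewrite /bump1; case: ifPn => // t0; rewrite mulr_ge0// ?expR_ge0// exprn_ge0// invr_ge0 ltW. Qed.

Lemma bump1_gt0 m t : 0 < t -> 0 < bump1 m t.
Proof. by move=> t0; rewrite /bump1 t0 mulr_gt0// ?expR_gt0// exprn_gt0// invr_gt0. Qed.

(** The term of order [m.+2] in the series of [exp (1/t)] beats [t^-m] with a factor [t^2] to spare,
    which is the quadratic remainder that [diff_quadratic] asks for at 0. *)
Lemma bump1_le m t : 0 < t -> bump1 m t <= (m.+2)`!%:R * t ^+ 2.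
Proof.
move=> t0; rewrite /bump1 t0 expRN.
have h : t^-1 ^+ m.+2 / (m.+2)`!%:R <= expR t^-1.
  have := @expR_ge1Dxn R t^-1 m.+1; rewrite invr_ge0 (ltW t0) => /(_ isT).
  by apply: le_trans; rewrite lerDr.
rewrite ler_pdivrMr ?expR_gt0//.
apply: (@le_trans _ _ ((m.+2)`!%:R * t ^+ 2 * (t^-1 ^+ m.+2 / (m.+2)`!%:R))); last first.
  by rewrite ler_wpM2l// mulr_ge0// exprn_ge0// ltW.
rewrite le_eqVlt; apply/orP; left; apply/eqP.
have f0 : (m.+2)`!%:R != 0 :> R by rewrite pnatr_eq0 -lt0n fact_gt0.
have tn0 : t != 0 by rewrite gt_eqF.
rewrite -(addn2 m) exprD addn2; move: (_`!%:R) f0 (t^-1 ^+ m) => F f0 G.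
by field; rewrite tn0 f0.
Qed.

Lemma is_derive_expVN m (t : R) : 0 < t ->
  is_derive t 1 (fun s : R => s^-1 ^+ m * expR (- s^-1))
    (- m%:R * (t^-1 ^+ m.+1 * expR (- t^-1)) + t^-1 ^+ m.+2 * expR (- t^-1)).
Proof.
move=> t0; have tn0 : t != 0 by rewrite gt_eqF.
have dV : is_derive t 1 (fun y : R => y^-1) (- t ^- 2).
  apply: is_derive_eq; first exact: (@is_deriveV R (fun y : R => y) t 1 1 tn0).
  by rewrite /GRing.scale/= mulr1.
elim: m => [|m ih].
  have : is_derive t 1 (expR \o (fun y : R => - y^-1)) (expR (- t^-1) *: - - t ^- 2).
    by apply: is_derive1_comp.
  rewrite (_ : expR \o _ = (fun s : R => s^-1 ^+ 0 * expR (- s^-1))); last first.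
    by apply/funext => s /=; rewrite expr0 mul1r.
  move=> h; apply: is_derive_eq; rewrite opprK /GRing.scale/=.
  by field.
rewrite (_ : (fun s : R => _) = (fun y : R => y^-1) * (fun s : R => s^-1 ^+ m * expR (- s^-1))).
    by apply: is_derive_eq; rewrite /GRing.scale/= !exprS -natr1; field.
by apply/funext => s; rewrite exprS -mulrA.
Qed.

Lemma is_derive_bump1 m (t : R) :
  is_derive t 1 (bump1 m) (- m%:R * bump1 m.+1 t + bump1 m.+2 t).
Proof.
have [t0|t0|<-] := ltrgtP 0 t.
- rewrite {2 3}/bump1 t0; apply: near_eq_is_derive (is_derive_expVN m t0).
  by near=> s; rewrite /bump1 ifT//; near: s; exact: lt_nbhsr.
- rewrite {2 3}/bump1 ltNge (ltW t0)/= mulr0 addr0.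
  apply: (near_eq_is_derive _ (is_derive_cst 0 t 1)).
  near=> s; rewrite /bump1 ifF//; apply/negbTE; rewrite -leNgt ltW//.
  by near: s; exact: lt_nbhsl.
- rewrite {2 3}/bump1 ltxx mulr0 addr0.
  have h0 h : `|h| <= 1 -> `|bump1 m (h + 0) - bump1 m 0 - (\0 : {linear R -> R}) h| <= (m.+2)`!%:R * `|h| ^+ 2.
    move=> _; rewrite /= addr0 {2}/bump1 ltxx !subr0 ger0_norm ?bump1_ge0//.
    have [hp|hn] := ltP 0 h; first by rewrite gtr0_norm//; exact: bump1_le.
    by rewrite /bump1 ltNge hn/= mulr_ge0.
  have [d e] := @diff_quadratic R R R (bump1 m) (\0 : {linear R -> R}) 0 _ (@cst_continuous _ _ _) h0.
  by apply: DeriveDef; [exact: diff_derivable|rewrite deriveE// e].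
Unshelve. all: by end_near. Qed.

Lemma smooth_upto_bump1 k m f : smooth_upto k f -> smooth_upto k (fun x => bump1 m (f x)).
Proof.
have d g x : differentiable g x -> differentiable (fun x => bump1 m (g x)) x.
  by move=> dg; have [] := diff_compR dg (is_derive_bump1 m (g x)).
elim: k m f {d} => [|k ih] m f.
  by move=> df x; have [] := diff_compR (df x) (is_derive_bump1 m (f x)).
move=> sf; have [df hf] := sf.
have [d e] : (forall x, differentiable (bump1 m \o f) x) /\ forall i,
  partial i (fun x => bump1 m (f x)) =
  (fun x => (- m%:R * bump1 m.+1 (f x) + bump1 m.+2 (f x)) * partial i f x).
  split; first by move=> x; have [] := diff_compR (df x) (is_derive_bump1 m (f x)).
  by move=> i; have [] := @partial_comp i (bump1 m) (fun t => - m%:R * bump1 m.+1 t + bump1 m.+2 t) f df (fun x => is_derive_bump1 m (f x)).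
split => // i; rewrite e; apply: smooth_uptoM; last exact: hf.
have sf' := smooth_uptoW sf.
apply: smooth_uptoD; last exact: ih.
by apply: smooth_uptoM; [exact: smooth_upto_cst|exact: ih].
Qed.

Lemma smooth_cst (c : R) : smooth (fun _ : Rn => c).
Proof. by apply/smoothP => k; exact: smooth_upto_cst. Qed.

Lemma smooth_coord i : smooth (fun x : Rn => x 0 i).
Proof. by apply/smoothP => k; exact: smooth_upto_coord. Qed.

Lemma smoothD f g : smooth f -> smooth g -> smooth (fun x => f x + g x).
Proof. by move=> /smoothP hf /smoothP hg; apply/smoothP => k; exact: smooth_uptoD. Qed.

Lemma smoothN f : smooth f -> smooth (fun x => - f x).
Proof. by move=> /smoothP hf; apply/smoothP => k; exact: smooth_uptoN. Qed.

Lemma smoothB f g : smooth f -> smooth g -> smooth (fun x => f x - g x).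
Proof. by move=> hf hg; apply: smoothD => //; exact: smoothN. Qed.

Lemma smoothM f g : smooth f -> smooth g -> smooth (fun x => f x * g x).
Proof. by move=> /smoothP hf /smoothP hg; apply/smoothP => k; exact: smooth_uptoM. Qed.

Lemma smoothX f k : smooth f -> smooth (fun x => f x ^+ k).
Proof.
move=> hf; elim: k => [|k ih]; first exact: smooth_cst.
by under eq_fun do rewrite exprS; exact: smoothM.
Qed.

Lemma smoothV f : (forall x, f x != 0) -> smooth f -> smooth (fun x => (f x)^-1).
Proof. by move=> f0 /smoothP hf; apply/smoothP => k; exact: smooth_uptoV. Qed.

Lemma smooth_sqrt f : (forall x, 0 < f x) -> smooth f -> smooth (fun x => Num.sqrt (f x)).
Proof. by move=> f0 /smoothP hf; apply/smoothP => k; exact: smooth_upto_sqrt. Qed.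

Lemma smooth_bump1 m f : smooth f -> smooth (fun x => bump1 m (f x)).
Proof. by move=> /smoothP hf; apply/smoothP => k; exact: smooth_upto_bump1. Qed.

Lemma smooth_sum (I : Type) (s : seq I) (F : I -> Rn -> R) :
  (forall i, smooth (F i)) -> smooth (fun x => \sum_(i <- s) F i x).
Proof.
move=> h; elim: s => [|i s ih].
  by under eq_fun do rewrite big_nil; exact: smooth_cst.
by under eq_fun do rewrite big_cons; exact: smoothD.
Qed.

Lemma smooth_diff f : smooth f -> forall x, differentiable f x.
Proof. by move=> h; exact: (h [::]). Qed.

Lemma smooth_partial i f : smooth f -> smooth (partial i f).
Proof. by move=> h s x; have := h (rcons s i) x; rewrite foldr_rcons. Qed.

Lemma smooth_continuous f : smooth f -> continuous f.
Proof. by move=> h x; apply: differentiable_continuous; exact: smooth_diff. Qed.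

Lemma diff_reflect f x y : differentiable f (x - y) ->
  differentiable (fun y => f (x - y)) y /\
  forall v, 'D_v (fun y => f (x - y)) y = - 'D_v f (x - y).
Proof.
move=> df.
have h : is_diff y (fun y : Rn => x - y) (0 - id).
  exact: (@is_diffB _ _ _ (cst x) id 0 id).
have dg : differentiable (fun y : Rn => x - y) y by case: h.
have dfg : differentiable (f \o (fun y : Rn => x - y)) y by exact: differentiable_comp.
split => // v; rewrite -[LHS]/('D_v (f \o (fun y : Rn => x - y)) y) deriveE//.
rewrite diff_comp//= (diff_val (is_diff_def := h)) /= sub0r.
by rewrite linearN -deriveE.
Qed.

Lemma partial_reflect i f x : (forall y, differentiable f y) ->
  partial i (fun y => f (x - y)) = (fun y => - partial i f (x - y)).
Proof. by move=> df; apply/funext => y; have [_] := diff_reflect (df (x - y)); exact. Qed.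

Lemma smooth_reflect f x : smooth f -> smooth (fun y => f (x - y)).
Proof.
move=> /smoothP sf; apply/smoothP => k; elim: k f {sf}(sf k) => [|k ih] f.
  by move=> df y; have [] := diff_reflect (df (x - y)).
move=> [df hf]; split; first by move=> y; have [] := diff_reflect (df (x - y)).
by move=> i; rewrite partial_reflect//; apply: smooth_uptoN; apply: ih; exact: hf.
Qed.

End SmoothCalculus.

(** * Test functions, integration by parts, convolution *)

Section CompactSupport.
Context {R : realType} {n : nat}.
Local Notation Rn := 'rV[R]_n.
Local Notation T := (lebRn R n).
Implicit Types (f g phi psi : Rn -> R) (x y z v : Rn) (U : set Rn).

Definition bsupp (r : R) f := forall x, r < `|x| -> f x = 0.

Lemma cube_compact x r : compact (cube x r).
Proof.
apply: bounded_closed_compact; last exact: cube_closed.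
exists (`|x| + r); split; first by rewrite num_real.
move=> M Mr y; rewrite /cube/= => yx; apply: (le_trans _ (ltW Mr)).
by rewrite -[y](subrK x) (le_trans (ler_normD _ _))// addrC lerD2l.
Qed.

Lemma continuous_bounded_on f (r : R) : continuous f ->
  exists2 M : R, 0 <= M & forall x, `|x| <= r -> `|f x| <= M.
Proof.
move=> cf; have /compact_bounded[M [Mreal hM]] : compact (f @` cube 0 r).
  by apply: continuous_compact; [apply: continuous_subspaceT|exact: cube_compact].
exists (Num.max 0 (M + 1)); first by rewrite le_max lexx.
move=> x xr; apply: le_trans (hM (M + 1) _ (f x) _) _; rewrite ?ltrDl//.
  by exists x => //; rewrite /cube/= subr0.
by rewrite le_max lexx orbT.
Qed.

Lemma continuous_bounded f (r : R) : continuous f -> bsupp r f ->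
  exists2 M : R, 0 <= M & forall x, `|f x| <= M.
Proof.
move=> cf f0; have [M M0 hM] := continuous_bounded_on r cf.
exists M => // x; have [xr|xr] := leP `|x| r; first exact: hM.
by rewrite f0// normr0.
Qed.

Lemma lint_continuous f (r : R) : continuous f -> bsupp r f -> lint f.
Proof.
move=> cf f0; have [M M0 hM] := continuous_bounded cf f0.
exact: lint_bounded (lmeas_cont cf) hM f0.
Qed.

Lemma compact_rV_bounded U : compact U -> exists r : R, forall x, U x -> `|x| <= r.
Proof.
move=> /compact_bounded[M [Mreal hM]]; exists (M + 1) => x Ux.
by apply: hM => //; rewrite ltrDl.
Qed.

Lemma Ccinf_supp U phi x : Ccinf U phi -> phi x != 0 -> U x.
Proof. by move=> [_ _ h] px; apply: h; exact: subset_closure. Qed.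

Lemma Ccinf_bsupp U phi : Ccinf U phi -> exists r, bsupp r phi.
Proof.
move=> [_ /compact_rV_bounded[r hr] _]; exists r => x xr; apply: contrapT => /eqP px.
have cx : closure [set x | phi x != 0] x by apply: subset_closure.
by have := hr x cx; rewrite leNgt xr.
Qed.

Lemma Ccinf_smooth U phi : Ccinf U phi -> smooth phi.
Proof. by case. Qed.

Lemma Ccinf_cont U phi : Ccinf U phi -> continuous phi.
Proof. by case=> h _ _; exact: smooth_continuous. Qed.

Lemma Ccinf_bounded U phi : Ccinf U phi -> exists2 M : R, 0 <= M & forall x, `|phi x| <= M.
Proof. by move=> h; have [r hr] := Ccinf_bsupp h; exact: continuous_bounded (Ccinf_cont h) hr. Qed.

Lemma Ccinf_lint U phi : Ccinf U phi -> lint phi.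
Proof. by move=> h; have [r hr] := Ccinf_bsupp h; exact: lint_continuous (Ccinf_cont h) hr. Qed.

Lemma Ccinf_sub U phi psi : Ccinf U phi -> smooth psi ->
  closure [set x | psi x != 0] `<=` closure [set x | phi x != 0] -> Ccinf U psi.
Proof.
move=> [_ cp pU] sp pp; split => //; last exact: subset_trans pU.
by apply: subclosed_compact cp pp; exact: closed_closure.
Qed.

Lemma Ccinf_mulr U phi psi : Ccinf U phi -> smooth psi -> Ccinf U (fun x => phi x * psi x).
Proof.
move=> h sp; apply: (Ccinf_sub h); first by apply: smoothM => //; exact: Ccinf_smooth h.
by apply: closureS => x /=; apply: contra => /eqP->; rewrite mul0r.
Qed.

Lemma CcinfW U V phi : U `<=` V -> Ccinf U phi -> Ccinf V phi.
Proof. by move=> UV [h1 h2 h3]; split => //; exact: subset_trans UV. Qed.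

Lemma CcinfT U phi : Ccinf U phi -> Ccinf setT phi.
Proof. exact: CcinfW. Qed.

Lemma near_notin_supp phi x : ~ closure [set x | phi x != 0] x -> \near x, phi x = 0.
Proof.
move=> nx; have : open (~` closure [set x | phi x != 0]).
  by apply: closed_openC; exact: closed_closure.
rewrite openE => /(_ x nx); apply: filterS => y ny; apply: contrapT => /eqP py.
by apply: ny; exact: subset_closure.
Qed.

Lemma supp_partial i phi :
  closure [set x | partial i phi x != 0] `<=` closure [set x | phi x != 0].
Proof.
apply: (@subset_trans _ (closure (closure [set x | phi x != 0]))); last first.
  by rewrite -(closure_id _).1//; exact: closed_closure.
apply: closureS => x /=; apply: contraNP => nx.
have h := near_notin_supp nx; apply/eqP.
by rewrite /partial (near_eq_derive (g := cst 0))// derive_cst.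
Qed.

Lemma Ccinf_partial i U phi : Ccinf U phi -> Ccinf U (partial i phi).
Proof.
by move=> h; apply: (Ccinf_sub h); [exact/smooth_partial/(Ccinf_smooth h)|exact: supp_partial].
Qed.

Lemma coord_sum_le (h : Rn) (M : R) (c : 'I_n -> R) : (forall i, `|c i| <= M) ->
  `|\sum_(i < n) h 0 i * c i| <= n%:R * M * `|h|.
Proof.
move=> hM; apply: (le_trans (ler_norm_sum _ _ _)).
apply: (@le_trans _ _ (\sum_(i < n) M * `|h|)).
  by apply: ler_sum => i _; rewrite normrM mulrC ler_pM// coord_norm_le.
by rewrite sumr_const card_ord -[leLHS]mulr_natl mulrA.
Qed.

Lemma smooth_lipschitz f (M : R) x h : (forall y, differentiable f y) ->
  (forall t : R, 0 <= t <= 1 -> forall i, `|partial i f (x + t *: h)| <= M) ->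
  `|f (x + h) - f x| <= n%:R * M * `|h|.
Proof.
by move=> df hM; have [t t01 ->] := MVT_rV x h df; apply: coord_sum_le => i; exact: hM.
Qed.

Lemma smooth_taylor f (M : R) x h : smooth f ->
  (forall t : R, 0 <= t <= 1 -> forall i j, `|partial j (partial i f) (x + t *: h)| <= M) ->
  `|f (x + h) - f x - \sum_(i < n) h 0 i * partial i f x| <= n%:R * (n%:R * M) * `|h| ^+ 2.
Proof.
move=> sf hM; have [t /andP[t0 t1] ->] := MVT_rV x h (smooth_diff sf).
rewrite -sumrB; under eq_bigr do rewrite -mulrBr.
rewrite (_ : n%:R * (n%:R * M) * `|h| ^+ 2 = n%:R * (n%:R * M * `|h|) * `|h|); last by ring.
apply: coord_sum_le => i.
apply: (@le_trans _ _ (n%:R * M * `|t *: h|)).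
  apply: smooth_lipschitz => [y|s /andP[s0 s1] j]; first exact/smooth_diff/smooth_partial.
  rewrite scalerA; apply: hM; rewrite mulr_ge0//=.
  by rewrite -[leRHS]mulr1 ler_pM.
rewrite normrZ ger0_norm//; apply: ler_wpM2l; last by rewrite ler_piMl.
rewrite mulr_ge0//; apply: le_trans (hM 0 _ i i); rewrite ?lexx ?ler01//.
Qed.

(** By translation invariance every difference quotient has integral 0. The quotients converge to
    the derivative, dominated by means of the mean value theorem. *)
Lemma intg_partial i phi : Ccinf setT phi -> intg (partial i phi) = 0.
Proof.
move=> hp; have [r hr] := Ccinf_bsupp hp.
have [M M0 hM] := Ccinf_bounded (Ccinf_partial i hp).
pose e : Rn := delta_mx 0 i.
pose F k x := k.+1%:R * (phi (x + k.+1%:R^-1 *: e) - phi x).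
have cp := Ccinf_cont hp.
have iF k : lint (F k).
  by apply: lintZ; apply: lintB; [apply: lint_shift|]; exact: Ccinf_lint hp.
have F0 k : intg (F k) = 0.
  rewrite intgZ; last by apply: lintB; [apply: lint_shift|]; exact: Ccinf_lint hp.
  rewrite intgB ?intg_shift ?subrr ?mulr0//; try exact: Ccinf_lint hp.
  by apply: lint_shift; exact: Ccinf_lint hp.
have e1 : `|e| <= 1.
  rewrite rV_norm_le//; apply/forallP => j; rewrite mxE eqxx/=.
  by case: (j == i); rewrite ?normr1 ?normr0.
have [_ c] : lint (partial i phi) /\ intg (F k) @[k --> \oo] --> intg (partial i phi).
  (* The increments have norm at most 1, so all quotients vanish outside the cube of radius
     [r + 1]. *)
  apply: (@intg_dct _ _ F (partial i phi) (fun x => M * \1_(cube 0 (r + 1)) x)).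
  - by move=> k; exact: lint_meas.
  - by apply: lmeas_cont; exact: (Ccinf_cont (Ccinf_partial i hp)).
  - apply: laeW => x.
    have dd : derivable phi x e by apply: diff_derivable; exact/smooth_diff/(Ccinf_smooth hp).
    have h0 : k.+1%:R^-1 @[k --> \oo] --> (0:R)^'.
      move=> P /= [d /= d0 hd]; have := @cvg_harmonic R => /cvgrPdist_lt/(_ d d0).
      by apply: filterS => k kd; apply: hd.
    have := cvg_comp _ _ h0 dd; rewrite -[lim _]/(partial i phi x).
    apply: cvg_trans; apply: near_eq_cvg; apply: nearW => k /=.
    by rewrite /F invrK (addrC x).
  - apply: lintZ; apply: lint_indic; [exact: cube_measurable|exact: leb_cube_lty].
  - move=> k; apply: laeW => x.
    have ek : `|k.+1%:R^-1 *: e| <= k.+1%:R^-1.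
      by rewrite normrZ ger0_norm// ler_piMr.
    have k1 : k.+1%:R^-1 <= 1 :> R by rewrite invf_le1// ler1n.
    rewrite indicE; have [xr|xr] := boolP (x \in _).
      rewrite mulr1 /F normrM.
      have [t t01 ->] := MVT_rV x (k.+1%:R^-1 *: e) (smooth_diff (Ccinf_smooth hp)).
      rewrite (bigD1 i)//= big1 ?addr0; last first.
        by move=> j ji; rewrite !mxE eqxx/= (negbTE ji) mulr0 mul0r.
      rewrite !mxE !eqxx/= mulr1 normrM mulrA -normrM divff ?pnatr_eq0// normr1 mul1r.
      exact: hM.
    have rx : r + 1 < `|x|.
      by rewrite ltNge; apply: contra xr => xr; rewrite inE /cube/= subr0.
    rewrite /F (hr x) ?(hr (x + _)) ?subrr ?mulr0 ?normr0//.
      rewrite -(ltrD2r 1); apply: (lt_le_trans rx).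
      rewrite -lerBlDr; apply: (@le_trans _ _ (`|x| - `|k.+1%:R^-1 *: e|)).
        by rewrite lerD2l lerN2 (le_trans ek).
      exact: lerB_normD.
    by apply: lt_trans rx; rewrite ltrDl.
move: c; under eq_fun do rewrite F0.
by move=> c; apply/esym; apply: (cvg_unique _ (@cvg_cst _ _ _ _ _) c).
Qed.


Lemma intg_byparts i phi psi : Ccinf setT phi -> smooth psi ->
  intg (fun x => phi x * partial i psi x) = - intg (fun x => psi x * partial i phi x).
Proof.
move=> hp sp; have hpp := Ccinf_mulr hp sp.
have := intg_partial i hpp.
rewrite partialM; [|exact/smooth_diff/(Ccinf_smooth hp)|exact: smooth_diff].
have h1 := Ccinf_lint (Ccinf_mulr hp (smooth_partial i sp)).
have h2 := Ccinf_lint (Ccinf_mulr (Ccinf_partial i hp) sp).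
rewrite intgD//; last by under eq_fun do rewrite mulrC.
by move/eqP; rewrite addr_eq0 => /eqP.
Qed.

Definition conv f k x : R := intg (fun y => f y * k (x - y)).

Lemma sub_continuous x : continuous (fun y : Rn => x - y).
Proof. by move=> y; apply: continuousB; [exact: cst_continuous|]. Qed.

Lemma lint_conv f k (r : R) x : lint f -> bsupp r f -> continuous k ->
  lint (fun y => f y * k (x - y)).
Proof.
move=> hf f0 ck; have [M M0 hM] := continuous_bounded_on (`|x| + r) ck.
apply: (@lint_dom _ _ _ (fun y => M * `|f y|)).
- apply: lmeasM; first exact: lint_meas.
  apply: lmeas_cont => y; apply: continuous_comp; [exact: sub_continuous|exact: ck].
- exact/lintZ/lint_norm.
- apply: laeW => y; rewrite normrM mulrC.
  have [yr|yr] := leP `|y| r; last by rewrite f0// normr0 !mulr0.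
  by rewrite ler_wpM2r// hM// (le_trans (ler_normB _ _))// lerD2l.
Qed.

Lemma second_partials_bounded k (r : R) : smooth k ->
  exists2 M : R, 0 <= M & forall x i j, `|x| <= r -> `|partial j (partial i k) x| <= M.
Proof.
move=> sk.
have h (ij : 'I_n * 'I_n) : exists M : R, 0 <= M /\ forall x, `|x| <= r ->
    `|partial ij.2 (partial ij.1 k) x| <= M.
  have [M M0 hM] := continuous_bounded_on r (smooth_continuous (smooth_partial ij.2 (smooth_partial ij.1 sk))).
  by exists M.
have [M hM] := choice h.
exists (\sum_ij M ij); first by apply: sumr_ge0 => ij _; have [] := hM ij.
move=> x i j xr; rewrite (bigD1 (i, j))//=.
have [_ /(_ x xr) hh] := hM (i, j); apply: (le_trans hh); rewrite lerDl.
by apply: sumr_ge0 => ij _; have [] := hM ij.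
Qed.

(** Differentiation under the integral sign: the second-order Taylor bound for [k], uniform over the
    support of [f], is integrated against [|f|] and yields a quadratic remainder. *)
Lemma conv_diff f k (r : R) x : lint f -> bsupp r f -> smooth k ->
  differentiable (conv f k) x /\ forall i, partial i (conv f k) x = conv f (partial i k) x.
Proof.
move=> hf f0 sk.
(* For [|y| <= r] and [|h| <= 1] the segment from [x - y] to [x - y + h] stays within this
   radius. *)
have [M M0 hM] := second_partials_bounded (`|x| + r + 1) sk.
pose c : Rn := \row_i conv f (partial i k) x.
pose C := n%:R * (n%:R * M).
have lk y := lint_conv y hf f0 (smooth_continuous sk).
have lpk i y := lint_conv y hf f0 (smooth_continuous (smooth_partial i sk)).
have h0 h : `|h| <= 1 -> `|conv f k (h + x) - conv f k x - dotv c h| <=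
    C * intg (fun y => `|f y|) * `|h| ^+ 2.
  move=> h1.
  have -> : dotv c h = intg (fun y => \sum_(i < n) h 0 i * (f y * partial i k (x - y))).
    rewrite intg_sum; last by move=> i; apply: lintZ; exact: lpk.
    by apply: eq_bigr => i _; rewrite mxE intgZ; [rewrite mulrC|exact: lpk].
  have ls : lint (fun y => \sum_(i < n) h 0 i * (f y * partial i k (x - y))).
    by apply: lint_sum => i; apply: lintZ; exact: lpk.
  rewrite /conv -intgB// -intgB//; last exact: lintB.
  apply: (le_trans (le_abs_intg _)); first by apply: lintB => //; exact: lintB.
  rewrite mulrAC -intgZ; last exact: lint_norm.
  apply: le_intg; [apply: lint_norm; apply: lintB => //; exact: lintB|exact/lintZ/lint_norm|].
  apply: laeW => y.
  have [yr|yr] := leP `|y| r; last first.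
    rewrite f0// !mul0r normr0 mulr0 subr0 sub0r normrN big1 ?normr0// => i _.
    by rewrite mul0r mulr0.
  under eq_bigr do rewrite mulrCA; rewrite -mulr_sumr -!mulrBr normrM mulrC.
  rewrite ler_wpM2r// (addrC h).
  rewrite (_ : x + h - y = x - y + h); last by rewrite addrAC.
  apply: smooth_taylor => // t /andP[t0 t1] i j; apply: hM.
  apply: (le_trans (ler_normD _ _)); apply: lerD.
    by rewrite (le_trans (ler_normB _ _))// lerD2l.
  by rewrite normrZ ger0_norm// -[leRHS]mulr1 ler_pM.
have [df e] := differentiable_quadratic h0.
split => // i; rewrite /partial e /dotv (bigD1 i)//= big1; last first.
  by move=> j ji; rewrite !mxE (negbTE ji) andbF mulr0.
by rewrite !mxE !eqxx mulr1 addr0.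
Qed.

Lemma partial_conv i f k (r : R) : lint f -> bsupp r f -> smooth k ->
  partial i (conv f k) = conv f (partial i k).
Proof. by move=> hf f0 sk; apply/funext => x; have [_] := conv_diff x hf f0 sk; exact. Qed.

Lemma conv_smooth f k (r : R) : lint f -> bsupp r f -> smooth k -> smooth (conv f k).
Proof.
move=> hf f0 sk; apply/smoothP => m; elim: m k sk => [|m ih] k sk.
  by move=> x; have [] := conv_diff x hf f0 sk.
split; first by move=> x; have [] := conv_diff x hf f0 sk.
by move=> i; rewrite (partial_conv i hf f0 sk); apply: ih; exact: smooth_partial.
Qed.

End CompactSupport.

Import HBSimple.

(** * Density of continuous functions and mollification *)

Section Density.
Context {R : realType} {n : nat}.
Local Notation Rn := 'rV[R]_n.
Local Notation T := (lebRn R n).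
Implicit Types (f g h : Rn -> R) (x y z v : Rn) (U : set Rn).

Lemma intg_dist_triangle f g h : lint f -> lint g -> lint h ->
  intg (fun x => `|f x - h x|) <= intg (fun x => `|f x - g x|) + intg (fun x => `|g x - h x|).
Proof.
move=> hf hg hh; rewrite -intgD; try exact/lint_norm/lintB.
apply: le_intg; [exact/lint_norm/lintB|apply: lintD; exact/lint_norm/lintB|].
by apply: laeW => x; exact: ler_distD.
Qed.

(** The [L^1] closure of the continuous functions with bounded support. It is stable under limits,
    maxima and linear combinations, and contains the indicators of boxes; from these facts it is
    shown to contain every integrable function. *)
Definition approximable f := lint f /\ forall e : R, 0 < e ->
  exists g, exists r : R, [/\ continuous g, bsupp r g & intg (fun x => `|f x - g x|) <= e].

Lemma approximable_lim f : lint f -> (forall e : R, 0 < e ->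
    exists2 h, approximable h & intg (fun x => `|f x - h x|) <= e) -> approximable f.
Proof.
move=> hf fh; split => // e e0; have e2 : 0 < e / 2 by rewrite divr_gt0.
have [h [hh /(_ _ e2)[g [r [cg g0 hg]]]] fhe] := fh _ e2.
exists g, r; split => //; rewrite [leRHS](splitr e).
apply: le_trans (intg_dist_triangle hf hh _) _; first exact: lint_continuous cg g0.
exact: lerD.
Qed.

Lemma lint_max f g : lint f -> lint g -> lint (fun x => Num.max (f x) (g x)).
Proof.
move=> hf hg; apply: (@lint_dom _ _ _ (fun x => `|f x| + `|g x|)).
- by apply: lmeas_max; exact: lint_meas.
- by apply: lintD; exact: lint_norm.
- apply: laeW => x; rewrite /Order.max; case: ifP => _; rewrite ?lerDr ?lerDl//.
Qed.

Lemma approximable_max f g : approximable f -> approximable g ->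
  approximable (fun x => Num.max (f x) (g x)).
Proof.
move=> [hf fa] [hg ga]; split; first exact: lint_max.
move=> e e0; have e2 : 0 < e / 2 by rewrite divr_gt0.
have [f' [r [cf f0 hf']]] := fa _ e2; have [g' [s [cg g0 hg']]] := ga _ e2.
have hf1 := lint_continuous cf f0; have hg1 := lint_continuous cg g0.
exists (fun x => Num.max (f' x) (g' x)), (Num.max r s); split.
- by move=> x; apply: continuous_max; [exact: cf|exact: cg].
- by move=> x; rewrite gt_max => /andP[rx sx]; rewrite f0// g0// maxxx.
- rewrite [leRHS](splitr e); apply: (le_trans _ (lerD hf' hg')).
  rewrite -intgD; try exact/lint_norm/lintB.
  apply: le_intg; [by apply/lint_norm/lintB; exact: lint_max| by apply: lintD; exact/lint_norm/lintB |].
  apply: laeW => x; move: (f x) (g x) (f' x) (g' x) => a b' c d.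
  have h1 := ler_norm (a - c); have h2 := ler_norm (b' - d).
  have h3 := ler_norm (- (a - c)); have h4 := ler_norm (- (b' - d)).
  rewrite !normrN in h3 h4; have := normr_ge0 (a - c); have := normr_ge0 (b' - d).
  move: h1 h2 h3 h4; set X := `|a - c|; set Y := `|b' - d|.
  by rewrite ler_norml /Order.max; case: ifPn; case: ifPn; rewrite -?leNgt; lra.
Qed.

Lemma approximableD f g : approximable f -> approximable g ->
  approximable (fun x => f x + g x).
Proof.
move=> [hf fa] [hg ga]; split; first exact: lintD.
move=> e e0; have e2 : 0 < e / 2 by rewrite divr_gt0.
have [f' [r [cf f0 hf']]] := fa _ e2; have [g' [s [cg g0 hg']]] := ga _ e2.
have hf1 := lint_continuous cf f0; have hg1 := lint_continuous cg g0.
exists (fun x => f' x + g' x), (Num.max r s); split.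
- by move=> x; apply: continuousD; [exact: cf|exact: cg].
- by move=> x; rewrite gt_max => /andP[rx sx]; rewrite f0// g0// addr0.
- rewrite [leRHS](splitr e); apply: (le_trans _ (lerD hf' hg')).
  rewrite -intgD; try exact/lint_norm/lintB.
  apply: le_intg; [by apply/lint_norm/lintB; exact: lintD| by apply: lintD; exact/lint_norm/lintB |].
  by apply: laeW => x; rewrite opprD addrACA ler_normD.
Qed.

Lemma approximableZ c f : approximable f -> approximable (fun x => c * f x).
Proof.
move=> [hf fa]; split; first exact: lintZ.
move=> e e0; have c1 : 0 < `|c| + 1 by rewrite ltr_wpDl.
have [g [r [cg g0 hg]]] := fa _ (divr_gt0 e0 c1).
have hg1 := lint_continuous cg g0.
exists (fun x => c * g x), r; split.
- by move=> x; apply: continuousM; [exact: cst_continuous|exact: cg].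
- by move=> x rx; rewrite g0// mulr0.
- have -> : intg (fun x => `|c * f x - c * g x|) = `|c| * intg (fun x => `|f x - g x|).
    rewrite -intgZ; last exact/lint_norm/lintB.
    by apply: eq_intg => x; rewrite -mulrBr normrM.
  apply: (le_trans (ler_wpM2l (normr_ge0 c) hg)).
  by rewrite mulrCA ler_piMr ?ltW// ltr_pdivrMr// mul1r ltrDl.
Qed.

Lemma approximable0 : approximable (fun=> 0).
Proof.
split; first exact: lint0.
move=> e e0; exists (fun=> 0), 0; split => //; first exact: cst_continuous.
by under eq_intg do rewrite subr0 normr0; rewrite intg0 ltW.
Qed.

Lemma continuous_prodr (I : Type) (s : seq I) (F : I -> Rn -> R) :
  (forall i, continuous (F i)) -> continuous (fun x => \prod_(i <- s) F i x).
Proof.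
move=> cF; elim: s => [|i s ih].
  by under eq_fun do rewrite big_nil; exact: cst_continuous.
by under eq_fun do rewrite big_cons; move=> x; exact: continuousM (cF i x) (ih x).
Qed.

Lemma box_measurable p : measurable (box p : set T).
Proof.
case: p => [[a b]|]; last exact: measurable0.
rewrite [X in measurable X](_ : _ = \big[setI/setT]_(i : 'I_n)
   ((fun x : Rn => x 0 i) @^-1` `]a 0 i, b 0 i])).
  by apply: bigsetI_measurable => i _; rewrite -[X in measurable X]setTI; exact: measurable_coord.
apply/seteqP; split => [x /= h|x]; rewrite -bigcap_seq.
  by move=> i _ /=; rewrite in_itv/=.
by move=> h i; have := h i (mem_index_enum i); rewrite /= in_itv.
Qed.

Lemma box_norm_le (a b x : Rn) : box (Some (a, b)) x -> `|x| <= `|a| + `|b|.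
Proof.
move=> h; rewrite rV_norm_le ?addr_ge0//; apply/forallP => i.
have /andP[h1 h2] := h i.
have := coord_norm_le a i; have := coord_norm_le b i.
by rewrite !ler_norml => /andP[h3 h4] /andP[h5 h6]; apply/andP; split; lra.
Qed.

Lemma leb_box_lty p : (leb (box p : set T) < +oo)%E.
Proof.
case: p => [[a b]|]; first exact: leb_bounded_lty (@box_norm_le a b).
by rewrite measure0.
Qed.

Lemma lint_box p : lint (\1_(box p) : Rn -> R).
Proof.
by apply: lint_indic; [exact: box_measurable|exact: leb_box_lty].
Qed.

Definition clamp (t : R) : R := Num.min 1 (Num.max 0 t).

Lemma clamp_cont : continuous clamp.
Proof.
move=> t; apply: continuous_min; first exact: cst_continuous.
by apply: continuous_max; [exact: cst_continuous|].
Qed.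

Lemma clamp01 t : 0 <= clamp t <= 1.
Proof. by rewrite /clamp le_min ge_min ler01 lexx le_max lexx. Qed.

Lemma clamp0 t : t <= 0 -> clamp t = 0.
Proof. by move=> t0; rewrite /clamp max_l// min_r. Qed.

Lemma clamp1 t : 1 <= t -> clamp t = 1.
Proof. by move=> t0; rewrite /clamp max_r ?min_l// (le_trans _ t0). Qed.

Lemma near_nat_ge (c : R) : \forall k \near \oo, c <= k.+1%:R.
Proof.
near=> k; apply: (@le_trans _ _ k%:R); last by rewrite ler_nat.
by near: k; exact: nbhs_infty_ger.
Unshelve. all: by end_near. Qed.

Lemma approximable_box p : approximable (\1_(box p) : Rn -> R).
Proof.
case: p => [[a b]|]; last first.
  rewrite (_ : \1_ _ = (fun=> 0)); first exact: approximable0.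
  by apply/funext => x; rewrite indicE in_set0.
(* The first factor vanishes up to [a_i] and is 1 from [a_i + 1/(k+1)] on; the second is 1 up to
   [b_i] and vanishes from [b_i + 1/(k+1)] on. The limit is thus exactly the indicator of the
   half-open box, at every point. *)
pose G k x := \prod_(i < n) (clamp (k.+1%:R * (x 0 i - a 0 i)) *
  clamp (k.+1%:R * (b 0 i - x 0 i) + 1)).
have cG k : continuous (G k).
  have c1 i : continuous (fun x : Rn => clamp (k.+1%:R * (x 0 i - a 0 i))).
    move=> x; apply: (@continuous_comp _ _ _ (fun x : Rn => k.+1%:R * (x 0 i - a 0 i))); last exact: clamp_cont.
    apply: continuousM; first exact: cst_continuous.
    by apply: continuousB; [exact: coord_continuous|exact: cst_continuous].
  have c2 i : continuous (fun x : Rn => clamp (k.+1%:R * (b 0 i - x 0 i) + 1)).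
    move=> x; apply: (@continuous_comp _ _ _ (fun x : Rn => k.+1%:R * (b 0 i - x 0 i) + 1)); last exact: clamp_cont.
    apply: continuousD; last exact: cst_continuous.
    apply: continuousM; first exact: cst_continuous.
    by apply: continuousB; [exact: cst_continuous|exact: coord_continuous].
  by apply: continuous_prodr => i x; exact: continuousM (c1 i x) (c2 i x).
have G01 k x : 0 <= G k x <= 1.
  have h i : 0 <= clamp (k.+1%:R * (x 0 i - a 0 i)) * clamp (k.+1%:R * (b 0 i - x 0 i) + 1) <= 1.
    have /andP[u1 u2] := clamp01 (k.+1%:R * (x 0 i - a 0 i)).
    have /andP[v1 v2] := clamp01 (k.+1%:R * (b 0 i - x 0 i) + 1).
    by rewrite mulr_ge0//= mulr_ile1.
  rewrite prodr_ge0/=; last by move=> i _; have /andP[] := h i.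
  by apply: prodr_ile1 => i _; exact: h.
pose r := `|a| + `|b| + 1.
have r0 : 0 <= r by rewrite !addr_ge0.
have G0 k : bsupp r (G k).
  move=> x; rewrite ltNge rV_norm_le// negb_forall => /existsP[i]; rewrite -ltNge => ri.
  rewrite /G (bigD1 i)//=.
  have := coord_norm_le a i; have := coord_norm_le b i.
  rewrite !ler_norml => /andP[h3 h4] /andP[h5 h6].
  have := normr_ge0 a; have := normr_ge0 b => nb na.
  have k1 : 1 <= k.+1%:R :> R by rewrite ler1n.
  case: (lerP 0 (x 0 i)) ri => x0 ri; last first.
    rewrite (clamp0 (t := _ * (x 0 i - _))) ?mul0r//; rewrite pmulr_rle0 ?ltr0n// subr_le0.
    by rewrite (ltr0_norm x0) /r in ri; lra.
  rewrite [X in _ * X * _](@clamp0) ?mulr0 ?mul0r//.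
  have : 1 <= x 0 i - b 0 i by rewrite (ger0_norm x0) /r in ri; lra.
  by move=> h; have := ler_pM ler01 ler01 k1 h; rewrite mulr1 -(opprB (x 0 i)) mulrN; lra.
have iG k : lint (G k) by exact: lint_continuous (cG k) (G0 k).
have Gx x : G k x @[k --> \oo] --> (\1_(box (Some (a, b))) x : R).
  apply: cvg_near_cst; rewrite indicE; case: (asboolP (box (Some (a, b)) x)) => bx.
    rewrite mem_set//.
    have : \forall k \near \oo, forall i : 'I_n, 1 <= k.+1%:R * (x 0 i - a 0 i).
      apply: filter_forall => i; have /andP[ai bi] := bx i.
      near=> k; rewrite -ler_pdivrMr ?subr_gt0// mul1r.
      by near: k; exact: near_nat_ge.
    apply: filterS => k hk; rewrite /G big1// => i _.
    have /andP[ai bi] := bx i.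
    by rewrite !clamp1 ?mulr1// lerDr mulr_ge0// subr_ge0.
  rewrite memNset//.
  have [i hi] : exists i, ~~ (a 0 i < x 0 i <= b 0 i).
    by apply/existsP; rewrite -negb_forall; apply/negP => /forallP.
  rewrite negb_and -leNgt -ltNge in hi; case/orP: hi => hi.
    near=> k; rewrite /G (bigD1 i)//= (clamp0 (t := _ * (x 0 i - _))) ?mul0r//.
    by rewrite pmulr_rle0 ?ltr0n// subr_le0.
  have : \forall k \near \oo, 1 <= k.+1%:R * (x 0 i - b 0 i).
    near=> k; rewrite -ler_pdivrMr ?subr_gt0// mul1r.
    by near: k; exact: near_nat_ge.
  apply: filterS => k hk; rewrite /G (bigD1 i)//= [X in _ * X * _](@clamp0) ?mulr0 ?mul0r//.
  by move: hk; rewrite -(opprB (x 0 i)) mulrN; lra.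
have [_ c] : lint (fun _ : Rn => 0) /\ intg (fun x => `|\1_(box (Some (a, b))) x - G k x|) @[k --> \oo] --> intg (fun _ : Rn => 0).
  apply: (@intg_dct _ _ _ _ (fun x => 2 * \1_(cube 0 r) x)).
  - by move=> k; apply: lint_meas; apply/lint_norm/lintB; [exact: lint_box|exact: iG].
  - exact: lmeas_cst.
  - apply: laeW => x.
    have h : \1_(box (Some (a, b))) x - G k x @[k --> \oo] -->
        (\1_(box (Some (a, b))) x - \1_(box (Some (a, b))) x : R).
      by apply: cvgB; [exact: cvg_cst|exact: Gx].
    rewrite (_ : 0 = `|\1_(box (Some (a, b))) x - \1_(box (Some (a, b))) x : R|); last by rewrite subrr normr0.
    exact: cvg_norm h.
  - apply: lintZ; apply: lint_indic; [exact: cube_measurable|exact: leb_cube_lty].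
  - move=> k; apply: laeW => x; rewrite normr_id.
    have [xr|xr] := boolP (x \in cube 0 r).
      rewrite [in leRHS]indicE xr mulr1; have /andP[g1 g2] := G01 k x.
      by rewrite indicE; case: (_ \in _) => /=; rewrite ler_norml; apply/andP; split; lra.
    have rx : r < `|x|.
      by rewrite ltNge; apply: contra xr => xr; rewrite inE /cube/= subr0.
    rewrite (G0 k x rx) !indicE (negbTE xr) memNset ?subrr ?normr0 ?mulr0// => bx.
    by move: rx; rewrite ltNge; apply/negP; rewrite negbK (le_trans (box_norm_le bx))// lerDl.
split; first exact: lint_box.
move=> e e0; move: c; rewrite intg0 => /cvgrPdist_lt/(_ e e0)[k _ /(_ k (leqnn _))].
rewrite sub0r normrN => h; exists (G k), r; split => //.
by rewrite ltW// (le_lt_trans _ h)// ler_norm.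
Unshelve. all: by end_near. Qed.

Lemma indicU (A B : set Rn) x : \1_(A `|` B) x = Num.max (\1_A x) (\1_B x) :> R.
Proof.
rewrite !indicE in_setU /Order.max.
by case: (x \in A); case: (x \in B); rewrite /= ?ltxx ?ltr01 ?ltr10.
Qed.

Lemma intg_dist_indic (A B : set Rn) : measurable (A : set T) -> measurable (B : set T) ->
  (leb (B : set T) < +oo)%E -> A `<=` B ->
  intg (fun x => `|\1_A x - \1_B x|) = fine (leb (B : set T)) - fine (leb (A : set T)).
Proof.
move=> mA mB Boo AB.
have Aoo : (leb (A : set T) < +oo)%E by apply: le_lt_trans Boo; exact: le_lebesgue_outer.
rewrite -!intg_indic// -intgB; try exact: lint_indic.
apply: eq_intg => x; rewrite !indicE.
have [xA|xA] := boolP (x \in A).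
  have -> : x \in B by rewrite inE; apply: AB; rewrite inE in xA.
  by rewrite subrr normr0.
by rewrite sub0r normrN subr0 ger0_norm.
Qed.

Lemma approximable_bigcup_box (B : nat -> option (Rn * Rn)) (N : nat) :
  approximable (\1_(\bigcup_(k < N) box (B k)) : Rn -> R).
Proof.
elim: N => [|N ih].
  rewrite (_ : \1_ _ = (fun=> 0)); first exact: approximable0.
  by apply/funext => x; rewrite bigcup_mkord big_ord0 indicE in_set0.
rewrite bigcup_mkord big_ord_recr/= -(bigcup_mkord N (fun k => box (B k))).
rewrite (_ : \1_ _ = (fun x => Num.max (\1_(\bigcup_(k < N) box (B k)) x) (\1_(box (B N)) x))).
  by apply: approximable_max => //; exact: approximable_box.
by apply/funext => x; rewrite indicU.
Qed.

(** The definition of the outer measure gives a countable union of boxes around [E] with little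
    excess; finite unions approximate it in turn, and their indicators are maxima of indicators of
    boxes. *)
Lemma approximable_indic (E : set Rn) : measurable (E : set T) -> (leb (E : set T) < +oo)%E ->
  approximable (\1_E : Rn -> R).
Proof.
move=> mE Eoo; have hE := lint_indic mE Eoo.
apply: approximable_lim => // e e0; have e2 : 0 < e / 2 by rewrite divr_gt0.
have fE : lebesgue_outer E \is a fin_num by rewrite ge0_fin_numE// lebesgue_outer_ge0.
have [_ [B EB <-] hB] := lb_ereal_inf_adherent e2 fE.
pose V : set Rn := \bigcup_k box (B k).
pose W N : set Rn := \bigcup_(k < N) box (B k).
have mV : measurable (V : set T) by apply: bigcupT_measurable => k; exact: box_measurable.
have mW N : measurable (W N : set T) by apply: bigcup_measurable => k _; exact: box_measurable.
have leV : (leb (V : set T) <= leb (E : set T) + (e / 2)%:E)%E.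
  apply: le_trans (ltW hB); apply: (@le_trans _ _ (\sum_(k <oo) leb (box (B k) : set T))%E).
    exact: (lebesgue_outer_sigma_subadditive (fun k => box (B k))).
  apply: lee_nneseries => k _; first by move=> _; exact: measure_ge0.
  case: (B k) => [[a b]|]; first exact: leb_box_le.
  by rewrite /= measure0.
have Voo : (leb (V : set T) < +oo)%E.
  by apply: le_lt_trans leV _; rewrite lte_add_pinfty// ltry.
have hV := lint_indic mV Voo.
have WV N : W N `<=` V by move=> x [k _ h]; exists k.
have Woo N : (leb (W N : set T) < +oo)%E by apply: le_lt_trans Voo; exact: le_lebesgue_outer.
have hW N := lint_indic (mW N) (Woo N).
have EV : intg (fun x => `|\1_E x - \1_V x|) <= e / 2.
  rewrite intg_dist_indic// lerBlDr addrC -lee_fin EFinD !fineK//.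
  by rewrite ge0_fin_numE//; exact: measure_ge0.
have [_ c] : lint (fun _ : Rn => 0) /\ intg (fun x => `|\1_V x - \1_(W N) x|) @[N --> \oo] --> intg (fun _ : Rn => 0).
  apply: (@intg_dct _ _ _ _ \1_V) => //.
  - by move=> N; apply: lint_meas; exact/lint_norm/lintB.
  - exact: lmeas_cst.
  - apply: laeW => x; apply: cvg_near_cst.
    case: (asboolP (V x)) => Vx.
      have [k _ Bk] := Vx; near=> N.
      rewrite !indicE !mem_set ?subrr ?normr0//; exists k => //.
      by near: N; exact: nbhs_infty_gt.
    apply: nearW => N; rewrite !indicE !memNset ?subrr ?normr0//.
    by move=> /WV.
  - move=> N; apply: laeW => x; rewrite normr_id !indicE.
    have [xW|xW] := boolP (x \in W N).
      have -> : x \in V by rewrite inE; apply: (WV N); rewrite inE in xW.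
      by rewrite subrr normr0.
    by rewrite subr0 ger0_norm.
move: c; rewrite intg0 => /cvgrPdist_lt/(_ _ e2)[N _ /(_ N (leqnn _))].
rewrite sub0r normrN => h; exists \1_(W N); first exact: approximable_bigcup_box.
apply: le_trans (intg_dist_triangle hE hV (hW N)) _.
by rewrite [leRHS](splitr e) lerD// ltW// (le_lt_trans _ h)// ler_norm.
Unshelve. all: by end_near. Qed.

Lemma approximable_sum (I : Type) (s : seq I) (F : I -> Rn -> R) :
  (forall i, approximable (F i)) -> approximable (fun x => \sum_(i <- s) F i x).
Proof.
move=> h; elim: s => [|i s ih].
  by under eq_fun do rewrite big_nil; exact: approximable0.
by under eq_fun do rewrite big_cons; exact: approximableD.
Qed.

Lemma approximable_sfun (g : {sfun T >-> R}) : lint (g : Rn -> R) ->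
  approximable (g : Rn -> R).
Proof.
move=> hg.
rewrite (_ : (g : Rn -> R) = (fun x => \sum_(y <- finmap.enum_fset (fset_set (range g)))
   y * \1_(g @^-1` [set y]) x)); last first.
  by apply/funext => x; rewrite {1}fimfunE fsbig_finite.
apply: approximable_sum => y.
have [->|y0] := eqVneq y 0.
  by under eq_fun do rewrite mul0r; exact: approximable0.
have mA : measurable (g @^-1` [set y] : set T) by exact: measurable_funPTI.
apply: approximableZ; apply: approximable_indic => //; apply: lint_indic_lty => //.
(* Markov's inequality: the level set of a nonzero value of an integrable function has finite
   measure. *)
apply: (@lint_dom _ _ _ (fun x => `|y|^-1 * `|g x|)); first exact: lmeas_indic.
  exact/lintZ/lint_norm.
apply: laeW => x; rewrite indicE; have [|_] := boolP (x \in _).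
  by rewrite inE /= => ->; rewrite mulVf ?normr_eq0// normr1.
by rewrite normr0 mulr_ge0.
Qed.

Lemma approximable_lint f : lint f -> approximable f.
Proof.
move=> hf; apply: approximable_lim => // e e0.
have [g hg h] := lint_sfun_approx hf e0.
by exists (g : Rn -> R) => //; exact: approximable_sfun.
Qed.

End Density.

(** * Mollification *)

Section Mollifier.
Context {R : realType} {n : nat}.
Local Notation Rn := 'rV[R]_n.
Local Notation T := (lebRn R n).
Implicit Types (f g h : Rn -> R) (x y z v : Rn) (U : set Rn) (d : R).

Lemma dotv_ge0 x : 0 <= dotv x x.
Proof. by apply: sumr_ge0 => i _; rewrite -expr2 sqr_ge0. Qed.

Lemma dotv_le x : dotv x x <= n%:R * `|x| ^+ 2.
Proof.
apply: (@le_trans _ _ (\sum_(i < n) `|x| ^+ 2)); last by rewrite sumr_const card_ord mulr_natl.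
by apply: ler_sum => i _; rewrite -expr2 -real_normK ?num_real// ler_pXn2r ?nnegrE// coord_norm_le.
Qed.

Lemma coord_dotv_le x i : x 0 i ^+ 2 <= dotv x x.
Proof.
rewrite /dotv (bigD1 i)//= -expr2 lerDl; apply: sumr_ge0 => j _.
by rewrite -expr2 sqr_ge0.
Qed.

Lemma dotv_gt d x : 0 <= d -> d < `|x| -> d ^+ 2 < dotv x x.
Proof.
move=> d0; rewrite ltNge rV_norm_le// negb_forall => /existsP[i]; rewrite -ltNge => di.
apply: (lt_le_trans _ (coord_dotv_le x i)); rewrite -[ltRHS]real_normK ?num_real//.
by rewrite ltr_pXn2r// nnegrE.
Qed.

Lemma smooth_dotv : smooth (fun x : Rn => dotv x x).
Proof. by apply: smooth_sum => i; apply: smoothM; exact: smooth_coord. Qed.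

Definition moll0 d x : R := bump1 0 (d ^+ 2 - dotv x x).
(** The mollifier of radius [d] is normalised by its own mass instead of being a rescaled copy of
    one bump, so that no change of variables under dilations occurs. *)
Definition moll d x : R := (intg (moll0 d))^-1 * moll0 d x.

Lemma moll0_smooth d : smooth (moll0 d).
Proof. by apply: smooth_bump1; apply: smoothB; [exact: smooth_cst|exact: smooth_dotv]. Qed.

Lemma moll0_bsupp d : 0 <= d -> bsupp d (moll0 d).
Proof. by move=> d0 x dx; rewrite /moll0 /bump1 subr_gt0 ltNge ltW// dotv_gt. Qed.

Lemma moll0_lint d : 0 <= d -> lint (moll0 d).
Proof.
move=> d0; apply: (@lint_continuous _ _ _ d); last exact: moll0_bsupp.
exact/smooth_continuous/moll0_smooth.
Qed.

Lemma bump1_incr (s t : R) : 0 < s -> s <= t -> bump1 0 s <= bump1 0 t.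
Proof.
move=> s0 st; have t0 := lt_le_trans s0 st.
by rewrite /bump1 s0 t0 !expr0 !mul1r ler_expR lerN2 lef_pV2.
Qed.

Lemma intg_moll0_gt0 d : 0 < d -> 0 < intg (moll0 d).
Proof.
(* On the cube of radius [s] the bound [|x|^2 <= n s^2 <= d^2 / 2] holds for the Euclidean norm, so
   the bump is at least its value at [d^2 / 2]. *)
move=> d0; pose s := d / (2 * n.+1%:R).
have s0 : 0 < s by rewrite divr_gt0// mulr_gt0// ltr0n.
have b0 : 0 < bump1 0 (d ^+ 2 / 2) by apply: bump1_gt0; rewrite divr_gt0// exprn_gt0.
apply: (@lt_le_trans _ _ (intg (fun x => bump1 0 (d ^+ 2 / 2) * \1_(cube 0 s) x))).
  rewrite intgZ; last by apply: lint_indic; [exact: cube_measurable|exact: leb_cube_lty].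
  rewrite mulr_gt0// intg_indic; last exact: cube_measurable.
  rewrite fine_gt0// leb_cube_lty andbT.
  by apply: lt_le_trans (leb_cube_ge 0 (ltW s0)); rewrite lte_fin exprn_gt0// mulr_gt0.
apply: le_intg; [|exact/moll0_lint/ltW|].
  by apply/lintZ/lint_indic; [exact: cube_measurable|exact: leb_cube_lty].
apply: laeW => x; rewrite indicE; have [|_] := boolP (x \in _); last first.
  by rewrite mulr0 bump1_ge0.
rewrite inE /cube/= subr0 mulr1 => xs; apply: bump1_incr; first by rewrite divr_gt0// exprn_gt0.
have h1 : dotv x x <= n%:R * s ^+ 2.
  by apply: le_trans (dotv_le x) _; rewrite ler_wpM2l// ler_pXn2r ?nnegrE ?(ltW s0).
have h2 : n%:R * s ^+ 2 <= d ^+ 2 / 2.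
  rewrite /s expr_div_n mulrCA ler_wpM2l ?sqr_ge0//.
  rewrite ler_pdivrMr ?exprn_gt0 ?mulr_gt0 ?ltr0n//.
  have : (n%:R : R) <= n.+1%:R by rewrite ler_nat.
  have : 1 <= n.+1%:R :> R by rewrite ler1n.
  move: (n%:R : R) (n.+1%:R : R) => a b; nra.
lra.
Qed.

Lemma moll_ge0 d x : 0 < d -> 0 <= moll d x.
Proof. by move=> d0; rewrite mulr_ge0// ?bump1_ge0// invr_ge0 ltW// intg_moll0_gt0. Qed.

Lemma moll_smooth d : smooth (moll d).
Proof. by apply: smoothM; [exact: smooth_cst|exact: moll0_smooth]. Qed.

Lemma moll_cont d : continuous (moll d).
Proof. exact/smooth_continuous/moll_smooth. Qed.

Lemma moll_bsupp d : 0 <= d -> bsupp d (moll d).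
Proof. by move=> d0 x dx; rewrite /moll moll0_bsupp// mulr0. Qed.

Lemma moll_even d x y : moll d (x - y) = moll d (y - x).
Proof.
rewrite /moll /moll0 /dotv; congr (_ * bump1 0 (_ - _)); apply: eq_bigr => i _.
by rewrite !mxE; ring.
Qed.

Lemma intg_moll d : 0 < d -> intg (moll d) = 1.
Proof.
move=> d0; rewrite intgZ; last exact/moll0_lint/ltW.
by rewrite mulVf// gt_eqF// intg_moll0_gt0.
Qed.

Lemma lint_moll d : 0 < d -> lint (moll d).
Proof. by move=> d0; apply/lintZ/moll0_lint/ltW. Qed.

Lemma lint_moll_sub d x : 0 < d -> lint (fun y => moll d (x - y)).
Proof. by move=> d0; under eq_fun do rewrite moll_even; apply: lint_shift; exact: lint_moll. Qed.

Lemma intg_moll_sub d x : 0 < d -> intg (fun y => moll d (x - y)) = 1.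
Proof.
move=> d0; under eq_intg do rewrite moll_even.
by rewrite (intg_shift (- x) (lint_moll d0)) intg_moll.
Qed.

Lemma lint_moll_subl d y : 0 < d -> lint (fun x => moll d (x - y)).
Proof. by move=> d0; apply: lint_shift; exact: lint_moll. Qed.

Lemma intg_moll_subl d y : 0 < d -> intg (fun x => moll d (x - y)) = 1.
Proof. by move=> d0; rewrite (intg_shift (- y) (lint_moll d0)) intg_moll. Qed.

Lemma conv_moll_bsupp f (r d : R) : 0 <= d -> bsupp r f -> bsupp (r + d) (conv f (moll d)).
Proof.
move=> d0 f0 x rx; rewrite /conv -[RHS](@intg0 R n); apply: eq_intg => y.
have [yr|yr] := leP `|y| r; last by rewrite f0// mul0r.
rewrite moll_bsupp ?mulr0//; apply: (lt_le_trans _ (lerB_dist x y)).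
by rewrite ltrBrDr; apply: le_lt_trans rx; rewrite addrC lerD2r.
Qed.

Lemma convB f g k (r s : R) : lint f -> bsupp r f -> lint g -> bsupp s g -> continuous k ->
  conv (fun x => f x - g x) k = (fun x => conv f k x - conv g k x).
Proof.
move=> hf f0 hg g0 ck; apply/funext => x.
rewrite /conv -intgB; [|exact: lint_conv f0 ck|exact: lint_conv g0 ck].
by apply: eq_intg => y; rewrite mulrBl.
Qed.

(** The contraction comes from Tonelli's theorem and from the unit mass of the mollifier in either
    variable. *)
Lemma conv_moll_L1 f (r d : R) : 0 < d -> lint f -> bsupp r f ->
  lint (conv f (moll d)) /\ intg (fun x => `|conv f (moll d) x|) <= intg (fun x => `|f x|).
Proof.
move=> d0 hf f0; pose F x y := `|f y| * moll d (x - y).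
have hn := lint_norm hf.
have n0 : bsupp r (fun x => `|f x|) by move=> x /f0->; rewrite normr0.
have eF y : intg (F^~ y) = `|f y|.
  have := intgZ `|f y| (lint_moll_subl y d0); rewrite (intg_moll_subl y d0) mulr1; exact.
have [h1 h2] : lint (fun x => intg (F x)) /\
    intg (fun x => intg (F x)) = intg (fun y => intg (F^~ y)).
  apply: lint_tonelli => //.
  - apply: measurable_funM; first exact: (measurable_snd_comp (lint_meas hn)).
    exact: (measurable_sub_comp (@moll_cont d)).
  - by move=> x y; rewrite mulr_ge0// moll_ge0.
  - by move=> y; apply: lintZ; exact: lint_moll_subl.
  - by rewrite (_ : (fun y => _) = (fun y => `|f y|))//; exact/funext.
  - by move=> x; exact: lint_conv n0 (@moll_cont d).
have sc := conv_smooth hf f0 (moll_smooth d).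
have le x : `|conv f (moll d) x| <= intg (F x).
  apply: (le_trans (le_abs_intg (lint_conv x hf f0 (@moll_cont d)))).
  rewrite le_eqVlt; apply/orP; left; apply/eqP; apply: eq_intg => y.
  by rewrite normrM (ger0_norm (moll_ge0 _ d0)).
have hc : lint (conv f (moll d)).
  exact: lint_dom (lmeas_cont (smooth_continuous sc)) h1 (laeW le).
split; first exact: hc.
apply: (@le_trans _ _ (intg (fun x => intg (F x)))).
  exact: le_intg (lint_norm hc) h1 (laeW le).
by rewrite h2 le_eqVlt; apply/orP; left; apply/eqP; exact: eq_intg.
Qed.

(** Jensen's inequality for the square, as the nonnegativity of a variance: the integral of
    [(f - c)^2] against the mollifier is expanded, with [c] the mean value itself. *)
Lemma conv_moll_sqr f (r d : R) x : 0 < d -> lint f -> lint (fun x => f x ^+ 2) -> bsupp r f ->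
  conv f (moll d) x ^+ 2 <= conv (fun x => f x ^+ 2) (moll d) x.
Proof.
move=> d0 hf hf2 f0; set c := conv f (moll d) x.
have f20 : bsupp r (fun x => f x ^+ 2) by move=> y /f0->; rewrite expr0n.
have l1 := lint_conv x hf f0 (@moll_cont d).
have l2 := lint_conv x hf2 f20 (@moll_cont d).
have l3 := lint_moll_sub x d0.
have : 0 <= intg (fun y => (f y - c) ^+ 2 * moll d (x - y)).
  by apply: intg_ge0 => y; rewrite mulr_ge0 ?sqr_ge0 ?moll_ge0.
have -> : intg (fun y => (f y - c) ^+ 2 * moll d (x - y)) =
   intg (fun y => f y ^+ 2 * moll d (x - y) + - (2 * c) * (f y * moll d (x - y)) + c ^+ 2 * moll d (x - y)).
  by apply: eq_intg => y; ring.
rewrite intgD; [|by apply: lintD => //; exact: lintZ|exact: lintZ].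
rewrite intgD; [|by []|exact: lintZ].
rewrite (intgZ (- (2 * c)) l1) (intgZ (c ^+ 2) l3) intg_moll_sub// -/(conv (fun x => f x ^+ 2) (moll d) x) -/(conv f (moll d) x) -/c.
by move=> h; lra.
Qed.

Lemma conv_moll_cvg g (r : R) x : continuous g -> bsupp r g ->
  conv g (moll k.+1%:R^-1) x @[k --> \oo] --> g x.
Proof.
move=> cg g0; apply/cvgrPdist_le => e e0.
have /nbhs_ballP[s /= s0 hs] : \forall y \near x, `|g x - g y| <= e.
  by have /cvgrPdist_le/(_ e e0) := cg x.
near=> k.
have : k.+1%:R^-1 < s.
  near: k; have := @cvg_harmonic R => /cvgrPdist_lt/(_ s s0); apply: filterS => k /=.
  by rewrite sub0r normrN ger0_norm.
set d : R := k.+1%:R^-1 => ds; have d0 : 0 < d by rewrite invr_gt0 ltr0n.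
have hg := lint_continuous cg g0.
have -> : g x - conv g (moll d) x = intg (fun y => (g x - g y) * moll d (x - y)).
  rewrite -[X in X - _]mulr1 -(intg_moll_sub x d0) -intgZ; last exact: lint_moll_sub.
  rewrite -intgB; [|apply: lintZ; exact: lint_moll_sub|exact: lint_conv g0 (@moll_cont d)].
  by apply: eq_intg => y; rewrite mulrBl.
have l1 : lint (fun y => (g x - g y) * moll d (x - y)).
  under eq_fun do rewrite mulrBl; apply: lintB; first by apply: lintZ; exact: lint_moll_sub.
  exact: lint_conv g0 (@moll_cont d).
apply: (le_trans (le_abs_intg l1)).
apply: (@le_trans _ _ (intg (fun y => e * moll d (x - y)))); last first.
  by rewrite intgZ ?intg_moll_sub ?mulr1//; exact: lint_moll_sub.
apply: le_intg; [exact: lint_norm|apply: lintZ; exact: lint_moll_sub|apply: laeW => y].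
rewrite normrM (ger0_norm (moll_ge0 _ d0)).
have [xy|xy] := leP `|x - y| d; last by rewrite (moll_bsupp (ltW d0) xy) !mulr0.
rewrite ler_wpM2r ?moll_ge0//; apply: hs; rewrite /= -ball_normE/=.
exact: le_lt_trans ds.
Unshelve. all: by end_near. Qed.

Lemma mollify_L1_cont g (r : R) : continuous g -> bsupp r g ->
  intg (fun x => `|g x - conv g (moll k.+1%:R^-1) x|) @[k --> \oo] --> 0.
Proof.
move=> cg g0; have hg := lint_continuous cg g0.
have [M M0 hM] := continuous_bounded cg g0.
have dk (k : nat) : (0 : R) < k.+1%:R^-1 by rewrite invr_gt0 ltr0n.
have dk1 (k : nat) : (k.+1%:R^-1 : R) <= 1 by rewrite invf_le1 ?ltr0n// ler1n.
have hc k := conv_moll_L1 (dk k) hg g0.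
rewrite -(@intg0 R n).
have [] // := @intg_dct R n (fun k x => `|g x - conv g (moll k.+1%:R^-1) x|) (fun=> 0)
  (fun x => 2 * M * \1_(cube 0 (r + 1)) x).
- by move=> k; apply: lint_meas; apply/lint_norm/lintB => //; have [] := hc k.
- exact: lmeas_cst.
- apply: laeW => x.
  have h : g x - conv g (moll k.+1%:R^-1) x @[k --> \oo] --> g x - g x.
    by apply: cvgB; [exact: cvg_cst|exact: conv_moll_cvg g0].
  rewrite (_ : 0 = `|g x - g x|); last by rewrite subrr normr0.
  exact: cvg_norm h.
- by apply/lintZ/lint_indic; [exact: cube_measurable|exact: leb_cube_lty].
- move=> k; apply: laeW => x; rewrite normr_id indicE.
  have [xr|xr] := boolP (x \in _); last first.
    have rx : r + 1 < `|x|.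
      by rewrite ltNge; apply: contra xr => xr; rewrite inE /cube/= subr0.
    rewrite g0; last by apply: lt_trans rx; rewrite ltrDl.
    rewrite (conv_moll_bsupp (ltW (dk k)) g0) ?subrr ?normr0 ?mulr0//.
    by apply: le_lt_trans rx; rewrite lerD2l.
  rewrite mulr1 (le_trans (ler_normB _ _))// mulr_natl mulr2n lerD//.
  apply: (le_trans (le_abs_intg (lint_conv x hg g0 (@moll_cont k.+1%:R^-1)))).
  have -> : M = intg (fun y => M * moll k.+1%:R^-1 (x - y)).
    by rewrite (intgZ M (lint_moll_sub x (dk k))) (intg_moll_sub x (dk k)) mulr1.
  apply: le_intg; [exact/lint_norm/(lint_conv _ hg g0 (@moll_cont _))|apply: lintZ; exact: lint_moll_sub|].
  apply: laeW => y; rewrite normrM (ger0_norm (moll_ge0 _ (dk k))).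
  by apply: ler_wpM2r; [exact: moll_ge0 (dk k)|exact: hM].
Qed.

(** Through a continuous [g] close to [f] in [L^1]: mollification contracts the [L^1] norm, so it
    does not enlarge the error [f - g]. *)
Lemma mollify_L1 f (r : R) : lint f -> bsupp r f ->
  intg (fun x => `|conv f (moll k.+1%:R^-1) x - f x|) @[k --> \oo] --> 0.
Proof.
move=> hf f0; apply/cvgrPdist_le => e e0.
have e3 : 0 < e / 3 by rewrite divr_gt0.
have [_ /(_ _ e3)[g [s [cg g0 hfg]]]] := approximable_lint hf.
have hg := lint_continuous cg g0.
have dk (k : nat) : (0 : R) < k.+1%:R^-1 by rewrite invr_gt0 ltr0n.
have fg0 : bsupp (Num.max r s) (fun x => f x - g x).
  by move=> x; rewrite gt_max => /andP[rx sx]; rewrite f0// g0// subrr.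
have := mollify_L1_cont cg g0 => /cvgrPdist_le/(_ _ e3); apply: filterS => k.
have [c1 c2] := conv_moll_L1 (dk k) (lintB hf hg) fg0.
have [c3 _] := conv_moll_L1 (dk k) hg g0.
have [c4 _] := conv_moll_L1 (dk k) hf f0.
rewrite !sub0r !normrN (ger0_norm (intg_ge0 _))// => h; rewrite ger0_norm ?intg_ge0//.
rewrite (convB hf f0 hg g0 (@moll_cont _)) in c1 c2.
apply: (le_trans (intg_dist_triangle c4 c3 hf)).
have h2 : intg (fun x => `|conv g (moll k.+1%:R^-1) x - f x|) <= e / 3 + e / 3.
  apply: (le_trans (intg_dist_triangle c3 hg hf)); apply: lerD.
    by under eq_intg do rewrite distrC.
  by under eq_intg do rewrite distrC.
have := le_trans c2 hfg; lra.
Qed.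

End Mollifier.

(** * Fast convergence in [L^1], and membership in [L^p] *)

Section FastConvergence.
Context d (X : measurableType d) (R : realType) (mu : {measure set X -> \bar R}).
Implicit Types f g : X -> R.

(* Partial converse of dominated convergence; the bound is [|f|] plus the sum of all [|F k - f|]. *)
Lemma fast_cvg_dominated (F : nat -> X -> R) f :
  (forall k, mu.-integrable setT (EFin \o F k)) -> mu.-integrable setT (EFin \o f) ->
  (forall k, \int[mu]_x `|F k x - f x| <= 1 / (2 ^ k.+1)%:R) ->
  {ae mu, forall x, F k x @[k --> \oo] --> f x} /\
  exists2 G, mu.-integrable setT (EFin \o G) & {ae mu, forall x, forall k, `|F k x| <= G x}.
Proof.
move=> hF hf hFf.
pose D k x : R := `|F k x - f x|.
have hD k : mu.-integrable setT (EFin \o D k).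
  apply: (integrable_norm (f := fun x => F k x - f x)).
  exact: (integrableB measurableT (hF k) hf).
have mD k : measurable_fun setT (EFin \o D k) := measurable_int _ (hD k).
have D0 k x : (0 <= (D k x)%:E)%E by rewrite lee_fin normr_ge0.
pose S x := (\sum_(k <oo) (D k x)%:E)%E.
have mS : measurable_fun setT S.
  by apply: ge0_emeasurable_sum => // k _; exact: mD.
have S0 x : (0 <= S x)%E by apply: nneseries_ge0 => k _ _; exact: D0.
have iS : mu.-integrable setT S.
  apply/integrableP; split => //.
  rewrite (eq_integral S); last by move=> x _; rewrite gee0_abs.
  rewrite integral_nneseries//.
  apply: (@le_lt_trans _ _ 1%:E); last exact: ltry.
  apply: le_trans (epsilon_trick0 xpredT (@ler01 R)).
  apply: lee_nneseries => k _; first by move=> _; exact: integral_ge0.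
  by rewrite -EFin_Rintegral// lee_fin; exact: hFf.
have fS : {ae mu, forall x, S x \is a fin_num}.
  by apply: ae_imp (integrable_ae measurableT iS) => x; apply.
have DS x k : S x \is a fin_num -> \sum_(0 <= j < k) D j x <= fine (S x).
  move=> Sx; rewrite -lee_fin fineK// -sumEFin.
  exact: (@nneseries_lim_ge _ (fun j => (D j x)%:E) xpredT 0 k).
have D1 x k : S x \is a fin_num -> D k x <= fine (S x).
  move=> Sx; apply: le_trans (DS x k.+1 Sx).
  by rewrite big_nat_recr//= lerDr; apply: sumr_ge0 => j _; exact: normr_ge0.
split.
  apply: ae_imp fS => x Sx.
  have c : cvgn (series (fun k => D k x)).
    apply: nondecreasing_is_cvgn.
      by apply/nondecreasing_seqP => k; rewrite /series/= big_nat_recr//= lerDl normr_ge0.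
    by exists (fine (S x)) => _ [k _ <-]; exact: DS.
  have /cvgrPdist_lt h := cvg_series_cvg_0 c.
  apply/cvgrPdist_lt => e e0; have := h _ e0; apply: filterS => k.
  by rewrite sub0r normrN /D normr_id distrC.
exists (fun x => `|f x| + fine (S x)).
  have ifS : mu.-integrable setT (EFin \o (fun x => fine (S x))).
    apply: (le_integrable measurableT _ _ iS).
      by apply/measurable_EFinP; apply: measurableT_comp => //.
    by move=> x _; rewrite /comp; case: (S x) => [r| |]; rewrite /= ?normr0 ?leey.
  exact: (integrableD measurableT (integrable_norm hf) ifS).
apply: ae_imp fS => x Sx k; have := D1 x k Sx; rewrite /D => h.
rewrite -[F k x](subrK (f x)) addrC (le_trans (ler_normD _ _))// lerD2l//.
Qed.

Lemma Lnorm_ltyP f (p : R) : measurable_fun setT f -> p != 0 ->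
  ('N[mu]_(p%:E)[EFin \o f] < +oo)%E <->
  mu.-integrable setT (EFin \o (fun x => `|f x| `^ p)).
Proof.
move=> mf p0.
have mp : measurable_fun setT (EFin \o (fun x => `|f x| `^ p)).
  apply/measurable_EFinP; apply: (measurableT_comp (measurable_powR p)).
  exact: measurableT_comp.
have e : (\int[mu]_x `|(f x)%:E| `^ p)%E = (\int[mu]_x `|(`|f x| `^ p)%:E|)%E.
  by apply: eq_integral => x _ /=; rewrite [in RHS]ger0_norm ?powR_ge0.
have p1 : p^-1 != 0 by rewrite invr_neq0.
split.
  rewrite unlock => /(lty_poweRy p1) h; apply/integrableP; split => //.
  by rewrite -e.
move=> /integrableP[_]; rewrite -e unlock => h.
exact: poweR_lty.
Qed.

End FastConvergence.

Section LpSpaces.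
Context {R : realType} {n : nat}.
Local Notation Rn := 'rV[R]_n.
Local Notation T := (lebRn R n).
Implicit Types (f g h : Rn -> R) (x y z v : Rn) (U K : set Rn).

Transparent lint intg lmeas lae.

Lemma lint_fast (F : nat -> Rn -> R) f : (forall k, lint (F k)) -> lint f ->
  (forall k, intg (fun x => `|F k x - f x|) <= 1 / (2 ^ k.+1)%:R) ->
  lae (fun x => F k x @[k --> \oo] --> f x) /\
  exists2 G, lint G & lae (fun x => forall k, `|F k x| <= G x).
Proof. exact: (@fast_cvg_dominated _ T R (@leb R n) F f). Qed.

Lemma LpP (p : R) U f : measurable (U : set T) -> p != 0 ->
  Lp p U f <-> lmeas (f \_ U) /\ lint (fun x => `|(f \_ U) x| `^ p).
Proof.
move=> mU p0; split=> [[/(lmeas_restrict f mU) mf h]|[mf h]]; split => //.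
- by move: h; rewrite /Lp_norm; move/(@Lnorm_ltyP _ T R (@leb R n) _ p mf p0).
- exact/lmeas_restrict.
- by rewrite /Lp_norm; apply/(@Lnorm_ltyP _ T R (@leb R n) _ p mf p0).
Qed.

Lemma Rintegral_intg U f : \int[@leb R n]_(x in (U : set T)) (f : T -> R) x = intg (f \_ U).
Proof. exact: Rintegral_mkcond. Qed.

Opaque lint intg lmeas lae.

Lemma restrictE U f x : (f \_ U) x = f x * \1_U x.
Proof. by rewrite /patch indicE; case: ifP => _; rewrite ?mulr1 ?mulr0. Qed.

Lemma Lp1P U f : measurable (U : set T) -> Lp 1 U f <-> lint (f \_ U).
Proof.
move=> mU; split.
  move=> /(LpP _ mU (oner_neq0 R))[mf].
  under eq_fun do rewrite powRr1//; move=> h.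
  by apply: (lint_dom mf h); apply: laeW.
move=> h; apply/(LpP _ mU (oner_neq0 R)); split; first exact: lint_meas.
by under eq_fun do rewrite powRr1//; exact: lint_norm.
Qed.

Lemma Lp2P U f : measurable (U : set T) ->
  Lp 2 U f <-> lmeas (f \_ U) /\ lint (fun x => (f \_ U) x ^+ 2).
Proof.
move=> mU; have e : (fun x => `|(f \_ U) x| `^ 2) = (fun x => (f \_ U) x ^+ 2).
  by apply/funext => x; rewrite powR_mulrn// real_normK// num_real.
have /LpP h : (2 : R) != 0 by rewrite pnatr_eq0.
by rewrite -e; exact: h.
Qed.

End LpSpaces.

(** * Weak gradients *)

Section WeakGradient.
Context {R : realType} {n : nat}.
Local Notation Rn := 'rV[R]_n.
Local Notation T := (lebRn R n).
Implicit Types (f h u phi psi : Rn -> R) (g : Rn -> Rn) (x y z v : Rn) (U K : set Rn).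

(** Compactness, in its near-covering form, makes the radius uniform on [K]. The thickened set is
    the image of [K] times a cube under addition, hence compact. *)
Lemma compact_thicken K U : compact K -> open U -> K `<=` U ->
  exists2 d : R, 0 < d & exists K', [/\ compact K', K' `<=` U & forall x, K x -> cube x d `<=` K'].
Proof.
move=> cK oU KU.
have /compact_near_coveringP/(_ R (0^'+) (fun d x => cube x d `<=` U) _) h := cK.
have {h} : \forall d \near 0^'+, K `<=` (fun x => cube x d `<=` U).
  apply: h => x Kx.
  have [e /= e0 eU] : nbhs_ball x U by rewrite nbhs_ballE; exact/oU/KU.
  exists (ball x (e / 2), [set d : R | d < e / 2]) => /=.
    split; first by apply: nbhsx_ballx; rewrite divr_gt0.
    by apply: nbhs_right_lt; rewrite divr_gt0.
  move=> [y d] /= [xy de] z; rewrite /cube/= => zd; apply: eU.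
  rewrite -ball_normE/= in xy *.
  rewrite -[x](subrK y) -addrA (le_lt_trans (ler_normD _ _))// (splitr e) ltrD//.
  by rewrite distrC (le_lt_trans zd).
move=> h; have [d d0 dU] : exists2 d : R, 0 < d & K `<=` (fun x => cube x d `<=` U).
  have /filter_ex[d [d0 dU]] : \forall d \near 0^'+, 0 < d /\ K `<=` (fun x : Rn => cube x d `<=` U).
    by apply: filterS2 (nbhs_right_gt (0 : R)) h.
  by exists d.
exists d => //; pose f (z : Rn * Rn) := z.1 + z.2.
exists (f @` (K `*` cube 0 d)); split.
- apply: continuous_compact; last by apply: compact_setX => //; exact: cube_compact.
  by apply: continuous_subspaceT => z; apply: add_continuous.
- move=> _ [[x y] [/= Kx yd] <-]; apply: (dU x Kx); rewrite /cube/= /f/= addrAC subrr add0r.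
  by move: yd; rewrite /cube/= subr0.
- move=> x Kx y yx; exists (x, y - x); last by rewrite /f/= addrC subrK.
  by split => //=; rewrite /cube/= subr0.
Qed.

Lemma open_exhaustion U : open U -> exists K : nat -> set Rn,
  (forall m, compact (K m) /\ K m `<=` U) /\ U `<=` \bigcup_m K m.
Proof.
move=> oU; pose C m := ~` \bigcup_(y in ~` U) ball y (m.+1%:R^-1 : R).
exists (fun m => cube 0 m%:R `&` C m); split => [m|x Ux].
  have m0 : (0 : R) < m.+1%:R^-1 by rewrite invr_gt0.
  split; last first.
    move=> x [_ Cx]; apply: contrapT => nU; apply: Cx; exists x => //.
    exact: ballxx.
  apply: (subclosed_compact _ (@cube_compact R n 0 m%:R)); last by move=> x [].
  apply: closedI; first exact: cube_closed.
  by apply: open_closedC; apply: bigcup_open => y _; exact: ball_open.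
have [e /= e0 eU] : nbhs_ball x U by rewrite nbhs_ballE; exact: oU.
have : \forall m \near \oo, `|x| <= m%:R /\ m.+1%:R^-1 < e.
  near=> m; split; first by near: m; exact: nbhs_infty_ger.
  near: m; have := @cvg_harmonic R => /cvgrPdist_lt/(_ e e0); apply: filterS => k /=.
  by rewrite sub0r normrN ger0_norm.
move=> /filter_ex[m [xm me]]; exists m => //; split.
  by rewrite /cube/= subr0.
move=> [y nU yx]; apply: nU; apply: eU; apply: ball_sym; exact: le_ball (ltW me) _ yx.
Unshelve. all: by end_near. Qed.

Lemma lae_open U (P : Rn -> Prop) : open U ->
  (forall K, compact K -> K `<=` U -> lae (fun x => K x -> P x)) -> lae (fun x => U x -> P x).
Proof.
move=> /open_exhaustion[K [cK UK]] h.
have : lae (fun x => forall m, K m x -> P x).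
  by apply: lae_nat => m; have [c s] := cK m; exact: h.
by apply: lae_imp => x hx /UK[m _ /hx].
Qed.

Lemma Ccinf_cube x (d : R) phi : smooth phi -> (forall y, ~ cube x d y -> phi y = 0) ->
  Ccinf (cube x d) phi.
Proof.
move=> sp p0; have h : closure [set x | phi x != 0] `<=` cube x d.
  apply: (@subset_trans _ (closure (cube x d))); last first.
    by rewrite -(closure_id _).1//; exact: cube_closed.
  apply: closureS => y /= py; apply: contrapT => ny.
  by move: py; rewrite p0 ?eqxx.
split => //; apply: subclosed_compact h; [exact: closed_closure|exact: cube_compact].
Qed.

Lemma Ccinf_out U phi x : Ccinf U phi -> ~ U x -> phi x = 0.
Proof. by move=> hp nU; apply: contrapT => /eqP px; apply: nU; exact: Ccinf_supp hp px. Qed.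

Lemma moll_test x (d : R) : 0 < d -> Ccinf (cube x d) (fun y => moll d (x - y)).
Proof.
move=> d0; apply: Ccinf_cube; first exact/smooth_reflect/moll_smooth.
move=> y; rewrite /cube/= distrC => /negP; rewrite -ltNge => xy.
exact: moll_bsupp (ltW d0) _ xy.
Qed.

Lemma intg_test K U u psi : K `<=` U -> Ccinf K psi ->
  \int[@leb R n]_(x in (U : set T)) (u x * psi x) = intg (fun x => (u \_ K) x * psi x).
Proof.
move=> KU hp; rewrite (Rintegral_intg U (fun x => u x * psi x)); apply: eq_intg => x.
rewrite !restrictE !indicE; have [xK|xK] := boolP (x \in K).
  have -> : x \in U by rewrite inE; apply: KU; rewrite inE in xK.
  by rewrite !mulr1.
rewrite (Ccinf_out hp) ?mulr0 ?mul0r// => Kx.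
by move: xK; rewrite mem_set.
Qed.

Lemma conv_moll_test K U u x (d : R) : 0 < d -> cube x d `<=` K -> K `<=` U ->
  conv (u \_ K) (moll d) x = \int[@leb R n]_(y in (U : set T)) (u y * moll d (x - y)).
Proof.
move=> d0 xK KU.
rewrite (@intg_test K U u (fun y => moll d (x - y)) KU)//.
exact: CcinfW (moll_test x d0).
Qed.

Lemma conv_wgrad U u g K x (d : R) i : is_wgrad U u g -> compact K -> K `<=` U -> 0 < d ->
  cube x d `<=` K ->
  partial i (conv (u \_ K) (moll d)) x = conv ((fun y => g y 0 i) \_ K) (moll d) x.
Proof.
move=> [[mu hu] hg wg] cK KU d0 xK.
have mK : measurable (K : set T) by exact: compact_measurable_leb.
have lu : lint (u \_ K) by apply/Lp1P => //; exact: hu.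
have [r hr] := compact_rV_bounded cK.
have u0 : bsupp r (u \_ K).
  move=> y ry; rewrite restrictE indicE memNset ?mulr0// => /hr; rewrite leNgt.
  by rewrite ry.
have hphi : Ccinf K (fun y => moll d (x - y)) := CcinfW xK (moll_test x d0).
rewrite (partial_conv i lu u0 (moll_smooth d)) (@conv_moll_test K U)//.
have e : (fun y => partial i (moll d) (x - y)) = (fun y => - partial i (fun y => moll d (x - y)) y).
  apply/funext => y; rewrite (partial_reflect i x (smooth_diff (moll_smooth d))).
  by rewrite opprK.
have hpp := Ccinf_partial i hphi.
rewrite /conv; have -> : (fun y => (u \_ K) y * partial i (moll d) (x - y)) =
    (fun y => - ((u \_ K) y * partial i (fun y => moll d (x - y)) y)).
  by apply/funext => y; rewrite (congr1 (@^~ y) e) mulrN.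
rewrite intgN; last first.
  under eq_fun do rewrite mulrC.
  have [M M0 hM] := Ccinf_bounded hpp.
  exact: lintM_bounded (lmeas_cont (Ccinf_cont hpp)) hM lu.
rewrite -(@intg_test K U u _ KU hpp).
by rewrite (wg _ i (CcinfW KU hphi)) opprK.
Qed.

Definition halving (k : nat) : R := 1 / (2 ^ k.+1)%:R.

Lemma halving_gt0 k : 0 < halving k.
Proof. by rewrite divr_gt0// ltr0n expn_gt0. Qed.

(** One sequence of radii serves finitely many functions at once. The rate [halving k] is the
    summable rate that [lint_fast] turns into convergence almost everywhere with a dominating
    function. *)
Lemma fast_radii (I : finType) (h : I -> Rn -> R) (r d : R) : 0 < d ->
  (forall i, lint (h i)) -> (forall i, bsupp r (h i)) ->
  exists s : nat -> R, forall k, [/\ 0 < s k, s k <= d &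
    forall i, intg (fun x => `|conv (h i) (moll (s k)) x - h i x|) <= halving k].
Proof.
move=> d0 hh h0.
have H k : exists s : R, [/\ 0 < s, s <= d &
    forall i, intg (fun x => `|conv (h i) (moll s) x - h i x|) <= halving k].
  have : \forall j \near \oo, (j.+1%:R^-1 : R) <= d /\
      forall i, intg (fun x => `|conv (h i) (moll j.+1%:R^-1) x - h i x|) <= halving k.
    apply: filterI.
      have := @cvg_harmonic R => /cvgrPdist_le/(_ d d0); apply: filterS => j /=.
      by rewrite sub0r normrN ger0_norm.
    apply: (@filter_forall nat I _ \oo) => i.
    have := mollify_L1 (hh i) (h0 i) => /cvgrPdist_le/(_ _ (halving_gt0 k)).
    by apply: filterS => j; rewrite sub0r normrN ger0_norm ?intg_ge0.
  move=> /filter_ex[j [jd hj]]; by exists j.+1%:R^-1; split => //; rewrite invr_gt0 ltr0n.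
by have [s hs] := choice H; exists s.
Qed.

(** The point is the integrable bound [G] for the squares. By Jensen's inequality the square of a
    mollified function is at most the mollified square, and the mollified squares converge fast in
    [L^1], so they have a common integrable bound. *)
Lemma wgrad_smooth_approx U u g K : open U -> is_wgrad U u g -> compact K -> K `<=` U ->
  (forall K', compact K' -> K' `<=` U -> lint (fun x => (u \_ K') x ^+ 2) /\
     forall i, lint (fun x => ((fun y => g y 0 i) \_ K') x ^+ 2)) ->
  exists W : nat -> Rn -> R,
  [/\ forall j, smooth (W j),
      lae (fun x => K x -> W j x @[j --> \oo] --> u x),
      forall i, lae (fun x => K x -> partial i (W j) x @[j --> \oo] --> g x 0 i) &
      exists2 G, lint G & lae (fun x => K x -> forall j, W j x ^+ 2 <= G x /\
        forall i, partial i (W j) x ^+ 2 <= G x)].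
Proof.
move=> oU wg cK KU h2.
have [d d0 [K' [cK' K'U KK']]] := compact_thicken cK oU KU.
have [hu hg] := h2 _ cK' K'U.
have mK' : measurable (K' : set T) by exact: compact_measurable_leb.
have [[mu lu] lg _] := wg.
pose h (o : option 'I_n) : Rn -> R :=
  if o is Some i then (fun y => g y 0 i) \_ K' else u \_ K'.
have lh o : lint (h o).
  case: o => [i|] /=; apply/Lp1P => //; last exact: lu.
  by have [_] := lg i; apply.
have lh2 o : lint (fun x => h o x ^+ 2) by case: o => [i|]; [exact: hg|exact: hu].
have [r hr] := compact_rV_bounded cK'.
have hK' o x : ~ K' x -> h o x = 0.
  by move=> nK; case: o => [i|] /=; rewrite restrictE indicE memNset ?mulr0.
have h0 o : bsupp r (h o).
  by move=> y ry; apply: hK' => /hr; rewrite leNgt ry.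
have h20 o : bsupp r (fun x => h o x ^+ 2) by move=> x /h0->; rewrite expr0n.
(* The boolean selects the square of the function; the radii have to be good for the functions and
   for their squares. *)
pose H (ob : option 'I_n * bool) : Rn -> R :=
  if ob.2 then (fun x => h ob.1 x ^+ 2) else h ob.1.
have [s hs] : exists s : nat -> R, forall k, [/\ 0 < s k, s k <= d &
    forall i, intg (fun x => `|conv (H i) (moll (s k)) x - H i x|) <= halving k].
  apply: (@fast_radii _ H r d d0) => i; case: i => o b; case: b; [exact: lh2|exact: lh|exact: h20|exact: h0].
have s0 k : 0 < s k by have [] := hs k.
have sd k : s k <= d by have [] := hs k.
have fast o : lae (fun x => conv (H o) (moll (s k)) x @[k --> \oo] --> H o x) /\
    exists2 G, lint G & lae (fun x => forall k, `|conv (H o) (moll (s k)) x| <= G x).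
  have [lH H0] : lint (H o) /\ bsupp r (H o) by case: o => o b; case: b; split; [exact: lh2|exact: h20|exact: lh|exact: h0].
  apply: lint_fast => //.
  - by move=> k; have [] := conv_moll_L1 (s0 k) lH H0.
  - by move=> k; have [_ _] := hs k; apply.
have /choice[G hG] : forall o, exists G : Rn -> R, lint G /\
    lae (fun x => forall k, `|conv (H (o, true)) (moll (s k)) x| <= G x).
  move=> o; by have [_ [G h1 h3]] := fast (o, true); exists G.
have Kc x k : K x -> cube x (s k) `<=` K'.
  move=> Kx y yx; apply: (KK' x Kx); exact: le_trans (sd k).
have pW i x k : K x -> partial i (conv (u \_ K') (moll (s k))) x = conv (h (Some i)) (moll (s k)) x.
  move=> Kx; apply: (conv_wgrad i wg cK' K'U (s0 k)); exact: Kc.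
exists (fun k => conv (u \_ K') (moll (s k))); split.
- by move=> k; exact: conv_smooth (lh None) (h0 None) (moll_smooth _).
- have [+ _] := fast (None, false); apply: lae_imp => x /= hx Kx.
  move: hx; rewrite /H /= [X in _ --> X -> _](_ : _ = u x)//.
  by rewrite restrictE indicE mem_set ?mulr1//; apply: (KK' x Kx); rewrite /cube/= subrr normr0 ltW.
- move=> i; have [+ _] := fast (Some i, false); apply: lae_imp => x /= hx Kx.
  under eq_fun do rewrite (pW i x _ Kx).
  move: hx; rewrite /H /= [X in _ --> X -> _](_ : _ = g x 0 i)//.
  by rewrite restrictE indicE mem_set ?mulr1//; apply: (KK' x Kx); rewrite /cube/= subrr normr0 ltW.
- exists (fun x => \sum_o G o x); first by apply: lint_sum => o; have [] := hG o.
  have : lae (fun x => forall o, forall k, `|conv (H (o, true)) (moll (s k)) x| <= G o x).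
    by apply: lae_fin => o; have [] := hG o.
  apply: lae_imp => x hx Kx k.
  have le o : conv (h o) (moll (s k)) x ^+ 2 <= \sum_o G o x.
    apply: (@le_trans _ _ (G o x)).
      apply: le_trans (hx o k).
      apply: le_trans (conv_moll_sqr x (s0 k) (lh o) (lh2 o) (h0 o)) _.
      exact: ler_norm.
    rewrite (bigD1 o)//= lerDl; apply: sumr_ge0 => o' _.
    exact: le_trans (normr_ge0 _) (hx o' k).
  by split => [|i]; [exact: (le None)|rewrite pW//; exact: (le (Some i))].
Qed.

Lemma L1loc_lint U f K : L1loc U f -> compact K -> K `<=` U -> lint (f \_ K).
Proof. by move=> [_ h] cK KU; apply/Lp1P; [exact: compact_measurable_leb|exact: h]. Qed.

(** Mollified values are integrals against translated mollifiers, so they coincide for the two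
    functions; along common fast radii they converge almost everywhere to the functions
    themselves. *)
Lemma test_eq_ae U f f' : open U -> L1loc U f -> L1loc U f' ->
  (forall phi, Ccinf U phi -> \int[@leb R n]_(x in (U : set T)) (f x * phi x) =
                              \int[@leb R n]_(x in (U : set T)) (f' x * phi x)) ->
  lae (fun x => U x -> f x = f' x).
Proof.
move=> oU hf hf' e; apply: lae_open => // K cK KU.
have [d d0 [K' [cK' K'U KK']]] := compact_thicken cK oU KU.
pose h b : Rn -> R := (if b : bool then f else f') \_ K'.
have lh b : lint (h b) by case: b; exact: L1loc_lint cK' K'U.
have [r hr] := compact_rV_bounded cK'.
have h0 b : bsupp r (h b).
  move=> y ry; rewrite /h restrictE indicE memNset ?mulr0// => /hr; rewrite leNgt.
  by rewrite ry.
have [s hs] := fast_radii d0 lh h0.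
have fast b : lae (fun x => conv (h b) (moll (s k)) x @[k --> \oo] --> h b x).
  have [] // := @lint_fast R n (fun k => conv (h b) (moll (s k))) (h b) _ (lh b) _.
    by move=> k; have [s0 _ _] := hs k; have [] := conv_moll_L1 s0 (lh b) (h0 b).
  by move=> k; have [_ _] := hs k; apply.
apply: lae_imp2 (fast true) (fast false) => x c1 c2 Kx.
have K'x : K' x by apply: (KK' x Kx); rewrite /cube/= subrr normr0 ltW.
have : h true x = h false x.
  suff e2 : (fun k => conv (h true) (moll (s k)) x) = (fun k => conv (h false) (moll (s k)) x).
    by rewrite -(cvg_lim (@norm_hausdorff _ R^o) c1) e2; exact: (cvg_lim (@norm_hausdorff _ R^o) c2).
  apply/funext => k; have [s0 sd _] := hs k.
  have xK' : cube x (s k) `<=` K' by move=> y yx; apply: (KK' x Kx); exact: le_trans sd.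
  rewrite !(@conv_moll_test K' U)//; apply: e.
  exact: CcinfW (subset_trans xK' K'U) (moll_test x s0).
by rewrite /h !restrictE indicE mem_set// !mulr1.
Qed.

Lemma wgrad_unique U u g g' : open U -> is_wgrad U u g -> is_wgrad U u g' ->
  lae (fun x => U x -> g x = g' x).
Proof.
move=> oU [_ hg wg] [_ hg' wg'].
have : lae (fun x => forall i, U x -> g x 0 i = g' x 0 i).
  apply: lae_fin => i; apply: test_eq_ae => // phi hp; apply: oppr_inj.
  by rewrite -(wg phi i hp) -(wg' phi i hp).
by apply: lae_imp => x h Ux; apply/rowP => i; exact: h.
Qed.

Lemma wgradP U u g : is_wgrad U u g -> is_wgrad U u (wgrad U u).
Proof. by move=> h; rewrite /wgrad; case: xgetP => [g' _|/(_ g)] //. Qed.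

Lemma wgrad_ae U u g : open U -> is_wgrad U u g -> lae (fun x => U x -> wgrad U u x = g x).
Proof. by move=> oU h; exact: (wgrad_unique oU (wgradP h) h). Qed.

End WeakGradient.

(** * Trace inequalities *)

Section NewtonKernel.
Context {R : realType} {n : nat}.
Local Notation Rn := 'rV[R]_n.
Local Notation T := (lebRn R n).
Implicit Types (f h u w phi psi : Rn -> R) (x y z : Rn) (d M r : R).

Lemma partial_sum i (I : Type) (s : seq I) (F : I -> Rn -> R) : (forall j, smooth (F j)) ->
  partial i (fun x => \sum_(j <- s) F j x) = (fun x => \sum_(j <- s) partial i (F j) x).
Proof.
move=> sF; elim: s => [|j s ih].
  rewrite (_ : (fun x => _) = fun=> 0) ?partial_cst; last by apply/funext => x; rewrite big_nil.
  by apply/funext => x; rewrite big_nil.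
rewrite (_ : (fun x => \sum_(k <- j :: s) _) = fun x => F j x + \sum_(k <- s) F k x); last first.
  by apply/funext => x; rewrite big_cons.
rewrite partialD ?ih; [|exact: smooth_diff|exact/smooth_diff/smooth_sum].
by apply/funext => x; rewrite big_cons.
Qed.

Lemma partial_dotv i : partial i (fun x : Rn => dotv x x) = (fun x => 2 * x 0 i).
Proof.
rewrite /dotv partial_sum; last by move=> j; apply: smoothM; exact: smooth_coord.
apply/funext => x; transitivity (\sum_(j < n) (x 0 j * (i == j)%:R + x 0 j * (i == j)%:R)).
  apply: eq_bigr => j _; rewrite partialM; [|exact/smooth_diff/smooth_coord..].
  by rewrite !partial_coord.
rewrite (bigD1 i)//= eqxx big1 ?addr0; first by rewrite mulr1 mulr_natl mulr2n.
by move=> j ji; rewrite eq_sym (negbTE ji) !mulr0 addr0.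
Qed.

Definition rad d x : R := (Num.sqrt (dotv x x + d ^+ 2))^-1.

Lemma rad_den d x : 0 < d -> 0 < dotv x x + d ^+ 2.
Proof. by move=> d0; rewrite ltr_wpDl ?dotv_ge0// exprn_gt0. Qed.

Lemma rad_gt0 d x : 0 < d -> 0 < rad d x.
Proof. by move=> d0; rewrite invr_gt0 sqrtr_gt0 rad_den. Qed.

Lemma rad_sqr d x : 0 < d -> rad d x ^+ 2 * (dotv x x + d ^+ 2) = 1.
Proof.
move=> d0; rewrite /rad exprVn sqr_sqrtr; last exact/ltW/rad_den.
by rewrite mulVf// gt_eqF// rad_den.
Qed.

Lemma rad_smooth d : 0 < d -> smooth (rad d).
Proof.
move=> d0; apply: smoothV; first by move=> x; rewrite gt_eqF// sqrtr_gt0 rad_den.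
apply: smooth_sqrt; first by move=> x; exact: rad_den.
by apply: smoothD; [exact: smooth_dotv|exact: smooth_cst].
Qed.

Lemma partial_rad d i : 0 < d -> partial i (rad d) = (fun x => - (rad d x ^+ 3 * x 0 i)).
Proof.
move=> d0; have sd : smooth (fun x : Rn => dotv x x + d ^+ 2).
  by apply: smoothD; [exact: smooth_dotv|exact: smooth_cst].
have q0 x : 0 < dotv x x + d ^+ 2 by exact: rad_den.
have [ds ps] := partial_sqrt i q0 (smooth_diff sd).
have s0 x : Num.sqrt (dotv x x + d ^+ 2) != 0 by rewrite gt_eqF// sqrtr_gt0.
rewrite /rad (partialV i s0 ds).2 ps; apply/funext => x.
rewrite partialD; [|exact/smooth_diff/smooth_dotv|exact/smooth_diff/smooth_cst].
rewrite partial_dotv partial_cst addr0.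
by have := s0 x; set s := Num.sqrt _ => s1; field.
Qed.

Lemma smooth_radX d m : 0 < d -> smooth (fun x => rad d x ^+ m).
Proof. by move=> d0; exact/smoothX/rad_smooth. Qed.

Lemma partial_radX d i m : 0 < d ->
  partial i (fun x => rad d x ^+ m) = (fun x => - (m%:R * x 0 i * rad d x ^+ m.+2)).
Proof.
move=> d0; elim: m => [|m ih].
  by rewrite (_ : (fun x => _) = fun=> 1)// partial_cst; apply/funext => x; rewrite !mul0r oppr0.
rewrite (_ : (fun x => _ ^+ m.+1) = fun x => rad d x * rad d x ^+ m); last first.
  by apply/funext => x; rewrite exprS.
rewrite partialM; [|exact/smooth_diff/rad_smooth|exact/smooth_diff/smooth_radX].
rewrite ih partial_rad//; apply/funext => x; rewrite -natr1 !exprS; ring.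
Qed.

(** Up to a constant this is the Newtonian kernel [|x|^(2-n)], with [|x|^2] replaced by
    [|x|^2 + d^2]. Below, [lapkern d] is minus its Laplacian: positive for [n > 2], and concentrated
    at scale [d]. *)
Definition kern d x : R := rad d x ^+ (n - 2).
Definition lapkern d x : R := (n%:R * (n - 2)%:R * d ^+ 2) * rad d x ^+ n.+2.

Lemma smooth_kern d : 0 < d -> smooth (kern d).
Proof. exact: smooth_radX. Qed.

Lemma kern_ge0 d x : 0 < d -> 0 <= kern d x.
Proof. by move=> d0; apply: exprn_ge0; exact/ltW/rad_gt0. Qed.

Lemma smooth_lapkern d : 0 < d -> smooth (lapkern d).
Proof. by move=> d0; apply: smoothM; [exact: smooth_cst|exact: smooth_radX]. Qed.

Lemma lapkern_ge0 d x : 0 < d -> 0 <= lapkern d x.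
Proof.
move=> d0; apply: mulr_ge0; last exact/exprn_ge0/ltW/rad_gt0.
by apply: mulr_ge0; [exact: mulr_ge0|exact: sqr_ge0].
Qed.

Lemma laplacian_kern d x : (2 < n)%N -> 0 < d ->
  \sum_(i < n) partial i (partial i (kern d)) x = - lapkern d x.
Proof.
move=> n2 d0; set m : R := (n - 2)%:R.
have e i : partial i (kern d) = (fun x => (- m * x 0 i) * rad d x ^+ n).
  rewrite /kern partial_radX//; apply/funext => y.
  by rewrite (_ : (n - 2).+2 = n) ?mulNr// -addn2 subnK// ltnW.
have sm i : smooth (fun x : Rn => - m * x 0 i) by apply: smoothM; [exact: smooth_cst|exact: smooth_coord].
transitivity (\sum_(i < n) (m * n%:R * rad d x ^+ n.+2 * (x 0 i * x 0 i) - m * rad d x ^+ n)).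
  apply: eq_bigr => i _; rewrite e partialM; [|exact: smooth_diff|exact/smooth_diff/smooth_radX].
  rewrite partial_radX// partialM; [|exact/smooth_diff/smooth_cst|exact/smooth_diff/smooth_coord].
  by rewrite partial_coord partial_cst eqxx /=; ring.
rewrite big_split/= -mulr_sumr sumr_const card_ord -/(dotv x x).
have h := rad_sqr x d0.
have rn : rad d x ^+ n = rad d x ^+ n.+2 * (dotv x x + d ^+ 2).
  by rewrite -addn2 exprD -mulrA h mulr1.
by rewrite rn -mulr_natr /lapkern -/m; ring.
Qed.

Definition grad2 w x : R := \sum_(i < n) partial i w x ^+ 2.

Lemma lint_grad2 U w : Ccinf U w -> lint (grad2 w).
Proof.
move=> hw; apply: lint_sum => i; have hp := Ccinf_partial i hw.
by apply: Ccinf_lint (Ccinf_mulr hp (Ccinf_smooth hp)).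
Qed.

Lemma grad2_ge0 w x : 0 <= grad2 w x.
Proof. by apply: sumr_ge0 => i _; exact: sqr_ge0. Qed.

(* Integrate the divergence of [w^2 (2M - N) grad N], where [N] is the potential of [f]. *)
Lemma potential_trace f w d r M : (2 < n)%N -> 0 < d -> 0 < M -> lint f -> bsupp r f ->
  (forall x, 0 <= f x) -> Ccinf setT w -> (forall x, conv f (kern d) x <= M) ->
  intg (fun x => w x ^+ 2 * conv f (lapkern d) x) <= 4 * M * intg (grad2 w).
Proof.
move=> n2 d0 M0 lf f0 fge hw NM; set N := conv f (kern d).
have sw := Ccinf_smooth hw.
have sk := smooth_kern d0.
have sN : smooth N := conv_smooth lf f0 sk.
have sP : smooth (conv f (lapkern d)) := conv_smooth lf f0 (smooth_lapkern d0).
have lapN x : \sum_(i < n) partial i (partial i N) x = - conv f (lapkern d) x.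
  transitivity (\sum_(i < n) conv f (partial i (partial i (kern d))) x).
    apply: eq_bigr => i _; rewrite /N (partial_conv i lf f0 sk).
    by rewrite (partial_conv i lf f0 (smooth_partial i sk)).
  rewrite /conv -intg_sum; last first.
    move=> i; apply: lint_conv lf f0 _.
    exact/smooth_continuous/smooth_partial/smooth_partial.
  rewrite -intgN; last by apply: lint_conv lf f0 _; exact/smooth_continuous/smooth_lapkern.
  by apply: eq_intg => y; rewrite -mulr_sumr laplacian_kern// mulrN.
have N0 x : 0 <= N x by apply: intg_ge0 => y; apply: mulr_ge0 => //; exact: kern_ge0.
have P0 x : 0 <= conv f (lapkern d) x.
  by apply: intg_ge0 => y; apply: mulr_ge0 => //; exact: lapkern_ge0.
(* The weight [2M - N] lies between [M] and [2M], and its gradient contributes [- w^2 |grad N|^2],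
   which absorbs the mixed term in [grad w] and [grad N]. Writing [w] twice exhibits the field as a
   test function times a smooth one. *)
pose Z i x := w x * (w x * ((2 * M - N x) * partial i N x)).
have s1 : smooth (fun x => 2 * M - N x) by apply: smoothB => //; exact: smooth_cst.
have s2 i : smooth (fun x => (2 * M - N x) * partial i N x).
  by apply: smoothM => //; exact: smooth_partial.
have s3 i : smooth (fun x => w x * ((2 * M - N x) * partial i N x)) by exact: smoothM.
have hZ i : Ccinf setT (Z i) := Ccinf_mulr hw (s3 i).
have pZ i x : partial i (Z i) x = 2 * w x * partial i w x * (2 * M - N x) * partial i N x
    - w x ^+ 2 * partial i N x ^+ 2 + w x ^+ 2 * (2 * M - N x) * partial i (partial i N) x.
  have D := @smooth_diff R n.
  rewrite /Z partialM; [|exact: D..].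
  rewrite partialM; [|exact: D..].
  rewrite partialM; [|exact: D|exact/D/smooth_partial].
  rewrite (partialD i (D _ (smooth_cst (2 * M))) (D _ (smoothN sN))).
  by rewrite partial_cst partialN; [ring|exact: D].
have lG : lint (grad2 w) := lint_grad2 hw.
have lP : lint (fun x => w x ^+ 2 * conv f (lapkern d) x).
  by apply: Ccinf_lint (Ccinf_mulr (Ccinf_mulr hw sw) sP).
have : intg (fun x => \sum_(i < n) partial i (Z i) x) <=
       intg (fun x => 4 * M ^+ 2 * grad2 w x - M * (w x ^+ 2 * conv f (lapkern d) x)).
  apply: le_intg.
  - by apply: lint_sum => i; exact: Ccinf_lint (Ccinf_partial i (hZ i)).
  - by apply: lintB; exact: lintZ.
  apply: laeW => x; under eq_bigr do rewrite pZ.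
  rewrite big_split/= -mulr_sumr lapN.
  have hN := NM x; rewrite -/N in hN.
  (* The difference of the two sides is a sum of squares [((2M - N) partial_i w - w partial_i N)^2].
     Afterwards [0 <= N <= M] gives [(2M - N)^2 <= 4 M^2] and [2M - N >= M]. *)
  apply: (@le_trans _ _ ((2 * M - N x) ^+ 2 * grad2 w x - w x ^+ 2 * (2 * M - N x) * conv f (lapkern d) x)).
    rewrite mulrN lerD2r /grad2 mulr_sumr; apply: ler_sum => i _.
    rewrite -subr_ge0; set a := partial i w x; set b := partial i N x; set c := 2 * M - N x.
    by rewrite (_ : _ - _ = (c * a - w x * b) ^+ 2) ?sqr_ge0//; ring.
  apply: lerB.
    apply: ler_wpM2r; first exact: grad2_ge0.
    have := N0 x; nra.
  rewrite -subr_ge0; set P := conv f _ x.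
  rewrite (_ : _ - _ = w x ^+ 2 * (P * (M - N x))); last by ring.
  apply: mulr_ge0; first exact: sqr_ge0.
  by apply: mulr_ge0; [exact: P0|rewrite subr_ge0].
rewrite intg_sum; last by move=> i; exact: Ccinf_lint (Ccinf_partial i (hZ i)).
rewrite big1; last by move=> i _; exact: intg_partial.
rewrite intgB; [|exact: lintZ..].
rewrite (intgZ (4 * M ^+ 2) lG) (intgZ M lP) subr_ge0.
by rewrite (_ : 4 * M ^+ 2 * _ = M * (4 * M * intg (grad2 w))) ?ler_pM2l//; ring.
Qed.

End NewtonKernel.

(** * The trace inequality for bounded Newtonian potentials *)

Section NewtonTrace.
Context {R : realType} {n : nat}.
Local Notation Rn := 'rV[R]_n.
Local Notation T := (lebRn R n).
Implicit Types (f h u w phi psi : Rn -> R) (x y z : Rn) (d M r : R).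

Lemma rad_le d x : 0 < d -> rad d x <= d^-1.
Proof.
move=> d0; rewrite /rad lef_pV2 ?posrE// ?sqrtr_gt0 ?rad_den//.
by rewrite -[leLHS](ger0_norm (ltW d0)) -sqrtr_sqr ler_wsqrtr// lerDr dotv_ge0.
Qed.

Lemma rad_ge d x : 0 < d -> cube 0 d x -> (Num.sqrt n.+1%:R * d)^-1 <= rad d x.
Proof.
rewrite /cube/= subr0 => d0 xd; have n0 : (0 : R) < n.+1%:R by rewrite ltr0n.
rewrite /rad lef_pV2 ?posrE// ?sqrtr_gt0 ?rad_den ?mulr_gt0 ?sqrtr_gt0//.
rewrite -[X in _ * X](ger0_norm (ltW d0)) -sqrtr_sqr -sqrtrM ?ler0n// ler_wsqrtr//.
apply: le_trans (_ : n%:R * `|x| ^+ 2 + d ^+ 2 <= _); first by rewrite lerD2r dotv_le.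
rewrite -natr1 mulrDl mul1r lerD2r ler_wpM2l ?ler0n// lerXn2r ?nnegrE//; exact: ltW.
Qed.

Lemma lapkern_bounded d x : 0 < d ->
  `|lapkern d x| <= n%:R * (n - 2)%:R * d ^+ 2 * d^-1 ^+ n.+2.
Proof.
move=> d0; rewrite ger0_norm ?lapkern_ge0// /lapkern ler_wpM2l//.
  by apply: mulr_ge0; [exact: mulr_ge0|exact: sqr_ge0].
by apply: lerXn2r (rad_le x d0); rewrite nnegrE; [exact/ltW/rad_gt0|rewrite invr_ge0 ltW].
Qed.

Lemma lapkern_even d x y : lapkern d (x - y) = lapkern d (y - x).
Proof.
rewrite /lapkern /rad -opprB; congr (_ * (Num.sqrt (_ + _))^-1 ^+ _).
by apply: eq_bigr => i _; rewrite !mxE mulrNN.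
Qed.

(** The volume [(2d)^n] of the cube of radius [d], times the lower bound
    [n (n-2) d^2 (sqrt(n+1) d)^-(n+2)] for [lapkern d] on it; the powers of [d] cancel. *)
Definition lapmass : R := n%:R * (n - 2)%:R * (Num.sqrt n.+1%:R)^-1 ^+ n.+2 * 2 ^+ n.

Lemma lapmass_gt0 : (2 < n)%N -> 0 < lapmass.
Proof.
move=> n2; apply: mulr_gt0; last by rewrite exprn_gt0.
apply: mulr_gt0; last by rewrite exprn_gt0// invr_gt0 sqrtr_gt0 ltr0n.
by rewrite mulr_gt0 ?ltr0n ?subn_gt0// (ltn_trans _ n2).
Qed.

Lemma lint_sqr_lapkern w d y : 0 < d -> Ccinf setT w ->
  lint (fun x => w x ^+ 2 * lapkern d (x - y)).
Proof.
move=> d0 hw; have sw := Ccinf_smooth hw.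
under eq_fun do rewrite lapkern_even.
by apply: Ccinf_lint (Ccinf_mulr (Ccinf_mulr hw sw) (smooth_reflect y (smooth_lapkern d0))).
Qed.

(* The mass of [lapkern d] on the cube of radius [d] is bounded below independently of [d]. *)
Lemma lapkern_lower w (L d : R) y : (2 < n)%N -> 0 < d -> 0 <= L -> Ccinf setT w ->
  (forall x, `|w x ^+ 2 - w y ^+ 2| <= L * `|x - y|) ->
  lapmass * (w y ^+ 2 - L * d) <= intg (fun x => w x ^+ 2 * lapkern d (x - y)).
Proof.
move=> n2 d0 L0 hw hL.
have J0 : 0 <= intg (fun x => w x ^+ 2 * lapkern d (x - y)).
  by apply: intg_ge0 => x; apply: mulr_ge0; [exact: sqr_ge0|exact: lapkern_ge0].
have [h|h] := ltP (w y ^+ 2 - L * d) 0.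
  by apply: le_trans J0; rewrite mulr_ge0_le0// ltW// lapmass_gt0.
pose p0 : R := n%:R * (n - 2)%:R * d ^+ 2 * (Num.sqrt n.+1%:R * d)^-1 ^+ n.+2.
have s0 : 0 < Num.sqrt (n.+1%:R : R) by rewrite sqrtr_gt0 ltr0n.
have p00 : 0 <= p0.
  apply: mulr_ge0; last by rewrite exprn_ge0// invr_ge0 mulr_ge0// ltW.
  by apply: mulr_ge0; [exact: mulr_ge0|exact: sqr_ge0].
have ep : lapmass = p0 * (2 * d) ^+ n.
  have -> : p0 = n%:R * (n - 2)%:R * d ^+ 2 *
      ((Num.sqrt n.+1%:R)^-1 ^+ n.+2 * (d ^+ n * d ^+ 2)^-1).
    by rewrite /p0 invfM exprMn -exprD addn2 [d^-1 ^+ _]exprVn.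
  rewrite /lapmass [(2 * d) ^+ n]exprMn.
  have : d ^+ n != 0 by rewrite expf_neq0// gt_eqF.
  set D := d ^+ n; set a := _ ^-1 ^+ n.+2; set b := 2 ^+ n; move=> D0.
  by field; rewrite D0 gt_eqF.
have mC := @cube_measurable R n y d.
have lC : lint (\1_(cube y d)) by apply: lint_indic => //; exact: leb_cube_lty.
have cC : (2 * d) ^+ n <= intg (\1_(cube y d)).
  rewrite intg_indic// -lee_fin fineK; first exact/leb_cube_ge/ltW.
  by rewrite ge0_fin_numE ?leb_cube_lty.
have : intg (fun x => (p0 * (w y ^+ 2 - L * d)) * \1_(cube y d) x) <=
       intg (fun x => w x ^+ 2 * lapkern d (x - y)).
  apply: le_intg; [exact: lintZ|exact: lint_sqr_lapkern|apply: laeW => x].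
  rewrite indicE; have [xC|xC] := boolP (x \in _); last first.
    by rewrite mulr0; apply: mulr_ge0; [exact: sqr_ge0|exact: lapkern_ge0].
  rewrite inE in xC; rewrite mulr1 mulrC; apply: ler_pM => //.
    have := hL x; rewrite ler_norml => /andP[+ _].
    have : L * `|x - y| <= L * d by rewrite ler_wpM2l.
    lra.
  rewrite /p0 /lapkern ler_wpM2l//.
    by apply: mulr_ge0; [exact: mulr_ge0|exact: sqr_ge0].
  rewrite lerXn2r ?nnegrE ?invr_ge0 ?mulr_ge0 ?(ltW d0) ?(ltW s0) ?(ltW (rad_gt0 _ _))//.
  by apply: rad_ge => //; rewrite /cube/= subr0.
apply: le_trans; rewrite (intgZ _ lC) ep -mulrA [X in _ * X]mulrC mulrA ler_wpM2l//.
exact: mulr_ge0.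
Qed.

Lemma tonelli_lapkern f w d r : 0 < d -> lint f -> bsupp r f -> (forall x, 0 <= f x) ->
  Ccinf setT w ->
  lint (fun y => f y * intg (fun x => w x ^+ 2 * lapkern d (x - y))) /\
  intg (fun x => w x ^+ 2 * conv f (lapkern d) x) =
  intg (fun y => f y * intg (fun x => w x ^+ 2 * lapkern d (x - y))).
Proof.
move=> d0 lf f0 fge hw; have sw := Ccinf_smooth hw.
have hw2 : Ccinf setT (fun x => w x * w x) := Ccinf_mulr hw sw.
have lw2 : lint (fun x => w x ^+ 2) by exact: Ccinf_lint hw2.
pose J y := intg (fun x => w x ^+ 2 * lapkern d (x - y)).
have eJ y : intg (fun x => f y * (w x ^+ 2 * lapkern d (x - y))) = f y * J y.
  by rewrite (intgZ (f y) (lint_sqr_lapkern y d0 hw)).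
pose B := n%:R * (n - 2)%:R * d ^+ 2 * d^-1 ^+ n.+2 : R.
have Jb y : `|J y| <= B * intg (fun x => w x ^+ 2).
  rewrite ger0_norm; last first.
    by apply: intg_ge0 => x; apply: mulr_ge0; [exact: sqr_ge0|exact: lapkern_ge0].
  rewrite -(intgZ B lw2); apply: le_intg; [exact: lint_sqr_lapkern|exact: lintZ|].
  apply: laeW => x; rewrite mulrC ler_wpM2r ?sqr_ge0//.
  exact: le_trans (ler_norm _) (lapkern_bounded _ d0).
have mJ : lmeas J.
  have [r' hr'] := Ccinf_bsupp hw.
  have -> : J = conv (fun x => w x ^+ 2) (lapkern d).
    by apply/funext => y; apply: eq_intg => x; rewrite lapkern_even.
  apply/lmeas_cont/smooth_continuous; apply: (conv_smooth lw2 (r := r')).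
    by move=> x /hr'->; rewrite expr0n.
  exact: smooth_lapkern.
have lJ : lint (fun y => f y * J y).
  by under eq_fun do rewrite mulrC; exact: lintM_bounded mJ Jb lf.
pose F x y := f y * (w x ^+ 2 * lapkern d (x - y)).
have [_ e] : lint (fun x => intg (F x)) /\
    intg (fun x => intg (F x)) = intg (fun y => intg (F^~ y)).
  apply: lint_tonelli.
  - have mw := lmeasX 2 (lint_meas (Ccinf_lint hw)).
    apply: measurable_funM; first exact: measurable_snd_comp (lint_meas lf).
    apply: measurable_funM; first exact: measurable_fst_comp mw.
    exact: (measurable_sub_comp (smooth_continuous (smooth_lapkern d0))).
  - move=> x y; apply: mulr_ge0 => //; apply: mulr_ge0; first exact: sqr_ge0.
    exact: lapkern_ge0.
  - by move=> y; apply: lintZ; exact: lint_sqr_lapkern.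
  - by under eq_fun do rewrite eJ.
  - move=> x; rewrite /F; under eq_fun do rewrite mulrCA.
    by apply: lintZ; apply: lint_conv lf f0 _; exact/smooth_continuous/smooth_lapkern.
split; first exact: lJ.
transitivity (intg (fun x => intg (F x))).
  apply: eq_intg => x; rewrite /conv -intgZ.
    by apply: eq_intg => y; rewrite /F mulrCA.
  by apply: lint_conv lf f0 _; exact/smooth_continuous/smooth_lapkern.
by rewrite e; apply: eq_intg => y; rewrite /F eJ.
Qed.

Lemma Ccinf_lipschitz phi : Ccinf setT phi ->
  exists2 L : R, 0 <= L & forall x y, `|phi x - phi y| <= L * `|x - y|.
Proof.
move=> hp; have H i : exists M : R, 0 <= M /\ forall x, `|partial i phi x| <= M.
  by have [M M0 hM] := Ccinf_bounded (Ccinf_partial i hp); exists M.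
have /choice[M hM] := H; exists (n%:R * \sum_i M i).
  by rewrite mulr_ge0// sumr_ge0// => i _; have [] := hM i.
move=> x y; rewrite -{1}[x](subrK y) [X in phi X - _]addrC.
apply: smooth_lipschitz; first exact/smooth_diff/(Ccinf_smooth hp).
move=> t _ i; rewrite (le_trans ((hM i).2 _))// (bigD1 i)//= lerDl sumr_ge0// => j _.
by have [] := hM j.
Qed.

(** Tonelli's theorem moves [lapkern d] in [potential_trace] from [f] onto [w^2], and
    [lapkern_lower] replaces the result by [lapmass * w^2]. The error is proportional to [L d], with
    [L] a Lipschitz constant of [w^2], and disappears as [d] tends to 0; hence the constant does not
    depend on [f] or [w]. *)
Theorem newton_trace : (2 < n)%N -> exists2 C : R, 0 < C &
  forall f r M w, lint f -> bsupp r f -> (forall x, 0 <= f x) -> 0 < M -> Ccinf setT w ->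
  (forall d x, 0 < d -> conv f (kern d) x <= M) ->
  intg (fun x => f x * w x ^+ 2) <= C * M * intg (grad2 w).
Proof.
move=> n2; have c0 := lapmass_gt0 n2.
exists (4 / lapmass) => [|f r M w lf f0 fge M0 hw hM]; first by rewrite divr_gt0.
have sw := Ccinf_smooth hw.
have hw2 : Ccinf setT (fun x => w x * w x) := Ccinf_mulr hw sw.
have [L L0 hL] := Ccinf_lipschitz hw2.
have lfw : lint (fun x => f x * w x ^+ 2).
  under eq_fun do rewrite mulrC.
  have [B _ hB] := Ccinf_bounded hw2.
  exact: lintM_bounded (lmeas_cont (Ccinf_cont hw2)) hB lf.
have key d : 0 < d ->
    intg (fun x => f x * w x ^+ 2) <= 4 / lapmass * M * intg (grad2 w) + L * intg f * d.
  move=> d0; have [lJ eJ] := tonelli_lapkern d0 lf f0 fge hw.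
  have : intg (fun y => lapmass * (f y * w y ^+ 2) - lapmass * L * d * f y) <= 4 * M * intg (grad2 w).
    apply: le_trans (potential_trace n2 d0 M0 lf f0 fge hw (hM d ^~ d0)).
    rewrite eJ; apply: le_intg; [by apply: lintB; exact: lintZ|exact: lJ|].
    apply: laeW => y; rewrite (_ : _ - _ = f y * (lapmass * (w y ^+ 2 - L * d))); last by ring.
    have hl : lapmass * (w y ^+ 2 - L * d) <= intg (fun x => w x ^+ 2 * lapkern d (x - y)).
      by apply: (lapkern_lower n2 d0 L0 hw) => x; rewrite !expr2; exact: hL.
    exact: ler_wpM2l (fge y) _ _ hl.
  rewrite intgB; [|exact: lintZ..].
  rewrite (intgZ lapmass lfw) (intgZ (lapmass * L * d) lf) lerBlDr.
  move: (intg _) (intg (grad2 w)) (intg f) => X G I h.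
  have -> : 4 / lapmass * M * G + L * I * d = lapmass^-1 * (4 * M * G + lapmass * L * d * I).
    by field; rewrite gt_eqF.
  by rewrite ler_pdivlMl.
apply/ler_addgt0Pr => e e0.
have : 0 <= L * intg f by apply: mulr_ge0 => //; exact: intg_ge0.
move: key; move: (intg _) (intg (grad2 w)) (intg f) => X G I key I0.
apply: (le_trans (key (e / (L * I + 1)) _)); first by rewrite divr_gt0// ltr_wpDl.
rewrite lerD2l mulrA ler_pdivrMr ?ltr_wpDl//; nra.
Qed.

End NewtonTrace.

(** * Weak Lorentz bounds and capacity *)

Section WeakTrace.
Context {R : realType} {n : nat}.
Local Notation Rn := 'rV[R]_n.
Local Notation T := (lebRn R n).
Implicit Types (f h u w phi psi beta V : Rn -> R) (x y z : Rn) (d M r W : R) (E S : set Rn).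

Lemma measurable_lmeas_gt f (t : R) : lmeas f -> measurable ([set x | t < f x] : set T).
Proof.
move=> mf; rewrite -[X in measurable X]setTI.
have -> : [set: T] `&` [set x | t < f x] = [set: T] `&` f @^-1` `]t, +oo[%classic.
  by apply/seteqP; split => x [_ /= h]; split => //=; move: h; rewrite in_itv/= andbT.
exact: mf.
Qed.

Lemma intg_indic_le S (a : R) : measurable (S : set T) -> (leb (S : set T) <= a%:E)%E ->
  intg \1_S <= a.
Proof.
move=> mS h; rewrite intg_indic// -lee_fin fineK//.
rewrite ge0_fin_numE ?outer_measure_ge0//; exact: le_lt_trans h (ltry _).
Qed.

(** A discrete layer-cake bound: either [g <= t 0], or some [j < m] has [t j < g <= t j.+1], and
    then the term of index [j] alone is large enough. *)
Lemma dyadic_le (t : nat -> R) (g : R) m : (forall j, 0 <= t j) -> g <= t m ->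
  g <= t 0%N + \sum_(j < m) t j.+1 * (t j < g)%R%:R.
Proof.
move=> t0; elim: m => [|m ih] gm; first by rewrite big_ord0 addr0.
rewrite big_ord_recr/=; have [h|h] := leP g (t m).
  by rewrite mulr0 addr0; exact: ih.
by rewrite mulr1 (le_trans gm)// addrA lerDr addr_ge0// sumr_ge0// => j _; rewrite mulr_ge0.
Qed.

Lemma geometric_sum (D : R) m : 0 <= D -> \sum_(j < m) D / 2 ^+ j <= 2 * D.
Proof.
move=> D0; have -> : \sum_(j < m) D / 2 ^+ j = 2 * D - 2 * D / 2 ^+ m.
  elim: m => [|m ih]; first by rewrite big_ord0 expr0 divr1 subrr.
  rewrite big_ord_recr/= ih exprS.
  have : (2 : R) ^+ m != 0 by rewrite expf_neq0.
  by set a := 2 ^+ m => a0; field.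
by rewrite gerBl divr_ge0// ?exprn_ge0// mulr_ge0.
Qed.

Lemma dyadic_intg (g : Rn -> R) E (D : R) (t : nat -> R) :
  measurable (E : set T) -> (leb (E : set T) < +oo)%E -> lmeas g -> (forall x, 0 <= g x) ->
  (forall j, 0 <= t j) -> (forall a, \forall j \near \oo, a <= t j) ->
  (forall j, t j.+1 * intg \1_(E `&` [set x | t j < g x]) <= D / 2 ^+ j) ->
  lint (fun x => g x * \1_E x) /\ intg (fun x => g x * \1_E x) <= t 0%N * intg \1_E + 2 * D.
Proof.
move=> mE fE mg g0 t0 too hD.
have mS j : measurable (E `&` [set x | t j < g x] : set T).
  by apply: measurableI => //; exact: measurable_lmeas_gt.
have lS j : lint (\1_(E `&` [set x | t j < g x])).
  by apply: lint_indic => //; apply: le_lt_trans fE; apply: le_lebesgue_outer => x [].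
have lE : lint (\1_E) by exact: lint_indic.
(* Cutting [g] off where it exceeds [t m] makes the finite sum of [dyadic_le] applicable; Fatou's
   lemma removes the cut. *)
pose F m x := g x * \1_(E `&` ~` [set x | t m < g x]) x.
pose B m x := t 0%N * \1_E x + \sum_(j < m) t j.+1 * \1_(E `&` [set x | t j < g x]) x.
have lB m : lint (B m).
  by apply: lintD; [exact: lintZ|apply: lint_sum => j; exact: lintZ].
have mC m : measurable (E `&` ~` [set x | t m < g x] : set T).
  by apply: measurableI => //; apply: measurableC; exact: measurable_lmeas_gt.
have mF m : lmeas (F m) by apply: lmeasM => //; exact: lmeas_indic.
have F0 m x : 0 <= F m x by rewrite mulr_ge0.
have B0 m x : 0 <= B m x.
  by apply: addr_ge0; [rewrite mulr_ge0|apply: sumr_ge0 => j _; rewrite mulr_ge0].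
have FB m x : F m x <= B m x.
  rewrite /F indicE; have [|_] := boolP (x \in _); last by rewrite mulr0.
  rewrite inE => -[Ex /negP]; rewrite -leNgt => gm; rewrite mulr1.
  apply: le_trans (dyadic_le t0 gm) _; rewrite /B indicE mem_set// mulr1 lerD2l.
  apply: ler_sum => j _; rewrite ler_wpM2l// indicE.
  have [h|//] := boolP (t j < g x).
  by rewrite mem_set.
have lF m : lint (F m).
  by apply: (lint_dom (mF m) (lB m)); apply: laeW => x; rewrite ger0_norm.
have D0 : 0 <= D.
  have := hD 0%N; rewrite expr0 divr1; apply: le_trans; apply: mulr_ge0 => //.
  exact: intg_ge0.
apply: (intg_fatou (F := F)) => //.
- by apply: lmeasM => //; exact: lmeas_indic.
- move=> m; apply: (@le_trans _ _ (intg (B m))).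
    by apply: le_intg => //; exact: laeW.
  rewrite /B intgD; [|exact: lintZ|by apply: lint_sum => j; exact: lintZ].
  rewrite (intgZ _ lE) lerD2l intg_sum; last by move=> j; exact: lintZ.
  apply: le_trans (geometric_sum m D0); apply: ler_sum => j _.
  by rewrite (intgZ _ (lS j)).
- apply: laeW => x; apply: cvg_near_cst.
  have := too (g x); apply: filterS => m gm; rewrite /F !indicE.
  congr (_ * (_ : bool)%:R); have [xE|xE] := boolP (x \in E).
    rewrite inE in xE; rewrite mem_set//; split => //=.
    by apply/negP; rewrite -leNgt.
  by apply: memNset => -[Ex _]; move: xE; rewrite mem_set.
Qed.

Lemma exprn_split (a : R) : (2 < n)%N -> a ^+ n = a ^+ (n - 2) * a ^+ 2.
Proof. by move=> n2; rewrite -exprD subnK// ltnW. Qed.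

Lemma expr_dvg (a c : R) : 0 < c -> \forall j \near \oo, a <= c * 2 ^+ j.
Proof.
move=> c0; near=> j; rewrite mulrC -ler_pdivrMr//.
apply: (@le_trans _ _ j%:R); first by near: j; exact: nbhs_infty_ger.
by rewrite -natrX ler_nat ltnW// ltn_expl.
Unshelve. all: by end_near. Qed.

(** The superlevel sets of the kernel lie in small cubes around [x], so the singularity contributes
    only a multiple of [r^2]. When [r^n] is the measure of [E], the whole bound is a multiple of
    [r^2]. *)
Lemma kern_indic_le E d r x : (2 < n)%N -> measurable (E : set T) ->
  (leb (E : set T) < +oo)%E -> 0 < r -> 0 < d ->
  conv \1_E (kern d) x <=
    r^-1 ^+ (n - 2) * intg \1_E + 2 * (8 ^+ (n - 2) * 16 * r ^+ 2).
Proof.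
(* The level [t j] is reached only in the cube of radius [r / 2^j], of measure at most
   [(4r / 2^j)^n]. Multiplied by [t j.+1] this is [8^(n-2) * 16 r^2 / 4^j], and [4^-j <= 2^-j]. *)
move=> n2 mE fE r0 d0; set D := 8 ^+ _ * 16 * _.
pose t j : R := (2 ^+ j / r) ^+ (n - 2).
have p0 j : (0 : R) < 2 ^+ j by rewrite exprn_gt0.
have pr0 j : 0 < 2 ^+ j / r by rewrite divr_gt0.
have t0 j : 0 <= t j by rewrite exprn_ge0// ltW.
pose g y := kern d (x - y).
have mg : lmeas g by exact/lmeas_cont/smooth_continuous/smooth_reflect/smooth_kern.
have [] := @dyadic_intg g E D t mE fE mg.
- by move=> y; exact: kern_ge0.
- by [].
- move=> a; have := expr_dvg (Num.max a 1) (divr_gt0 ltr01 r0).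
  apply: filterS => j; rewrite ge_max => /andP[h1 h2].
  have e : 2 ^+ j / r = 1 / r * 2 ^+ j by rewrite mulrC div1r.
  rewrite /t e (le_trans h1)// -{1}[_ * _]expr1 ler_weXn2l// subn_gt0//.
- move=> j; have sub : E `&` [set y | t j < g y] `<=` cube x (r / 2 ^+ j).
    move=> y [_ /= h]; rewrite /cube/= distrC leNgt; apply/negP => xy.
    have rj : 0 <= r / 2 ^+ j by rewrite divr_ge0// ltW.
    move: h; apply/negP; rewrite -leNgt /g /kern /t.
    apply: lerXn2r; rewrite ?nnegrE; [exact/ltW/rad_gt0|exact/ltW/pr0|].
    rewrite /rad -[2 ^+ j / r]invrK lef_pV2 ?posrE ?sqrtr_gt0 ?rad_den ?invr_gt0//.
    rewrite invf_div -[leLHS](ger0_norm rj) -sqrtr_sqr ler_wsqrtr//.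
    by rewrite (le_trans (ltW (dotv_gt rj xy)))// lerDl sqr_ge0.
  have r2 : r / 2 ^+ j < 2 * (r / 2 ^+ j) by rewrite ltr_pMl ?divr_gt0// ltr1n.
  have h : intg (\1_(E `&` [set y | t j < g y])) <= (2 * (2 * (r / 2 ^+ j))) ^+ n.
    apply: intg_indic_le.
      by apply: measurableI => //; exact: measurable_lmeas_gt.
    apply: (@le_trans _ _ (leb (cube x (r / 2 ^+ j) : set T))); first exact: le_lebesgue_outer.
    by apply: leb_cube_le => //; rewrite divr_ge0// ltW.
  apply: le_trans (ler_wpM2l (t0 _) h) _.
  rewrite exprn_split// /t [2 ^+ j.+1]exprS [leLHS]mulrA -exprMn.
  have p1 : 1 <= (2 : R) ^+ j by rewrite exprn_ege1// ler1n.
  move: p1 (p0 j); set p : R := 2 ^+ j => p1 pp.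
  rewrite (_ : 2 * p / r * (2 * (2 * (r / p))) = 8); last by field; rewrite !gt_eqF.
  rewrite /D -!mulrA ler_wpM2l ?exprn_ge0//.
  rewrite (_ : (2 * (2 * (r / p))) ^+ 2 = (16 * (r ^+ 2 / p)) * p^-1); last by field; rewrite gt_eqF.
  rewrite [r * (r / p)]mulrA -expr2 -[leRHS]mulr1; apply: ler_wpM2l; last by rewrite invf_le1.
  by rewrite mulr_ge0// divr_ge0 ?sqr_ge0// ltW.
move=> _; rewrite (_ : t 0%N = r^-1 ^+ (n - 2)); last by rewrite /t expr0 div1r.
by apply: le_trans; rewrite le_eqVlt; apply/orP; left; apply/eqP/eq_intg => y; rewrite mulrC.
Qed.

Definition weak_bound beta W :=
  forall t : R, 0 < t -> (leb ([set x | (t < beta x)%R] : set T) <= ((W / t) ^+ n)%:E)%E.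

Lemma weak_sqr beta W E (s : R) : (2 < n)%N -> lmeas beta -> (forall x, 0 <= beta x) ->
  0 <= W -> weak_bound beta W -> measurable (E : set T) -> (leb (E : set T) < +oo)%E -> 0 < s ->
  lint (fun x => beta x ^+ 2 * \1_E x) /\
  intg (fun x => beta x ^+ 2 * \1_E x) <= s ^+ 2 * intg \1_E + 2 * (4 * W ^+ n * s^-1 ^+ (n - 2)).
Proof.
(* The level [t j.+1 = 4 (s 2^j)^2] times the measure bound [(W / (s 2^j))^n] is
   [4 W^n s^-(n-2) 2^(-j (n-2))], which decays geometrically because [n - 2 >= 1]. *)
move=> n2 mb b0 W0 hW mE fE s0; set D := 4 * _ * _.
pose t j : R := (s * 2 ^+ j) ^+ 2.
have p0 j : (0 : R) < 2 ^+ j by rewrite exprn_gt0.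
have sp j : 0 < s * 2 ^+ j by rewrite mulr_gt0.
have t0 j : 0 <= t j by exact: sqr_ge0.
rewrite (_ : s ^+ 2 = t 0%N); last by rewrite /t expr0 mulr1.
apply: dyadic_intg => //.
- exact: lmeasX.
- by move=> x; exact: sqr_ge0.
- move=> a; have := expr_dvg (Num.max a 1) s0.
  apply: filterS => j; rewrite ge_max => /andP[h1 h2].
  by rewrite /t (le_trans h1)// -{1}[_ * _]expr1 ler_weXn2l.
- move=> j; have e : [set x | t j < beta x ^+ 2] = [set x | s * 2 ^+ j < beta x].
    by apply/seteqP; split => x /=; rewrite /t ltr_pXn2r// nnegrE// ltW.
  have h : intg (\1_(E `&` [set x | t j < beta x ^+ 2])) <= (W / (s * 2 ^+ j)) ^+ n.
    apply: intg_indic_le.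
      by apply: measurableI => //; apply: measurable_lmeas_gt; exact: lmeasX.
    apply: le_trans (hW _ (sp j)); apply: le_lebesgue_outer => x [_]; by rewrite e.
  apply: le_trans (ler_wpM2l (t0 _) h) _.
  rewrite expr_div_n [(s * _) ^+ n]exprn_split// /t [2 ^+ j.+1]exprS.
  have p1 : 1 <= (2 : R) ^+ j by rewrite exprn_ege1// ler1n.
  move: p1 (p0 j); set p : R := 2 ^+ j => p1 pp.
  rewrite [(s * p) ^+ (n - 2)]exprMn /D exprVn.
  have m0 : (0 < n - 2)%N by rewrite subn_gt0.
  have a0 : 0 < s ^+ (n - 2) by rewrite exprn_gt0.
  have c0 : 0 < p ^+ (n - 2) by rewrite exprn_gt0.
  have pc : p <= p ^+ (n - 2) by rewrite -{1}[p]expr1 ler_weXn2l.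
  have Wn : 0 <= W ^+ n by rewrite exprn_ge0.
  move: a0 c0 pc Wn; set a := s ^+ _; set c := p ^+ _; set q := W ^+ n => a0 c0 pc q0.
  rewrite (_ : _ * (q / _) = 4 * q / a * c^-1); last by field; rewrite !gt_eqF.
  by rewrite ler_wpM2l ?lef_pV2// divr_ge0 ?mulr_ge0// ltW.
Qed.

Lemma nth_root_ex (a : R) : (0 < n)%N -> 0 < a -> exists2 r : R, 0 < r & r ^+ n = a.
Proof.
move=> n0 a0; exists (a `^ n%:R^-1); first exact: powR_gt0.
by rewrite -powR_mulrn ?powR_ge0// -powRrM mulVf ?pnatr_eq0 -?lt0n// powRr1// ltW.
Qed.

(* Testing the Newtonian trace inequality with [f = \1_E] bounds [|E|^(1 - 2/n)] by the energy. *)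
Lemma weak_trace_set beta W : (2 < n)%N -> lmeas beta -> (forall x, 0 <= beta x) ->
  0 <= W -> weak_bound beta W ->
  exists2 C : R, 0 < C & forall E w r, measurable (E : set T) -> E `<=` cube 0 r ->
    Ccinf setT w -> (forall x, E x -> 1 <= 4 * w x ^+ 2) ->
    intg (fun x => beta x ^+ 2 * \1_E x) <= C * intg (grad2 w).
Proof.
move=> n2 mb b0 W0 hW; have [C0 C00 nt] := @newton_trace R n n2.
(* This is the constant of [kern_indic_le] for the radius [rho] with [rho^n = |E|]: the potential of
   [\1_E] is at most [c1 * rho^2]. *)
pose c1 : R := 1 + 2 * (8 ^+ (n - 2) * 16).
have c10 : 0 < c1 by rewrite ltr_wpDr// mulr_ge0// mulr_ge0// exprn_ge0.
have Wn : 0 <= W ^+ n by rewrite exprn_ge0.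
exists ((1 + 8 * W ^+ n) * (4 * C0 * c1)).
  by rewrite mulr_gt0 ?mulr_gt0// ltr_wpDr// mulr_ge0.
move=> E w r mE Er hw hE.
have fE : (leb (E : set T) < +oo)%E.
  by apply: le_lt_trans (leb_cube_lty 0 r); exact: le_lebesgue_outer.
have lE : lint (\1_E) by exact: lint_indic.
have G0 : 0 <= intg (grad2 w) by apply: intg_ge0 => x; exact: grad2_ge0.
have a0 : 0 <= intg (\1_E : Rn -> R) by exact: intg_ge0.
(* A null set is treated apart because [rho] has to be positive. *)
have [a00|] := eqVneq (intg (\1_E : Rn -> R)) 0.
  have : leb (E : set T) = 0%E.
    move: a00; rewrite intg_indic// => h; rewrite -[leb _]fineK ?h//.
    by rewrite ge0_fin_numE ?outer_measure_ge0.
  move=> /lae_measure0 aE.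
  rewrite (@intg_ae_eq _ _ _ (fun=> 0)).
  - by rewrite intg0 mulr_ge0// mulr_ge0 ?mulr_ge0 ?addr_ge0 ?mulr_ge0// ltW.
  - by apply: lmeasM; [exact: lmeasX|exact: lmeas_indic].
  - exact: lmeas_cst.
  - by apply: lae_imp aE => x nE; rewrite indicE memNset// mulr0.
rewrite neq_lt ltNge a0/= => ap.
have [rho rho0 rhoE] := nth_root_ex (ltn_trans (ltn0Sn 1) n2) ap.
pose q := rho ^+ (n - 2).
have q0 : 0 < q by rewrite exprn_gt0.
have aq : intg (\1_E : Rn -> R) = q * rho ^+ 2 by rewrite -rhoE exprn_split.
have qG : q <= 4 * C0 * c1 * intg (grad2 w).
  have hM d x : 0 < d -> conv \1_E (kern d) x <= c1 * rho ^+ 2.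
    move=> d0; apply: le_trans (kern_indic_le x n2 mE fE rho0 d0) _.
    rewrite aq exprVn -/q (mulKf (lt0r_neq0 q0)) /c1; lra.
  have E0 : bsupp r (\1_E : Rn -> R).
    move=> x rx; rewrite indicE memNset// => /Er; rewrite /cube/= subr0 leNgt.
    by rewrite rx.
  have M0 : 0 < c1 * rho ^+ 2 by rewrite mulr_gt0// exprn_gt0.
  have E1 x : 0 <= (\1_E : Rn -> R) x by rewrite indicE.
  have h1 := nt _ _ _ _ lE E0 E1 M0 hw hM.
  have lEw : lint (fun x => \1_E x * w x ^+ 2).
    have hw2 := Ccinf_mulr hw (Ccinf_smooth hw).
    have [B _ hB] := Ccinf_bounded hw2.
    under eq_fun do rewrite mulrC.
    exact: lintM_bounded (lmeas_cont (Ccinf_cont hw2)) hB lE.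
  have h2 : intg (\1_E : Rn -> R) <= 4 * intg (fun x => \1_E x * w x ^+ 2).
    rewrite -(intgZ 4 lEw); apply: le_intg => //; first exact: lintZ.
    apply: laeW => x; rewrite mulrCA indicE; have [xE|xE] := boolP (x \in E).
      by rewrite mul1r; apply: hE; rewrite inE in xE.
    by rewrite mul0r.
  move: h1 h2; rewrite aq; move: (intg _) (intg (grad2 w)) => X G h1 h2.
  have r2 : 0 < rho ^+ 2 by rewrite exprn_gt0.
  rewrite -(ler_pM2r r2); lra.
(* The choice [s = 1 / rho] balances the two terms of [weak_sqr]: [s^2 |E|] and [s^-(n-2)] both
   become [q = rho^(n-2)], the power [|E|^(1 - 2/n)]. *)
have s0 : 0 < rho^-1 by rewrite invr_gt0.
have [_] := weak_sqr n2 mb b0 W0 hW mE fE s0.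
rewrite aq invrK -/q => h; apply: (le_trans h).
rewrite (_ : _ + _ = (1 + 8 * W ^+ n) * q); last by rewrite /q; field; rewrite gt_eqF.
by rewrite -[leRHS]mulrA ler_wpM2l// addr_ge0// mulr_ge0.
Qed.

End WeakTrace.

(** * Potentials with a trace inequality, and Maz'ya's truncation *)

Section TraceClass.
Context {R : realType} {n : nat}.
Local Notation Rn := 'rV[R]_n.
Local Notation T := (lebRn R n).
Implicit Types (f h u w phi psi beta V : Rn -> R) (x y z : Rn) (d M r W : R) (E S K U : set Rn).

(** The summand 1 next to the energy leaves room for the low level of [w^2]: where [w^2 <= 1], the
    integral of [V w^2] is paid for by the integral of [V]. *)
Definition trace_class V := [/\ lint V, forall x, 0 <= V x, exists r, bsupp r V &
  exists2 C : R, 0 <= C &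
    forall w, Ccinf setT w -> intg (fun x => V x * w x ^+ 2) <= C * (1 + intg (grad2 w))].

(** Read with [y = w^2] and [c = 4^j]: the left side is [c] times the density of the energy of
    [truncated w c] relative to that of [w]. The difference in the bound is
    [3cy / ((y + 4c)(y + c))], which explains the factor [16/3]; it telescopes because [4c] is the
    next level. *)
Lemma capacity_telescope (y c : R) : 0 <= y -> 0 < c ->
  c * (4 * y * c ^+ 2 / (y + c) ^+ 4) <= 16 / 3 * (4 * c / (y + 4 * c) - c / (y + c)).
Proof.
move=> y0 c0; have p1 : 0 < y + c by lra.
have p2 : 0 < y + 4 * c by lra.
rewrite (_ : 16 / 3 * _ = 16 * c * y / ((y + 4 * c) * (y + c))); last by field; rewrite !gt_eqF.
rewrite ler_pdivlMr ?mulr_gt0// [c * (_ / _)]mulrA mulrAC ler_pdivrMr ?exprn_gt0//.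
have -> : 16 * c * y * (y + c) ^+ 4 = (4 * c * y * (y + c)) * (4 * (y + c) ^+ 3) by ring.
have -> : c * (4 * y * c ^+ 2) * ((y + 4 * c) * (y + c)) =
  (4 * c * y * (y + c)) * (c ^+ 2 * (y + 4 * c)) by ring.
apply: ler_wpM2l; first by rewrite !mulr_ge0// ltW.
rewrite -subr_ge0.
have -> : 4 * (y + c) ^+ 3 - c ^+ 2 * (y + 4 * c) = y * (4 * y ^+ 2 + 12 * c * y + 11 * c ^+ 2) by ring.
by rewrite mulr_ge0// !addr_ge0 ?mulr_ge0 ?sqr_ge0// ltW.
Qed.

(** A smooth substitute for truncation at level [c] that is again a test function. Where [w^2 > c]
    its value is at least [1/2], the normalisation expected by [weak_trace_set]. *)
Definition truncated w (c : R) x := (w x * w x) * (w x * w x + c)^-1.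

Lemma truncated_test w (c : R) : 0 < c -> Ccinf setT w -> Ccinf setT (truncated w c) /\
  forall x, grad2 (truncated w c) x = 4 * w x ^+ 2 * c ^+ 2 / (w x ^+ 2 + c) ^+ 4 * grad2 w x.
Proof.
move=> c0 hw; have sw := Ccinf_smooth hw; have D := @smooth_diff R n.
have q0 x : w x * w x + c != 0 by rewrite gt_eqF// ltr_wpDl// -expr2 sqr_ge0.
have s1 : smooth (fun x => w x * w x) by exact: smoothM.
have s2 : smooth (fun x => w x * w x + c) by apply: smoothD => //; exact: smooth_cst.
have s3 := smoothV q0 s2.
split; first exact: Ccinf_mulr (Ccinf_mulr hw sw) s3.
move=> x; rewrite /grad2 mulr_sumr; apply: eq_bigr => i _.
rewrite /truncated (partialM i (D _ s1) (D _ s3)) (partialV i q0 (D _ s2)).2.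
rewrite (partialD i (D _ s1) (D _ (smooth_cst c))) partial_cst (partialM i (D _ sw) (D _ sw)).
have := q0 x; rewrite -expr2 => qx; by field.
Qed.

(* Maz'ya's truncation: the bounds on the level sets [4^j < w^2] are tested with
   [w^2 / (w^2 + 4^j)], and the energies of these functions add up to a telescoping sum. *)
Theorem weak_trace beta W r : (2 < n)%N -> lmeas beta -> (forall x, 0 <= beta x) -> bsupp r beta ->
  0 <= W -> weak_bound beta W -> trace_class (fun x => beta x ^+ 2).
Proof.
move=> n2 mb b0 br W0 hW.
have mC : measurable (cube 0 r : set T) by exact: cube_measurable.
have fC : (leb (cube 0 r : set T) < +oo)%E by exact: leb_cube_lty.
have bC S x : beta x ^+ 2 * \1_(cube 0 r `&` S) x = beta x ^+ 2 * \1_S x.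
  rewrite !indicE in_setI; have [xC|xC] := boolP (x \in cube 0 r); first by [].
  rewrite br ?expr0n ?mul0r//= ltNge; apply/negP => h; move/negP: xC; apply.
  by rewrite inE /cube/= subr0.
have lb : lint (fun x => beta x ^+ 2).
  have [h _] := weak_sqr n2 mb b0 W0 hW mC fC ltr01.
  rewrite (_ : (fun x => _) = fun x => beta x ^+ 2 * \1_(cube 0 r) x)//.
  apply/funext => x; have := bC setT x; rewrite setIT => ->.
  by rewrite indicE in_setT mulr1.
have [C C0 hC] := weak_trace_set n2 mb b0 W0 hW.
have b2 x : 0 <= beta x ^+ 2 by exact: sqr_ge0.
split => //; first by exists r => x /br->; rewrite expr0n.
have Ib : 0 <= intg (fun x => beta x ^+ 2) by exact: intg_ge0.
(* The factor [64/3] is the [16/3] of the telescoping sum times the ratio 4 of consecutive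
   levels. *)
exists (intg (fun x => beta x ^+ 2) + 64 / 3 * C).
  by rewrite addr_ge0// mulr_ge0 ?(ltW C0)// divr_ge0.
move=> w hw.
have G0 : 0 <= intg (grad2 w) by apply: intg_ge0 => x; exact: grad2_ge0.
have lG : lint (grad2 w) := lint_grad2 hw.
have c0 j : (0 : R) < 4 ^+ j by rewrite exprn_gt0.
have [B B0 hB] := Ccinf_bounded hw.
(* A test function is bounded, so finitely many levels suffice. *)
have [m hm] : exists m, forall x, w x ^+ 2 <= 4 ^+ m.
  have /filter_ex[m hm] := @expr_dvg R (B ^+ 2) 1 ltr01; exists m => x.
  apply: (@le_trans _ _ (B ^+ 2)); first by rewrite -[w x ^+ 2]real_normK ?num_real// lerXn2r ?nnegrE.
  by rewrite (le_trans hm)// mul1r lerXn2r ?nnegrE// ler_nat.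
pose S j := [set x | 4 ^+ j < w x ^+ 2].
have mw : lmeas (fun x => w x ^+ 2) := lmeasX 2 (lint_meas (Ccinf_lint hw)).
have mS j : measurable (S j : set T) by exact: measurable_lmeas_gt.
pose Q j := fun x => beta x ^+ 2 * \1_(S j) x.
have lQ j : lint (Q j).
  rewrite (_ : Q j = fun x => \1_(S j) x * beta x ^+ 2); last by apply/funext => x; rewrite mulrC.
  apply: (lintM_bounded (c := 1) (lmeas_indic (mS j)) _ lb) => x.
  by rewrite indicE; case: (_ \in _); rewrite ?normr1 ?normr0.
have [ht gt] : (forall j, Ccinf setT (truncated w (4 ^+ j))) /\ (forall j x,
    grad2 (truncated w (4 ^+ j)) x =
    4 * w x ^+ 2 * (4 ^+ j) ^+ 2 / (w x ^+ 2 + 4 ^+ j) ^+ 4 * grad2 w x).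
  by split => j; have [] := truncated_test (c0 j) hw.
have QT j : intg (Q j) <= C * intg (grad2 (truncated w (4 ^+ j))).
  have e : intg (Q j) = intg (fun x => beta x ^+ 2 * \1_(cube 0 r `&` S j) x).
    by apply: eq_intg => x; rewrite bC.
  rewrite e; apply: (hC _ _ r).
  - exact: measurableI.
  - by move=> x [].
  - exact: ht.
  move=> x [_ Sx]; rewrite /truncated -expr2; move: Sx; rewrite /S/=.
  move: (c0 j) (sqr_ge0 (w x)); set c := 4 ^+ j; set y := w x ^+ 2 => cp y0 cy.
  have h : 2^-1 <= y * (y + c)^-1 by rewrite ler_pdivlMr; lra.
  have : (2^-1 : R) ^+ 2 <= (y * (y + c)^-1) ^+ 2 by rewrite lerXn2r ?nnegrE// (le_trans _ h).
  rewrite exprVn; lra.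
have lT j : lint (grad2 (truncated w (4 ^+ j))) := lint_grad2 (ht j).
have tele x : \sum_(j < m) 4 ^+ j * grad2 (truncated w (4 ^+ j)) x <= 16 / 3 * grad2 w x.
  have y0 := sqr_ge0 (w x).
  pose H j : R := 4 ^+ j / (w x ^+ 2 + 4 ^+ j).
  have H1 j : H j <= 1.
    rewrite ler_pdivrMr ?mul1r ?lerDr//; have := c0 j; lra.
  have H0 j : 0 <= H j by rewrite divr_ge0 ?addr_ge0// ltW.
  apply: (@le_trans _ _ (\sum_(j < m) 16 / 3 * (H j.+1 - H j) * grad2 w x)).
    apply: ler_sum => j _; rewrite gt mulrA ler_wpM2r ?grad2_ge0// /H [4 ^+ j.+1]exprS.
    exact: capacity_telescope.
  rewrite -mulr_suml ler_wpM2r ?grad2_ge0// -mulr_sumr -[leRHS]mulr1 ler_wpM2l ?divr_ge0//.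
  rewrite (_ : \sum_(j < m) _ = H m - H 0%N); first by have := H1 m; have := H0 0%N; lra.
  elim: m {hm} => [|k ih]; first by rewrite big_ord0 subrr.
  by rewrite big_ord_recr/= ih; ring.
have pt x : beta x ^+ 2 * w x ^+ 2 <= beta x ^+ 2 + \sum_(j < m) 4 ^+ j.+1 * Q j x.
  have := @dyadic_le R (fun j => 4 ^+ j) (w x ^+ 2) m (fun j => ltW (c0 j)) (hm x).
  rewrite expr0 => h; apply: le_trans (ler_wpM2l (b2 x) h) _.
  rewrite mulrDr mulr1 lerD2l mulr_sumr; apply: ler_sum => j _.
  rewrite /Q mulrCA ler_wpM2l// ?exprn_ge0// ler_wpM2l// indicE.
  have [xS|//] := boolP (4 ^+ j < w x ^+ 2).
  by rewrite mem_set.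
have lbw : lint (fun x => beta x ^+ 2 * w x ^+ 2).
  have hw2 := Ccinf_mulr hw (Ccinf_smooth hw).
  have [B' _ hB'] := Ccinf_bounded hw2.
  under eq_fun do rewrite mulrC.
  exact: lintM_bounded (lmeas_cont (Ccinf_cont hw2)) hB' lb.
have lsum : lint (fun x => \sum_(j < m) 4 ^+ j.+1 * Q j x).
  by apply: lint_sum => j; exact: lintZ.
apply: (@le_trans _ _ (intg (fun x => beta x ^+ 2 + \sum_(j < m) 4 ^+ j.+1 * Q j x))).
  apply: le_intg; [exact: lbw|exact: lintD|exact: laeW].
rewrite (intgD lb lsum) intg_sum; last by move=> j; exact: lintZ.
have sumT : \sum_(j < m) intg (fun x => 4 ^+ j.+1 * Q j x) <= 64 / 3 * C * intg (grad2 w).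
  apply: (@le_trans _ _ (\sum_(j < m) 4 * C * intg (fun x => 4 ^+ j * grad2 (truncated w (4 ^+ j)) x))).
    apply: ler_sum => j _; rewrite (intgZ _ (lQ j)) (intgZ _ (lT j)).
    have := QT j; have := c0 j; rewrite exprS; set c := 4 ^+ j.
    move: (intg _) (intg _) => X Y cp XY.
    by rewrite (_ : 4 * C * (c * X) = 4 * c * (C * X)) ?ler_wpM2l//; [rewrite mulr_ge0// ltW|ring].
  rewrite -mulr_sumr -intg_sum; last by move=> j; exact: lintZ.
  have := @le_intg R n (fun x => \sum_(j < m) 4 ^+ j * grad2 (truncated w (4 ^+ j)) x)
    (fun x => 16 / 3 * grad2 w x).
  rewrite (intgZ _ lG) => h.
  have {}h := h (lint_sum _ (fun j : 'I_m => lintZ _ (lT j))) (lintZ _ lG) (laeW tele).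
  have p : 0 <= 4 * C by rewrite mulr_ge0// ltW.
  apply: le_trans (ler_wpM2l p h) _; lra.
move: sumT Ib G0; move: (intg _) (intg (grad2 w)) (\sum_(j < m) _) => I G Sm sumT I0 G0.
have : 0 <= I * G by rewrite mulr_ge0.
have : 0 <= 64 / 3 * C by rewrite mulr_ge0 ?(ltW C0)// divr_ge0.
lra.
Qed.

Lemma potential_trace_class f M r : (2 < n)%N -> lint f -> bsupp r f -> (forall x, 0 <= f x) ->
  0 < M -> (forall d x, 0 < d -> conv f (kern d) x <= M) -> trace_class f.
Proof.
move=> n2 lf fr f0 M0 hM; have [C C0 hC] := @newton_trace R n n2.
split => //; first by exists r.
exists (C * M) => [|w hw]; first by rewrite mulr_ge0// ltW.
apply: le_trans (hC _ _ _ _ lf fr f0 M0 hw hM) _.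
by rewrite ler_wpM2l ?mulr_ge0 ?(ltW C0) ?(ltW M0)// lerDr.
Qed.

End TraceClass.

(** * The trace inequality from Kato and weak Lorentz bounds, and for Sobolev functions *)

Section FormBounded.
Context {R : realType} {n : nat}.
Local Notation Rn := 'rV[R]_n.
Local Notation T := (lebRn R n).
Implicit Types (f h u w phi psi beta V : Rn -> R) (x y z : Rn) (d M r W : R) (E S K U : set Rn).

Lemma enorm_sqr x : enorm x ^+ 2 = dotv x x.
Proof. by rewrite sqr_sqrtr// dotv_ge0. Qed.

Lemma enorm_gt0 x : x != 0 -> 0 < enorm x.
Proof.
move=> x0; rewrite sqrtr_gt0 -[0](@expr0n R 2).
by apply: dotv_gt => //; rewrite normr_gt0.
Qed.

Lemma lmeas_enorm_sub x : lmeas (fun y => enorm (x - y)).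
Proof.
apply: (lmeas_comp (@sqrt_continuous R)).
exact: (lmeas_cont (smooth_continuous (smooth_reflect x (@smooth_dotv R n)))).
Qed.

Lemma kern_le_enorm d x : 0 < d -> x != 0 -> kern d x <= (enorm x ^+ (n - 2))^-1.
Proof.
move=> d0 /enorm_gt0 x0; rewrite -exprVn; apply: lerXn2r; rewrite ?nnegrE.
- exact/ltW/rad_gt0.
- by rewrite invr_ge0 ltW.
- rewrite /rad lef_pV2 ?posrE//; last by rewrite sqrtr_gt0 rad_den.
  by apply: ler_wsqrtr; rewrite lerDl sqr_ge0.
Qed.

Lemma enorm_sub_bounded K x : compact K -> exists2 r : R, 0 < r & forall y, K y -> enorm (x - y) < r.
Proof.
move=> /compact_rV_bounded[r hr]; exists (Num.sqrt (n%:R * (`|x| + r) ^+ 2) + 1) => [|y /hr yr].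
  by rewrite ltr_wpDl// sqrtr_ge0.
rewrite (@le_lt_trans _ _ (Num.sqrt (n%:R * (`|x| + r) ^+ 2)))// ?ltrDl// ler_wsqrtr//.
apply: le_trans (dotv_le _) _; rewrite ler_wpM2l// lerXn2r ?nnegrE ?addr_ge0//.
  exact: le_trans (normr_ge0 _) yr.
by rewrite (le_trans (ler_normB _ _))// lerD2l.
Qed.

Lemma lmeas_powN_enorm x m : lmeas (fun y => (enorm (x - y) ^+ m)^-1).
Proof.
rewrite (_ : (fun y => _) = fun y => (enorm (x - y) ^+ m) `^ (-1)); last first.
  by apply/funext => y; rewrite powR_inv1// exprn_ge0// sqrtr_ge0.
apply: (@lmeas_mcomp _ _ (fun t : R => t `^ (-1))); first exact: measurable_powR.
exact/lmeasX/lmeas_enorm_sub.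
Qed.

Lemma lint_restrict U f K : measurable (U : set T) -> lint (f \_ U) -> measurable (K : set T) ->
  K `<=` U -> lint (fun x => `|f x| * \1_K x).
Proof.
move=> mU lf mK KU.
rewrite (_ : (fun x => _) = fun x => \1_K x * `|(f \_ U) x|).
  apply: (lintM_bounded (c := 1) (lmeas_indic mK) _ (lint_norm lf)) => x.
  by rewrite indicE; case: (_ \in _); rewrite ?normr1 ?normr0.
apply/funext => x; rewrite restrictE !indicE; have [xK|] := boolP (x \in K); last by rewrite mulr0 mul0r.
by rewrite mem_set ?mulr1 ?mul1r//; apply: KU; rewrite inE in xK.
Qed.

(** The smoothed kernel is below [|x - y|^(2-n)], and a single ball around [x] contains [K], so the
    integral over this ball in [vartheta] controls the potential. *)
Lemma vartheta_potential U f K d x r : (0 < n)%N -> open U -> lint (f \_ U) -> compact K -> K `<=` U ->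
  0 < d -> (forall y, K y -> enorm (x - y) < r) ->
  ((conv (fun x => `|f x| * \1_K x) (kern d) x)%:E <= vartheta U f r)%E.
Proof.
move=> n0 oU lf cK KU d0 hr.
have mU : measurable (U : set T) by exact: open_measurable_leb.
have mK : measurable (K : set T) by exact: compact_measurable_leb.
have lV := lint_restrict mU lf mK KU.
have [rho hrho] := compact_rV_bounded cK.
have V0 : bsupp rho (fun x => `|f x| * \1_K x).
  move=> y ry; rewrite indicE memNset ?mulr0// => /hrho; rewrite leNgt.
  by rewrite ry.
have lc := lint_conv x lV V0 (smooth_continuous (smooth_kern d0)).
rewrite /conv (EFin_intg lc).
apply: (@le_trans _ _ (\int[@leb R n]_(y in ((eball x r `&` U) : set T))
      (`|f y| / enorm (x - y) ^+ (n - 2))%:E)%E); last first.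
  by apply: ereal_sup_ubound; exists x.
pose D := eball x r `&` U.
have mD : measurable (D : set T).
  apply: measurableI => //.
  have -> : eball x r = ~` [set y | ~ (enorm (x - y) < r)] by rewrite /eball setCK.
  have e : [set y | ~ enorm (x - y) < r] = ~` [set y | 0 < r - enorm (x - y)].
    by apply/seteqP; split => y /=; rewrite subr_gt0.
  rewrite e setCK; apply: measurable_lmeas_gt; apply: lmeasB; first exact: lmeas_cst.
  exact: lmeas_enorm_sub.
pose g y := `|f y| / enorm (x - y) ^+ (n - 2).
rewrite (integral_mkcond (D : set T)) (restrict_EFin g).
have g0 y : 0 <= (g \_ D) y.
  by rewrite restrictE !mulr_ge0// invr_ge0 exprn_ge0// sqrtr_ge0.
have mg : lmeas (g \_ D).
  rewrite (_ : g \_ D = fun y => `|(f \_ U) y| * (enorm (x - y) ^+ (n - 2))^-1 * \1_D y).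
    apply: lmeasM; last exact: lmeas_indic.
    by apply: lmeasM; [exact/lmeas_norm/lint_meas|exact: lmeas_powN_enorm].
  apply/funext => y; rewrite !restrictE /g indicE; have [yD|] := boolP (y \in D); last by rewrite !mulr0.
  by rewrite !mulr1 indicE mem_set ?mulr1//; rewrite inE in yD; case: yD.
have c0 y : 0 <= `|f y| * \1_K y * kern d (x - y) by rewrite !mulr_ge0// kern_ge0.
apply: ae_ge0_le_integral.
- exact: measurableT.
- by move=> y _; rewrite lee_fin.
- by apply/measurable_EFinP; exact: lint_meas lc.
- by move=> y _; rewrite lee_fin.
- by apply/measurable_EFinP; exact: mg.
(* For [n > 2] the quotient in [vartheta] takes the value 0 at [y = x], because [0^-1 = 0]. The
   kernels are therefore compared off this point, which is a null set. *)
have /lae_measure0 : leb ([set x] : set T) = 0%E by exact: leb_set1.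
apply: lae_imp => y yx _; rewrite lee_fin.
have [yK|yK] := boolP (y \in K); last by rewrite indicE (negbTE yK) mulr0 mul0r.
rewrite inE in yK; rewrite restrictE !indicE !mem_set//; last by split; [exact: hr|exact: KU].
rewrite !mulr1 /g ler_wpM2l// kern_le_enorm// subr_eq0; apply/eqP => xy; apply: yx.
by rewrite xy.
Qed.

(** A ball around [x] that contains [K] has a radius growing with [x]; the supremum over all radii
    in [Kato] makes the bound on the potential uniform. *)
Theorem kato_trace_class U f K : (2 < n)%N -> open U -> Kato U f -> compact K -> K `<=` U ->
  trace_class (fun x => `|f x| * \1_K x).
Proof.
move=> n2 oU [hf _ hS] cK KU.
have mU : measurable (U : set T) by exact: open_measurable_leb.
have mK : measurable (K : set T) by exact: compact_measurable_leb.
have lf : lint (f \_ U) by exact/(Lp1P _ mU).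
have [rho hrho] := compact_rV_bounded cK.
move: hS; set s := ereal_sup _ => hS.
apply: (@potential_trace_class _ _ _ (`|fine s| + 1) rho) => //.
- exact: (lint_restrict mU lf mK KU).
- move=> y ry; rewrite indicE memNset ?mulr0// => /hrho; rewrite leNgt.
  by rewrite ry.
move=> d x d0; have [r r0 hr] := enorm_sub_bounded x cK.
have h := vartheta_potential (ltn_trans (ltn0Sn 1) n2) oU lf cK KU d0 hr.
have {h} : ((conv (fun x => `|f x| * \1_K x) (kern d) x)%:E <= s)%E.
  by apply: (le_trans h); apply: ereal_sup_ubound; exists r.
case: s hS => [s| |] //= _; rewrite lee_fin => h.
by rewrite (le_trans h)// (le_trans (ler_norm _))// lerDl.
Qed.

Lemma weak_Lorentz_distr (p : R) U f : 0 < p -> weak_Lorentz p U f ->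
  exists2 W : R, 0 <= W & forall t : R, 0 < t -> (distr U f t <= ((W / t) `^ p)%:E)%E.
Proof.
move=> p0 [_]; rewrite /weak_Lorentz_norm; set s := ereal_sup _ => hs.
have D0 t : (0 <= distr U f t)%E by exact: outer_measure_ge0.
have key t : 0 < t -> (t%:E * distr U f t `^ p^-1 <= s)%E.
  by move=> t0; apply: ereal_sup_ubound; exists t.
have p10 : 0 < p^-1 by rewrite invr_gt0.
have s0 : (0 <= s)%E.
  by apply: le_trans (key 1 ltr01); rewrite mul1e poweR_ge0.
case: s hs key s0 => [s| |] //= _ key; rewrite lee_fin => s0.
exists s => // t t0; have := key t t0; have := D0 t.
case: (distr U f t) => [a| |] //=.
  rewrite -EFinM !lee_fin => a0 h.
  have h2 : a `^ p^-1 <= s / t by rewrite ler_pdivlMr// mulrC.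
  have -> : a = (a `^ p^-1) `^ p by rewrite -powRrM mulVf ?gt_eqF// powRr1.
  by apply: ge0_ler_powR; rewrite ?nnegrE ?powR_ge0 ?divr_ge0// ltW.
by move=> _; rewrite gt_eqF// gt0_muley ?lte_fin.
Qed.

Lemma weak_trace_indic U h K W : (2 < n)%N -> open U -> measurable_on U h -> (forall x, 0 <= h x) ->
  compact K -> K `<=` U -> 0 <= W ->
  (forall t : R, 0 < t -> (leb ([set x | U x /\ (t < h x)%R] : set T) <= ((W / t) ^+ n)%:E)%E) ->
  trace_class (fun x => h x ^+ 2 * \1_K x).
Proof.
move=> n2 oU mh h0 cK KU W0 hW.
have mU : measurable (U : set T) by exact: open_measurable_leb.
have mK : measurable (K : set T) by exact: compact_measurable_leb.
have [rho hrho] := compact_rV_bounded cK.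
have -> : (fun x => h x ^+ 2 * \1_K x) = (fun x => (h x * \1_K x) ^+ 2).
  apply/funext => x; rewrite exprMn indicE; congr (_ * _).
  by case: (_ \in _); rewrite ?expr1n ?expr0n.
apply: (@weak_trace _ _ (fun x => h x * \1_K x) W rho) => //.
- rewrite (_ : (fun x => _) = fun x => (h \_ U) x * \1_K x).
    by apply: lmeasM; [exact/(lmeas_restrict _ mU)|exact: lmeas_indic].
  apply/funext => x; rewrite restrictE !indicE; have [xK|] := boolP (x \in K); last by rewrite !mulr0.
  by rewrite mem_set ?mulr1//; apply: KU; rewrite inE in xK.
- by move=> x; rewrite mulr_ge0.
- move=> y ry; rewrite indicE memNset ?mulr0// => /hrho; rewrite leNgt.
  by rewrite ry.
move=> t t0; apply: le_trans (hW t t0); apply: le_lebesgue_outer => x /=.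
rewrite indicE; have [xK|_] := boolP (x \in K); last by rewrite mulr0 ltNge (ltW t0).
by rewrite mulr1 => tx; split => //; apply: KU; rewrite inE in xK.
Qed.

Theorem weak_Lorentz_trace_class U h K : (2 < n)%N -> open U -> weak_Lorentz n%:R U h ->
  (forall x, 0 <= h x) -> compact K -> K `<=` U -> trace_class (fun x => h x ^+ 2 * \1_K x).
Proof.
move=> n2 oU hh h0 cK KU; have n0 : (0 : R) < n%:R by rewrite ltr0n (ltn_trans _ n2).
have [W W0 hW] := weak_Lorentz_distr n0 hh.
apply: (weak_trace_indic n2 oU hh.1 h0 cK KU W0) => t t0.
have := hW t t0; rewrite /distr powR_mulrn ?divr_ge0// ?(ltW t0)//; apply: le_trans.
by apply: le_lebesgue_outer => x [Ux tx]; split => //; rewrite ger0_norm.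
Qed.

(** Reduction to exponent [n]: if [f] is in weak [L^(n/2)] with constant [W], then [sqrt |f|] is in
    weak [L^n] with constant [sqrt W], since [|f| > t^2] where [sqrt |f| > t]. *)
Theorem weak_Lorentz_half_trace_class U f K : (2 < n)%N -> open U -> weak_Lorentz (n%:R / 2) U f ->
  compact K -> K `<=` U -> trace_class (fun x => `|f x| * \1_K x).
Proof.
move=> n2 oU hf cK KU; have n0 : (0 : R) < n%:R / 2 by rewrite divr_gt0// ltr0n (ltn_trans _ n2).
have [W W0 hW] := weak_Lorentz_distr n0 hf.
have mU : measurable (U : set T) by exact: open_measurable_leb.
pose h x := Num.sqrt `|f x|.
have mh : measurable_on U h.
  apply/(lmeas_restrict _ mU).
  rewrite (_ : h \_ U = fun x => Num.sqrt `|(f \_ U) x|).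
    apply: (lmeas_comp (@sqrt_continuous R)); apply: lmeas_norm.
    by apply/(lmeas_restrict _ mU); exact: hf.1.
  apply/funext => x; rewrite !restrictE indicE; case: (_ \in _); rewrite ?mulr1 ?mulr0//.
  by rewrite normr0 sqrtr0.
have := @weak_trace_indic U h K (Num.sqrt W) n2 oU mh (fun x => sqrtr_ge0 _) cK KU (sqrtr_ge0 _).
rewrite (_ : (fun x => h x ^+ 2 * \1_K x) = fun x => `|f x| * \1_K x); last first.
  by apply/funext => x; rewrite sqr_sqrtr.
apply => t t0.
have -> : (Num.sqrt W / t) ^+ n = (W / t ^+ 2) `^ (n%:R / 2).
  have -> : W / t ^+ 2 = (Num.sqrt W / t) `^ 2.
    by rewrite powR_mulrn ?divr_ge0 ?sqrtr_ge0 ?(ltW t0)// expr_div_n sqr_sqrtr.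
  have -> : ((Num.sqrt W / t) `^ 2) `^ (n%:R / 2) = (Num.sqrt W / t) `^ n%:R.
    by rewrite -powRrM; congr (_ `^ _); field.
  by rewrite powR_mulrn// divr_ge0 ?sqrtr_ge0// ltW.
apply: le_trans (hW (t ^+ 2) _); last by rewrite exprn_gt0.
apply: le_lebesgue_outer => x [Ux tx]; split => //; move: tx; rewrite /h => tx.
rewrite -[ltRHS]sqr_sqrtr// ltr_pXn2r// ?nnegrE ?sqrtr_ge0//; exact: ltW.
Qed.

(** The indicator of a first thickening [K1] is mollified: the radius is small enough to leave the
    value 1 on [K], and to keep the support within a second thickening [K2]. *)
Lemma cutoff K U : compact K -> open U -> K `<=` U ->
  exists K' chi, [/\ compact K', K' `<=` U, Ccinf K' chi & forall x, K x -> chi x = 1].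
Proof.
move=> cK oU KU.
have [d1 d10 [K1 [cK1 K1U KK1]]] := compact_thicken cK oU KU.
have [d2 d20 [K2 [cK2 K2U K12]]] := compact_thicken cK1 oU K1U.
pose s := Num.min d1 d2; have s0 : 0 < s by rewrite lt_min d10.
have mK1 : measurable (K1 : set T) by exact: compact_measurable_leb.
have [r hr] := compact_rV_bounded cK1.
have lK1 : lint (\1_K1).
  apply: lint_indic => //; apply: le_lt_trans (leb_cube_lty 0 r).
  by apply: le_lebesgue_outer => x /hr; rewrite /cube/= subr0.
have r1 : bsupp r (\1_K1 : Rn -> R).
  by move=> y ry; rewrite indicE memNset// => /hr; rewrite leNgt ry.
exists K2, (conv \1_K1 (moll s)); split => //.
  have sc := conv_smooth lK1 r1 (moll_smooth s).
  have h : closure [set x | conv \1_K1 (moll s) x != 0] `<=` K2.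
    apply: (@subset_trans _ (closure K2)); last first.
      by rewrite -(closure_id K2).1//; exact: compact_closed.
    apply: closureS => x /=; apply: contraNP => nx; apply/eqP.
    rewrite /conv -[RHS](@intg0 R n); apply: eq_intg => y; rewrite indicE.
    have [yK|_] := boolP (y \in K1); last by rewrite mul0r.
    rewrite (moll_bsupp (ltW s0)) ?mulr0// ltNge; apply/negP => xy; apply: nx.
    rewrite inE in yK; apply: (K12 y yK); rewrite /cube/= (le_trans xy)//.
    by rewrite /s ge_min lexx orbT.
  by split => //; apply: (subclosed_compact _ cK2 h); exact: closed_closure.
move=> x Kx; rewrite /conv -(intg_moll_sub x s0); apply: eq_intg => y; rewrite indicE.
have [yK|yK] := boolP (y \in K1); first by rewrite mul1r.
rewrite (moll_bsupp (ltW s0)) ?mulr0// ltNge; apply/negP => xy.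
move/negP: yK; apply; rewrite inE; apply: (KK1 x Kx); rewrite /cube/= distrC (le_trans xy)//.
by rewrite /s ge_min lexx.
Qed.

(** The trace inequality is available for test functions, so it is applied to [chi * W_j] with a
    cutoff [chi] equal to 1 on [K]. The energies stay bounded, and Fatou's lemma gives the limit. *)
Lemma trace_sobolev U u g K V : open U -> is_wgrad U u g -> compact K -> K `<=` U ->
  (forall K', compact K' -> K' `<=` U -> lint (fun x => (u \_ K') x ^+ 2) /\
     forall i, lint (fun x => ((fun y => g y 0 i) \_ K') x ^+ 2)) ->
  trace_class V -> (forall x, ~ K x -> V x = 0) -> lint (fun x => V x * u x ^+ 2).
Proof.
move=> oU wg cK KU h2 [lV V0 _ [C C0 hC]] VK.
have [K' [chi [cK' K'U hchi chi1]]] := cutoff cK oU KU.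
have [W [sW Wu _ [G lG hG]]] := wgrad_smooth_approx oU wg cK' K'U h2.
have KK' : K `<=` K'.
  by move=> x /chi1 e; apply: (Ccinf_supp hchi); rewrite e oner_neq0.
have hT := CcinfT hchi.
have hw j : Ccinf setT (fun x => chi x * W j x) := Ccinf_mulr hT (sW j).
have [B [B0 hB hBi]] : exists B : R, [/\ 0 <= B, forall x, `|chi x| <= B &
    forall i x, `|partial i chi x| <= B].
  have [B1 B10 hB1] := Ccinf_bounded hT.
  have H i : exists M : R, 0 <= M /\ forall x, `|partial i chi x| <= M.
    by have [M M0 hM] := Ccinf_bounded (Ccinf_partial i hT); exists M.
  have /choice[M hM] := H.
  have sM : 0 <= \sum_i M i by apply: sumr_ge0 => i _; have [] := hM i.
  exists (B1 + \sum_i M i); split; first exact: addr_ge0.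
    by move=> x; rewrite (le_trans (hB1 x))// lerDl.
  move=> i x; rewrite (le_trans ((hM i).2 x))// (bigD1 i)//= addrCA lerDl addr_ge0//.
  by apply: sumr_ge0 => j _; have [] := hM j.
have sqB (a : R) : `|a| <= B -> a ^+ 2 <= B ^+ 2.
  by move=> aB; rewrite -[a ^+ 2]real_normK ?num_real// lerXn2r ?nnegrE.
(* In each coordinate the product rule gives [(a q + p b)^2 <= 2 (a^2 q^2 + p^2 b^2) <= 4 B^2 |G|];
   there are [n] coordinates. *)
have eG j : intg (grad2 (fun x => chi x * W j x)) <= intg (fun x => n%:R * (4 * B ^+ 2) * `|G x|).
  apply: le_intg; [exact: lint_grad2 (hw j)|exact/lintZ/lint_norm|].
  apply: lae_imp hG => x hx; rewrite /grad2.
  apply: (@le_trans _ _ (\sum_(i < n) 4 * B ^+ 2 * `|G x|)); last first.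
    by rewrite sumr_const card_ord -[leLHS]mulr_natl [leLHS]mulrA.
  apply: ler_sum => i _; rewrite partialM; [|exact/smooth_diff/(Ccinf_smooth hT)|exact: smooth_diff].
  have [K'x|nK'] := pselect (K' x).
    have [h1 h3] := hx K'x j; have {}h3 := h3 i.
    have := sqB _ (hB x); have := sqB _ (hBi i x); have := ler_norm (G x).
    move: h1 h3; set a := chi x; set b := partial i chi x; set p := W j x; set q := partial i _ x.
    move: (sqr_ge0 a) (sqr_ge0 b) (sqr_ge0 p) (sqr_ge0 q) (sqr_ge0 B) => a0 b0 p0 q0 BB hp hq hG' hb ha.
    have e1 : a ^+ 2 * q ^+ 2 <= B ^+ 2 * `|G x| by apply: ler_pM => //; exact: le_trans hG'.
    have e2 : p ^+ 2 * b ^+ 2 <= `|G x| * B ^+ 2 by apply: ler_pM => //; exact: le_trans hG'.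
    have := sqr_ge0 (a * q - p * b); nra.
  rewrite (Ccinf_out hchi nK') (Ccinf_out (Ccinf_partial i hchi) nK') mul0r mulr0 addr0 expr0n/=.
  by rewrite !mulr_ge0// sqr_ge0.
have mK : measurable (K : set T) by exact: compact_measurable_leb.
pose F j x := V x * (chi x * W j x) ^+ 2.
have [] // := @intg_fatou R n F (fun x => V x * u x ^+ 2)
    (C * (1 + intg (fun x => n%:R * (4 * B ^+ 2) * `|G x|))).
- move=> j; have hw2 := Ccinf_mulr (hw j) (Ccinf_smooth (hw j)).
  have [B' _ hB'] := Ccinf_bounded hw2.
  rewrite /F; under eq_fun do rewrite mulrC.
  exact: lintM_bounded (lmeas_cont (Ccinf_cont hw2)) hB' lV.
- rewrite (_ : (fun x => _) = fun x => V x * ((u \_ K) x) ^+ 2).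
    apply: lmeasM; first exact: lint_meas.
    apply: lmeasX; apply: lint_meas; apply: (L1loc_lint _ cK KU); by case: wg.
  apply/funext => x; rewrite restrictE indicE; have [xK|xK] := boolP (x \in K); first by rewrite mulr1.
  by rewrite (VK x) ?mul0r// => Kx; move/negP: xK; apply; rewrite inE.
- by move=> j x; rewrite mulr_ge0// sqr_ge0.
- by move=> j; apply: le_trans (hC _ (hw j)) _; rewrite ler_wpM2l// lerD2l.
- apply: lae_imp Wu => x Wx; have [Kx|nK] := pselect (K x).
    rewrite /F (chi1 x Kx); under eq_fun do rewrite mul1r.
    have c := Wx (KK' x Kx).
    by apply: cvgM; [exact: cvg_cst|rewrite expr2; under eq_fun do rewrite expr2; exact: cvgM].
  by rewrite /F (VK x nK) mul0r; under eq_fun do rewrite mul0r; exact: cvg_cst.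
Qed.

End FormBounded.

(** * Square integrable functions, and test functions as elements of [W_0^{1,2}] *)

Section SquareIntegrable.
Context {R : realType} {n : nat}.
Local Notation Rn := 'rV[R]_n.
Local Notation T := (lebRn R n).
Implicit Types (f h u v w a phi psi : Rn -> R) (x y z : Rn) (K U : set Rn).

Definition l2 f := lmeas f /\ lint (fun x => f x ^+ 2).

Lemma l2D f h : l2 f -> l2 h -> l2 (fun x => f x + h x).
Proof.
move=> [mf lf] [mh lh]; split; first exact: lmeasD.
apply: (lint_dom _ (lintD (lintZ 2 lf) (lintZ 2 lh))); first exact/lmeasX/lmeasD.
apply: laeW => x; rewrite ger0_norm ?sqr_ge0//.
have := sqr_ge0 (f x - h x); nra.
Qed.

Lemma l2Z (c : R) f : l2 f -> l2 (fun x => c * f x).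
Proof.
move=> [mf lf]; split; first by apply: lmeasM => //; exact: lmeas_cst.
by under eq_fun do rewrite exprMn; exact: lintZ.
Qed.

Lemma l2N f : l2 f -> l2 (fun x => - f x).
Proof. by move=> h; under eq_fun do rewrite -mulN1r; exact: l2Z. Qed.

Lemma l2B f h : l2 f -> l2 h -> l2 (fun x => f x - h x).
Proof. by move=> lf lh; apply: l2D => //; exact: l2N. Qed.

Lemma l2_sum (I : Type) (s : seq I) (F : I -> Rn -> R) : (forall i, l2 (F i)) ->
  l2 (fun x => \sum_(i <- s) F i x).
Proof.
move=> hF; elim: s => [|i s ih].
  under eq_fun do rewrite big_nil.
  split; first exact: lmeas_cst.
  by under eq_fun do rewrite expr0n/=; exact: lint0.
by under eq_fun do rewrite big_cons; exact: l2D.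
Qed.

Lemma l2_dom f h : lmeas f -> lint h -> lae (fun x => f x ^+ 2 <= h x) -> l2 f.
Proof.
move=> mf lh hfh; split => //; apply: (lint_dom _ lh); first exact: lmeasX.
by apply: lae_imp hfh => x; rewrite ger0_norm// sqr_ge0.
Qed.

Lemma l2_bounded (c : R) a f : lmeas a -> lae (fun x => `|a x| <= c) -> l2 f ->
  l2 (fun x => a x * f x).
Proof.
move=> ma ac [mf lf]; apply: (@l2_dom _ (fun x => c ^+ 2 * f x ^+ 2)).
- exact: lmeasM.
- exact: lintZ.
apply: lae_imp ac => x axc; rewrite exprMn ler_wpM2r ?sqr_ge0//.
rewrite -[a x ^+ 2]real_normK ?num_real// lerXn2r ?nnegrE//.
exact: le_trans (normr_ge0 _) axc.
Qed.

Lemma l2M f h : l2 f -> l2 h -> lint (fun x => f x * h x).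
Proof.
move=> [mf lf] [mh lh]; apply: (lint_dom _ (lintD lf lh)); first exact: lmeasM.
apply: laeW => x; rewrite ler_norml.
have := sqr_ge0 (f x - h x); have := sqr_ge0 (f x + h x).
move=> h1 h2; apply/andP; split; nra.
Qed.

Lemma lint_Ccinf f U phi : lint f -> Ccinf U phi -> lint (fun x => f x * phi x).
Proof.
move=> lf hp; have [B _ hB] := Ccinf_bounded hp.
under eq_fun do rewrite mulrC.
exact: lintM_bounded (lmeas_cont (Ccinf_cont hp)) hB lf.
Qed.

Lemma restrict_out f K x : ~ K x -> (f \_ K) x = 0.
Proof. by move=> nK; rewrite restrictE indicE memNset// mulr0. Qed.

Lemma restrict_in f K x : K x -> (f \_ K) x = f x.
Proof. by move=> Kx; rewrite restrictE indicE mem_set// mulr1. Qed.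

Lemma Rintegral_supp U h : (forall x, ~ U x -> h x = 0) ->
  \int[@leb R n]_(x in (U : set T)) (h x) = intg h.
Proof.
move=> h0; rewrite (Rintegral_intg U h); apply: eq_intg => x.
by have [Ux|nU] := pselect (U x); [rewrite restrict_in|rewrite restrict_out// h0].
Qed.

Lemma lmeas_restrictW U f K : measurable (U : set T) -> measurable (K : set T) -> K `<=` U ->
  measurable_on U f -> lmeas (f \_ K).
Proof.
move=> mU mK KU mf; rewrite (_ : f \_ K = fun x => (f \_ U) x * \1_K x).
  by apply: lmeasM; [exact/(lmeas_restrict _ mU)|exact: lmeas_indic].
apply/funext => x; rewrite indicE; have [Kx|nK] := pselect (K x).
  by rewrite !restrict_in ?mem_set ?mulr1//; exact: KU.
by rewrite restrict_out// memNset// mulr0.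
Qed.

Lemma enorm_restrict_meas U (g : Rn -> Rn) : measurable (U : set T) ->
  (forall i, measurable_on U (fun x => g x 0 i)) -> lmeas ((fun x => enorm (g x)) \_ U).
Proof.
move=> mU mg; have mi i : lmeas ((fun x => g x 0 i) \_ U) by exact/(lmeas_restrict _ mU).
rewrite (_ : _ \_ U = fun x => Num.sqrt (\sum_i ((fun x => g x 0 i) \_ U) x ^+ 2)).
  by apply: (lmeas_comp (@sqrt_continuous R)); apply: lmeas_sum => i; exact: lmeasX.
apply/funext => x; have [Ux|nU] := pselect (U x).
  rewrite restrict_in//; congr Num.sqrt; apply: eq_bigr => i _.
  by rewrite restrict_in.
rewrite restrict_out// big1 ?sqrtr0// => i _.
by rewrite restrict_out ?expr0n.
Qed.

Lemma Lp2_ae U f h : measurable (U : set T) -> lmeas (f \_ U) -> lint h ->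
  lae (fun x => U x -> f x ^+ 2 <= h x) -> Lp 2 U f.
Proof.
move=> mU mf lh hfh; apply/(Lp2P _ mU); split => //.
apply: (lint_dom _ (lint_norm lh)); first exact: lmeasX.
apply: lae_imp hfh => x fh; rewrite ger0_norm ?sqr_ge0//.
have [Ux|nU] := pselect (U x); last by rewrite restrict_out// expr0n/= normr_ge0.
by rewrite restrict_in// (le_trans (fh Ux))// ler_norm.
Qed.

Transparent lint intg lmeas lae.

Lemma Lp2_norm_ae0 U f : measurable (U : set T) -> lmeas (f \_ U) ->
  lae (fun x => U x -> f x = 0) -> Lp_norm 2 U f = 0%E.
Proof.
move=> mU mf f0; have l0 : Lp 2 U f.
  by apply: (Lp2_ae mU mf (@lint0 R n)); apply: lae_imp f0 => x fx Ux; rewrite fx// expr0n.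
rewrite /Lp_norm unlock; set I := (\int[_]_x _)%E.
suff -> : I = 0%E by rewrite poweR0r// invr_neq0.
transitivity (\int[@leb R n]_x (`|(f \_ U) x| `^ 2)%:E)%E; first by [].
have p0 : (2 : R) != 0 by rewrite pnatr_eq0.
have [_ lf] := (LpP f mU p0).1 l0.
rewrite -(EFin_intg lf).
rewrite (@intg_ae_eq _ _ _ (fun=> 0)) ?intg0//.
- exact: lint_meas lf.
- exact: lmeas_cst.
apply: lae_imp f0 => x fx; have [Ux|nU] := pselect (U x).
  by rewrite restrict_in// fx// normr0 powR0.
by rewrite restrict_out// normr0 powR0.
Qed.

Opaque lint intg lmeas lae.

Lemma Ccinf_L1loc U phi : open U -> Ccinf setT phi -> L1loc U phi.
Proof.
move=> oU hp; have mU : measurable (U : set T) by exact: open_measurable_leb.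
have mp : lmeas phi by exact/lmeas_cont/(Ccinf_cont hp).
split.
  apply/(lmeas_restrict _ mU); rewrite (_ : _ \_ _ = fun x => phi x * \1_U x).
    by apply: lmeasM => //; exact: lmeas_indic.
  by apply/funext => x; rewrite restrictE.
move=> K cK KU; have mK : measurable (K : set T) by exact: compact_measurable_leb.
apply/(Lp1P _ mK); rewrite (_ : _ \_ _ = fun x => \1_K x * phi x).
  apply: (lintM_bounded (c := 1) (lmeas_indic mK) _ (Ccinf_lint hp)) => x.
  by rewrite indicE; case: (_ \in _); rewrite ?normr1 ?normr0.
by apply/funext => x; rewrite restrictE mulrC.
Qed.

Lemma Ccinf_wgrad U phi : open U -> Ccinf setT phi -> is_wgrad U phi (grad phi).
Proof.
move=> oU hp; split; first exact: Ccinf_L1loc.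
  move=> i; rewrite (_ : (fun x => _) = partial i phi); last by apply/funext => x; rewrite mxE.
  by apply: Ccinf_L1loc => //; exact: Ccinf_partial.
move=> psi i hpsi.
rewrite (@Rintegral_supp U (fun x => phi x * partial i psi x)); last first.
  by move=> x nU; rewrite (Ccinf_out (Ccinf_partial i hpsi) nU) mulr0.
rewrite (@Rintegral_supp U (fun x => grad phi x 0 i * psi x)); last first.
  by move=> x nU; rewrite (Ccinf_out hpsi nU) mulr0.
rewrite (intg_byparts i hp (Ccinf_smooth hpsi)); congr (- _).
by apply: eq_intg => x; rewrite mxE mulrC.
Qed.

Lemma is_wgrad_meas U u g i : is_wgrad U u g -> measurable_on U (fun x => g x 0 i).
Proof. by move=> [_ hg _]; have [] := hg i. Qed.

Lemma Ccinf_sqr_lint U phi : Ccinf U phi -> lint (fun x => phi x ^+ 2).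
Proof. by move=> hp; apply: Ccinf_lint (Ccinf_mulr hp (Ccinf_smooth hp)). Qed.

Lemma Ccinf_W012 U phi : open U -> Ccinf U phi -> W012 U phi.
Proof.
move=> oU hp; have mU : measurable (U : set T) by exact: open_measurable_leb.
have hT := CcinfT hp.
have wg := Ccinf_wgrad oU hT.
have wg' := wgradP wg.
have ae := wgrad_ae oU wg.
split.
  split; first by exists (grad phi).
    apply: (Lp2_ae mU _ (Ccinf_sqr_lint hT)); last by apply: laeW.
    by apply/(lmeas_restrict _ mU); case: wg => -[].
  apply: (Lp2_ae mU _ (lint_grad2 hT)).
    by apply: (enorm_restrict_meas mU) => i; exact: is_wgrad_meas wg'.
  apply: lae_imp ae => x gx Ux; rewrite (gx Ux) enorm_sqr /dotv /grad2.
  by apply: ler_sum => i _; rewrite !mxE expr2.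
move=> e e0; exists phi => //.
(* A test function approximates itself. The weak gradient of the zero function is a chosen
   representative, hence zero only almost everywhere, and the norm is computed with
   [Lp2_norm_ae0]. *)
pose z x := phi x - phi x.
have hz : Ccinf setT z by apply: (Ccinf_sub hT); rewrite /z;
  [under eq_fun do rewrite subrr; exact: smooth_cst
  |apply: closureS => x /=; rewrite subrr eqxx].
have wz := Ccinf_wgrad oU hz.
have az := wgrad_ae oU wz.
have z0 : z = fun=> 0 by apply/funext => x; rewrite /z subrr.
rewrite (_ : (phi \- phi)%R = z)// /W12_norm (Lp2_norm_ae0 mU); [|by apply/(lmeas_restrict _ mU); case: wz => -[]|]; last first.
  by apply: laeW => x _; rewrite z0.
rewrite add0e (Lp2_norm_ae0 mU) ?lte_fin//.
  by apply: (enorm_restrict_meas mU) => i; exact: is_wgrad_meas (wgradP wz).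
apply: lae_imp az => x gx Ux; rewrite (gx Ux) z0.
rewrite /enorm /dotv big1 ?sqrtr0// => i _.
by rewrite !mxE partial_cst mul0r.
Qed.

Lemma two_star_gt2 : (2 < n)%N -> 2 <= two_star (R := R) (n := n).
Proof.
move=> n2; have n2' : (2 : R) < n%:R by rewrite ltr_nat.
rewrite /two_star ler_pdivlMr ?subr_gt0//; lra.
Qed.

(** On a compact set, integrability with exponent [two_star >= 2] implies square integrability,
    because [t^2 <= 1 + |t|^p] for [p >= 2]. *)
Lemma Y12loc_l2 U u K : (2 < n)%N -> open U -> Y12loc U u -> compact K -> K `<=` U ->
  l2 (u \_ K) /\ forall i, l2 ((fun x => wgrad U u x 0 i) \_ K).
Proof.
move=> n2 oU [[g wg] hY] cK KU; have wg' := wgradP wg.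
have mU : measurable (U : set T) by exact: open_measurable_leb.
have mK : measurable (K : set T) by exact: compact_measurable_leb.
have [hu hg] := hY K cK KU.
have p2 := two_star_gt2 n2.
have p0 : two_star (R := R) (n := n) != 0 by rewrite gt_eqF// (lt_le_trans _ p2).
split.
  have [mu lu] := (LpP u mK p0).1 hu.
  have [r hr] := compact_rV_bounded cK.
  have lK : lint (\1_K : Rn -> R).
    apply: lint_indic => //; apply: le_lt_trans (leb_cube_lty 0 r).
    by apply: le_lebesgue_outer => x /hr; rewrite /cube/= subr0.
  apply: (l2_dom mu (lintD lK lu)); apply: laeW => x.
  have [Kx|nK] := pselect (K x); last first.
    by rewrite restrict_out// expr0n/= normr0 addr_ge0 ?powR_ge0// indicE.
  rewrite indicE mem_set//=; set a := (u \_ K) x.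
  have [a1|a1] := leP `|a| 1.
    rewrite -[a ^+ 2]real_normK ?num_real//.
    apply: (@le_trans _ _ 1); first by rewrite expr_le1.
    by rewrite lerDl powR_ge0.
  rewrite -[a ^+ 2]real_normK ?num_real// -powR_mulrn//.
  by apply: (@le_trans _ _ (`|a| `^ two_star (R := R) (n := n))); [rewrite ler_powR// ltW|rewrite lerDr].
move=> i; have [_ hgi _] := wg'.
have /(Lp2P _ mK)[_ lg] := hg.
have mi : lmeas ((fun x => wgrad U u x 0 i) \_ K).
  exact: lmeas_restrictW mU mK KU (is_wgrad_meas i wg').
apply: (l2_dom mi lg); apply: laeW => x.
have [Kx|nK] := pselect (K x); last by rewrite !restrict_out.
by rewrite !restrict_in// enorm_sqr coord_dotv_le.
Qed.

End SquareIntegrable.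

(** * The minimum of two supersolutions *)

Section SmoothStep.
Context {R : realType}.
Implicit Types (e t a b : R).

Definition root e t : R := Num.sqrt (t ^+ 2 + e ^+ 2).
Definition step e t : R := 2^-1 * (1 + t * (root e t)^-1).
Definition dstep e t : R := 2^-1 * (e ^+ 2 * (root e t)^-1 ^+ 3).
(** A primitive of [step e]; as [e] tends to 0 it converges to the positive part [t * step0 t] of
    [t]. *)
Definition ramp e t : R := 2^-1 * (t + root e t).

(* The value at [0] is [1/2], because [0^-1 = 0]. *)
Definition step0 t : R := 2^-1 * (1 + t * `|t|^-1).

Lemma root_den e t : 0 < e -> 0 < t ^+ 2 + e ^+ 2.
Proof. by move=> e0; rewrite ltr_wpDl ?sqr_ge0// exprn_gt0. Qed.

Lemma root_gt0 e t : 0 < e -> 0 < root e t.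
Proof. by move=> e0; rewrite sqrtr_gt0 root_den. Qed.

Lemma root_sqr e t : 0 < e -> root e t ^+ 2 = t ^+ 2 + e ^+ 2.
Proof. by move=> e0; rewrite sqr_sqrtr// ltW// root_den. Qed.

Lemma norm_le_root e t : `|t| <= root e t.
Proof. by rewrite -sqrtr_sqr ler_wsqrtr// lerDl sqr_ge0. Qed.

Lemma le_root e t : 0 < e -> e <= root e t.
Proof.
by move=> e0; rewrite -[leLHS](ger0_norm (ltW e0)) -sqrtr_sqr ler_wsqrtr// lerDr sqr_ge0.
Qed.

Lemma root_le e t : 0 < e -> root e t <= `|t| + e.
Proof.
move=> e0; have h : 0 <= `|t| + e by rewrite addr_ge0// ltW.
rewrite -[leRHS](ger0_norm h) -sqrtr_sqr ler_wsqrtr//.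
rewrite sqrrD real_normK ?num_real// lerD2r lerDl; apply: mulrn_wge0; apply: mulr_ge0 => //.
exact: ltW.
Qed.

Lemma step_itv e t : 0 < e -> 0 <= step e t <= 1.
Proof.
move=> e0; have r0 := root_gt0 t e0.
have : `|t * (root e t)^-1| <= 1.
  by rewrite normrM [`|_^-1|]gtr0_norm ?invr_gt0// ler_pdivrMr// mul1r norm_le_root.
by rewrite ler_norml /step => /andP[h1 h2]; apply/andP; split; lra.
Qed.

Lemma step0_itv t : 0 <= step0 t <= 1.
Proof.
have : `|t * `|t|^-1| <= 1.
  rewrite normrM normfV normr_id; have [->|t0] := eqVneq t 0; first by rewrite normr0 mul0r.
  by rewrite mulfV// normr_eq0.
by rewrite ler_norml /step0 => /andP[h1 h2]; apply/andP; split; lra.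
Qed.

Lemma dstep_ge0 e t : 0 < e -> 0 <= dstep e t.
Proof.
move=> e0; rewrite mulr_ge0// mulr_ge0 ?sqr_ge0// exprn_ge0// invr_ge0 ltW//.
exact: root_gt0.
Qed.

Lemma dstep_le e t : 0 < e -> dstep e t <= e^-1.
Proof.
move=> e0; have r0 := root_gt0 t e0.
have h : (root e t)^-1 ^+ 3 <= e^-1 ^+ 3.
  by rewrite lerXn2r ?nnegrE ?invr_ge0 ?(ltW e0) ?(ltW r0)// lef_pV2// le_root.
have : e ^+ 2 * (root e t)^-1 ^+ 3 <= e ^+ 2 * e^-1 ^+ 3 by rewrite ler_wpM2l ?sqr_ge0.
have -> : e ^+ 2 * e^-1 ^+ 3 = e^-1 by field; rewrite gt_eqF.
have : 0 < e^-1 by rewrite invr_gt0.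
rewrite /dstep; lra.
Qed.

(** With [r = root e t], the product is half of [(t/r) (e/r)^2], and both [|t|] and [e] are at most
    [r]. *)
Lemma dstepM_le e t : 0 < e -> `|t * dstep e t| <= 1.
Proof.
move=> e0; have r0 := root_gt0 t e0.
rewrite normrM [`|dstep _ _|]ger0_norm ?dstep_ge0// /dstep.
have h1 : `|t| * (root e t)^-1 <= 1 by rewrite ler_pdivrMr// mul1r norm_le_root.
have h2 : (e * (root e t)^-1) ^+ 2 <= 1.
  rewrite expr_le1// ?ler_pdivrMr ?mul1r ?le_root//.
  by apply: mulr_ge0; [exact: ltW|rewrite invr_ge0 ltW].
have p1 : 0 <= `|t| * (root e t)^-1 by rewrite mulr_ge0// invr_ge0 ltW.
have := ler_pM p1 (sqr_ge0 _) h1 h2.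
rewrite (_ : _ * _ ^+ 2 = `|t| * (e ^+ 2 * (root e t)^-1 ^+ 3)); last by ring.
have : 0 <= `|t| * (e ^+ 2 * (root e t)^-1 ^+ 3).
  apply: mulr_ge0 => //; apply: mulr_ge0; first exact: sqr_ge0.
  by rewrite exprn_ge0// invr_ge0 ltW.
lra.
Qed.

Lemma ramp_le e t : 0 < e -> `|ramp e t| <= `|t| + e.
Proof.
move=> e0; have h1 := root_le t e0; have h2 := ler_norm t; have h3 := ler_norm (- t).
rewrite normrN in h3; have h4 := root_gt0 t e0.
by rewrite ler_norml /ramp; apply/andP; split; lra.
Qed.

Lemma continuous_comp_real (k h : R -> R) : continuous h -> continuous k ->
  continuous (fun t => k (h t)).
Proof. by move=> ch ck t; exact: continuous_comp (ch t) (ck _). Qed.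

Lemma cvg_comp_real (k : R -> R) (s : nat -> R) (l : R) : continuous k ->
  s j @[j --> \oo] --> l -> k (s j) @[j --> \oo] --> k l.
Proof. by move=> ck sl; apply: continuous_cvg => //; exact: ck. Qed.

Lemma root_continuous e : continuous (root e).
Proof.
apply: (continuous_comp_real (k := Num.sqrt)); last exact: sqrt_continuous.
by move=> t; apply: cvgD; [apply: exprn_continuous|exact: cvg_cst].
Qed.

Lemma root_inv_continuous e : 0 < e -> continuous (fun t => (root e t)^-1).
Proof.
move=> e0 t; apply: cvgV; first by rewrite gt_eqF// root_gt0.
exact: root_continuous.
Qed.

Lemma step_continuous e : 0 < e -> continuous (step e).
Proof.
move=> e0 t; apply: cvgM; first exact: cvg_cst.
apply: cvgD; first exact: cvg_cst.
by apply: cvgM; [exact: cvg_id|exact: root_inv_continuous].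
Qed.

Lemma dstep_continuous e : 0 < e -> continuous (dstep e).
Proof.
move=> e0 t; apply: cvgM; first exact: cvg_cst.
apply: cvgM; first exact: cvg_cst.
exact: (continuous_comp_real (k := fun s : R => s ^+ 3)
  (root_inv_continuous e0) (@exprn_continuous R 3)).
Qed.

Lemma ramp_continuous e : continuous (ramp e).
Proof.
move=> t; apply: cvgM; first exact: cvg_cst.
by apply: cvgD; [exact: cvg_id|exact: root_continuous].
Qed.

Lemma root_cvg t : root k.+1%:R^-1 t @[k --> \oo] --> `|t|.
Proof.
rewrite -[`|t|]sqrtr_sqr.
apply: (cvg_comp_real (k := Num.sqrt)); first exact: sqrt_continuous.
rewrite -[X in _ --> X]addr0; apply: cvgD; first exact: cvg_cst.
rewrite -[X in _ --> X](expr0n R 2).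
apply: (cvg_comp_real (k := fun s : R => s ^+ 2)); first exact: exprn_continuous.
exact: cvg_harmonic.
Qed.

Lemma step_cvg t : step k.+1%:R^-1 t @[k --> \oo] --> step0 t.
Proof.
apply: cvgM; first exact: cvg_cst.
apply: cvgD; first exact: cvg_cst.
have [->|t0] := eqVneq t 0.
  by rewrite mul0r; under eq_fun do rewrite mul0r; exact: cvg_cst.
apply: cvgM; first exact: cvg_cst.
by apply: cvgV; [rewrite normr_eq0|exact: root_cvg].
Qed.

Lemma ramp_cvg t : ramp k.+1%:R^-1 t @[k --> \oo] --> t * step0 t.
Proof.
have -> : t * step0 t = 2^-1 * (t + `|t|).
  rewrite /step0; have [->|t0] := eqVneq t 0; first by rewrite normr0 mul0r addr0 mulr0.
  have n0 : `|t| != 0 by rewrite normr_eq0.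
  have e : t * t = `|t| * `|t| by rewrite -!expr2 real_normK ?num_real.
  by rewrite mulrCA mulrDr mulr1 mulrA e mulfK.
apply: cvgM; first exact: cvg_cst.
by apply: cvgD; [exact: cvg_cst|exact: root_cvg].
Qed.

Lemma dstepM_cvg t : t * dstep k.+1%:R^-1 t @[k --> \oo] --> 0.
Proof.
have [->|t0] := eqVneq t 0.
  by under eq_fun do rewrite mul0r; exact: cvg_cst.
have -> : 0 = t * (2^-1 * (0 ^+ 2 * `|t|^-1 ^+ 3)) by rewrite expr0n/= mul0r !mulr0.
apply: cvgM; first exact: cvg_cst.
apply: cvgM; first exact: cvg_cst.
apply: cvgM.
  apply: (cvg_comp_real (k := fun s : R => s ^+ 2)); first exact: exprn_continuous.
  exact: cvg_harmonic.
apply: (cvg_comp_real (k := fun s : R => s ^+ 3)); first exact: exprn_continuous.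
by apply: cvgV; [rewrite normr_eq0|exact: root_cvg].
Qed.

Lemma min_step0 a b : Num.min a b = step0 (b - a) * a + (1 - step0 (b - a)) * b.
Proof.
rewrite /step0; have [h|h|->] := ltgtP a b; last by rewrite subrr mul0r; lra.
- have h0 : 0 < b - a by rewrite subr_gt0.
  by rewrite (gtr0_norm h0) mulfV ?gt_eqF//; lra.
- have h0 : b - a < 0 by rewrite subr_lt0.
  by rewrite (ltr0_norm h0) invrN mulrN mulfV ?lt_eqF//; lra.
Qed.

End SmoothStep.

Section StepComposition.
Context {R : realType} {n : nat}.
Local Notation Rn := 'rV[R]_n.
Implicit Types (f : Rn -> R) (e : R).

Lemma smooth_root e f : 0 < e -> smooth f -> smooth (fun x => root e (f x)).
Proof.
move=> e0 sf; apply: smooth_sqrt; first by move=> x; exact: root_den.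
by apply: smoothD; [exact: smoothX|exact: smooth_cst].
Qed.

Lemma smooth_rootV e f : 0 < e -> smooth f -> smooth (fun x => (root e (f x))^-1).
Proof.
by move=> e0 sf; apply: smoothV; [move=> x; rewrite gt_eqF// root_gt0|exact: smooth_root].
Qed.

Lemma partial_root e f i : 0 < e -> smooth f ->
  partial i (fun x => root e (f x)) = (fun x => (root e (f x))^-1 * f x * partial i f x).
Proof.
move=> e0 sf; have q0 x : 0 < f x ^+ 2 + e ^+ 2 by exact: root_den.
have D := @smooth_diff R n.
have sq : smooth (fun x => f x * f x + e ^+ 2).
  by apply: smoothD; [exact: smoothM|exact: smooth_cst].
rewrite (partial_sqrt i q0 (D _ sq)).2.
rewrite (partialD i (D _ (smoothM sf sf)) (D _ (smooth_cst (e ^+ 2)))) partial_cst.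
rewrite (partialM i (D _ sf) (D _ sf)); apply/funext => x.
rewrite -/(root e (f x)); have := root_gt0 (f x) e0; set s := root _ _ => s0.
by field; rewrite gt_eqF.
Qed.

Lemma smooth_step e f : 0 < e -> smooth f -> smooth (fun x => step e (f x)).
Proof.
move=> e0 sf; apply: smoothM; first exact: smooth_cst.
apply: smoothD; first exact: smooth_cst.
by apply: smoothM => //; exact: smooth_rootV.
Qed.

Lemma smooth_ramp e f : 0 < e -> smooth f -> smooth (fun x => ramp e (f x)).
Proof.
move=> e0 sf; apply: smoothM; first exact: smooth_cst.
by apply: smoothD => //; exact: smooth_root.
Qed.

Lemma partial_step e f i x : 0 < e -> smooth f ->
  partial i (fun x => step e (f x)) x = dstep e (f x) * partial i f x.
Proof.
move=> e0 sf; have sr := smooth_root e0 sf; have sv := smooth_rootV e0 sf.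
have pr := partial_root i e0 sf.
have D := @smooth_diff R n.
have r0 y : root e (f y) != 0 by rewrite gt_eqF// root_gt0.
have s1 : smooth (fun x => f x * (root e (f x))^-1) by exact: smoothM.
have s2 : smooth (fun x => 1 + f x * (root e (f x))^-1).
  by apply: smoothD => //; exact: smooth_cst.
rewrite /step (partialM i (D _ (smooth_cst 2^-1)) (D _ s2)) partial_cst.
rewrite (partialD i (D _ (smooth_cst 1)) (D _ s1)) partial_cst.
rewrite (partialM i (D _ sf) (D _ sv)) (partialV i r0 (D _ sr)).2 pr /dstep.
have := root_sqr (f x) e0; have := r0 x; set s := root _ _ => s0 hs.
have -> : e ^+ 2 = s ^+ 2 - f x ^+ 2 by rewrite hs; ring.
by field.
Qed.

Lemma partial_ramp e f i x : 0 < e -> smooth f ->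
  partial i (fun x => ramp e (f x)) x = step e (f x) * partial i f x.
Proof.
move=> e0 sf; have sr := smooth_root e0 sf; have sv := smooth_rootV e0 sf.
have pr := partial_root i e0 sf.
have D := @smooth_diff R n.
have s2 : smooth (fun x => f x + root e (f x)) by exact: smoothD.
rewrite /ramp (partialM i (D _ (smooth_cst 2^-1)) (D _ s2)) partial_cst.
rewrite (partialD i (D _ sf) (D _ sr)) pr /step; ring.
Qed.

Lemma lmeas_step e f : 0 < e -> lmeas f -> lmeas (fun x => step e (f x)).
Proof. by move=> e0; apply: lmeas_comp; exact: step_continuous. Qed.

Lemma lmeas_step0 f : lmeas f -> lmeas (fun x => step0 (f x)).
Proof.
move=> mf; apply: (@lmeas_cvg _ _ (fun k x => step k.+1%:R^-1 (f x))).
  by move=> k; exact: lmeas_step.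
by move=> x; exact: step_cvg.
Qed.

End StepComposition.

(** * Limits in the smooth approximation and in the step *)

Section PassingToTheLimit.
Context {R : realType} {n : nat}.
Local Notation Rn := 'rV[R]_n.
Local Notation T := (lebRn R n).
Implicit Types (f h u v w phi psi G : Rn -> R) (x y z : Rn) (K U : set Rn) (e : R).

Lemma lint_compact K : compact K -> lint (\1_K : Rn -> R).
Proof.
move=> cK; have [r hr] := compact_rV_bounded cK.
apply: lint_indic; first exact: compact_measurable_leb.
apply: le_lt_trans (leb_cube_lty 0 r).
by apply: le_lebesgue_outer => x /hr; rewrite /cube/= subr0.
Qed.

Lemma intg_test_dct K psi (F : nat -> Rn -> R) f h : Ccinf K psi ->
  (forall k, lmeas (F k)) -> lmeas f ->
  lae (fun x => K x -> F k x @[k --> \oo] --> f x) ->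
  lint h -> lae (fun x => K x -> forall k, `|F k x| <= h x) ->
  lint (fun x => f x * psi x) /\
  intg (fun x => F k x * psi x) @[k --> \oo] --> intg (fun x => f x * psi x).
Proof.
move=> hp mF mf Ff lh Fh; have [B B0 hB] := Ccinf_bounded hp.
have mp : lmeas psi by exact/lmeas_cont/(Ccinf_cont hp).
apply: (@intg_dct _ _ _ _ (fun x => B * `|h x|)).
- by move=> k; exact: lmeasM.
- exact: lmeasM.
- apply: lae_imp Ff => x Fx; have [Kx|nK] := pselect (K x).
    by apply: cvgM; [exact: Fx|exact: cvg_cst].
  rewrite (Ccinf_out hp nK) mulr0; under eq_fun do rewrite mulr0; exact: cvg_cst.
- exact/lintZ/lint_norm.
move=> k; apply: lae_imp Fh => x Fx; have [Kx|nK] := pselect (K x).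
  rewrite normrM mulrC ler_pM//; apply: le_trans (Fx Kx k) _; exact: ler_norm.
by rewrite (Ccinf_out hp nK) mulr0 normr0 mulr_ge0.
Qed.

Record smooth_approx K w (g : 'I_n -> Rn -> R) (W : nat -> Rn -> R) G := SmoothApprox {
  approx_smooth : forall j, smooth (W j);
  approx_cvg : lae (fun x => K x -> W j x @[j --> \oo] --> w x);
  approx_partial : forall i, lae (fun x => K x -> partial i (W j) x @[j --> \oo] --> g i x);
  approx_lint : lint G;
  approx_dom : lae (fun x => K x -> forall j, W j x ^+ 2 <= G x /\
    forall i, partial i (W j) x ^+ 2 <= G x) }.

Lemma le1sqr (t a : R) : t ^+ 2 <= a -> `|t| <= 1 + a.
Proof.
move=> ta; have := sqr_ge0 (`|t| - 1); have := real_normK (num_real t); have := sqr_ge0 t.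
nra.
Qed.

(** The weak chain rule for the positive part of [w]. It holds for [ramp e] of the smooth
    approximations; first the approximations converge for fixed [e], then [e] tends to 0 along
    [1/(k+1)], dominated by squares of [w] and of its gradient. *)
Lemma ramp_byparts K w g psi i : compact K -> lmeas w -> (forall i, l2 (g i)) -> l2 w ->
  (exists W G, smooth_approx K w g W G) -> Ccinf K psi ->
  [/\ lint (fun x => w x * step0 (w x) * partial i psi x),
      lint (fun x => step0 (w x) * g i x * psi x) &
  intg (fun x => w x * step0 (w x) * partial i psi x) =
  - intg (fun x => step0 (w x) * g i x * psi x)].
Proof.
move=> cK mw hg hw [W [G [sW Ww Wg lG WG]]] hp.
have hpp := Ccinf_partial i hp.
have lK := lint_compact cK.
have mW j : lmeas (W j) by exact/lmeas_cont/smooth_continuous.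
have mWi j : lmeas (partial i (W j)) by exact/lmeas_cont/smooth_continuous/smooth_partial.
have mg : lmeas (g i) := (hg i).1.
have ones (t : R) s : 0 <= s <= 1 -> `|s * t| <= 1 + t ^+ 2.
  move=> /andP[s0 s1]; rewrite normrM (ger0_norm s0).
  by apply: le_trans (le1sqr (lexx (t ^+ 2))); rewrite -[leRHS]mul1r ler_wpM2r.
have step_e e : 0 < e ->
  intg (fun x => ramp e (w x) * partial i psi x) = - intg (fun x => step e (w x) * g i x * psi x).
  move=> e0.
  have c1 : intg (fun x => ramp e (W j x) * partial i psi x) @[j --> \oo] -->
      intg (fun x => ramp e (w x) * partial i psi x).
    have [] // := @intg_test_dct K (partial i psi) (fun j x => ramp e (W j x))
      (fun x => ramp e (w x)) (fun x => (1 + e) * \1_K x + G x) hpp _ _ _ _ _.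
    - by move=> j; exact: lmeas_comp (@ramp_continuous R e) (mW j).
    - exact: lmeas_comp (@ramp_continuous R e) mw.
    - apply: lae_imp Ww => x h Kx; exact: cvg_comp_real (@ramp_continuous R e) (h Kx).
    - by apply: lintD => //; exact: lintZ.
    - apply: lae_imp WG => x h Kx j; have [h1 _] := h Kx j; rewrite indicE mem_set// mulr1.
      by have := ramp_le (W j x) e0; have := le1sqr h1; lra.
  have c2 : intg (fun x => step e (W j x) * partial i (W j) x * psi x) @[j --> \oo] -->
      intg (fun x => step e (w x) * g i x * psi x).
    have [] // := @intg_test_dct K psi (fun j x => step e (W j x) * partial i (W j) x)
      (fun x => step e (w x) * g i x) (fun x => \1_K x + G x) hp _ _ _ _ _.
    - by move=> j; apply: lmeasM => //; exact: lmeas_step.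
    - by apply: lmeasM => //; exact: lmeas_step.
    - apply: lae_imp2 Ww (Wg i) => x h h' Kx.
      by apply: cvgM; [exact: cvg_comp_real (step_continuous e0) (h Kx)|exact: h'].
    - exact: lintD.
    - apply: lae_imp WG => x h Kx j; have [_ /(_ i) h1] := h Kx j; rewrite indicE mem_set//.
      by apply: le_trans (ones _ _ (step_itv (W j x) e0)) _; rewrite lerD2l.
  have ee : (fun j => intg (fun x => ramp e (W j x) * partial i psi x)) =
            (fun j => - intg (fun x => step e (W j x) * partial i (W j) x * psi x)).
    apply/funext => j; rewrite -[LHS]opprK; congr (- _).
    rewrite -(intg_byparts i (CcinfT hp) (smooth_ramp e0 (sW j))).
    by apply: eq_intg => x; rewrite (partial_ramp i x e0 (sW j)) mulrC.
  rewrite -(cvg_lim (@norm_hausdorff _ R^o) c1) ee.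
  exact: (cvg_lim (@norm_hausdorff _ R^o) (cvgN c2)).
have e0 k : (0 : R) < k.+1%:R^-1 by rewrite invr_gt0.
have e1 k : (k.+1%:R^-1 : R) <= 1 by rewrite invf_le1 ?ler1n.
have [l1 c1] : lint (fun x => w x * step0 (w x) * partial i psi x) /\
    intg (fun x => ramp k.+1%:R^-1 (w x) * partial i psi x) @[k --> \oo] -->
    intg (fun x => w x * step0 (w x) * partial i psi x).
  apply: (@intg_test_dct K (partial i psi) (fun k x => ramp k.+1%:R^-1 (w x))
    (fun x => w x * step0 (w x)) (fun x => 2 * \1_K x + w x ^+ 2) hpp).
  - by move=> k; exact: lmeas_comp (@ramp_continuous R _) mw.
  - by apply: lmeasM => //; exact: lmeas_step0.
  - by apply: laeW => x _; exact: ramp_cvg.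
  - by apply: lintD; [exact: lintZ|exact: hw.2].
  - apply: laeW => x Kx k; rewrite indicE mem_set// mulr1.
    move: (e0 k) (e1 k); move: (k.+1%:R^-1) => d d0 d1.
    by have := ramp_le (w x) d0; have := le1sqr (lexx (w x ^+ 2)); lra.
have [l2 c2] : lint (fun x => step0 (w x) * g i x * psi x) /\
    intg (fun x => step k.+1%:R^-1 (w x) * g i x * psi x) @[k --> \oo] -->
    intg (fun x => step0 (w x) * g i x * psi x).
  apply: (@intg_test_dct K psi (fun k x => step k.+1%:R^-1 (w x) * g i x)
    (fun x => step0 (w x) * g i x) (fun x => \1_K x + g i x ^+ 2) hp).
  - by move=> k; apply: lmeasM => //; exact: lmeas_step.
  - by apply: lmeasM => //; exact: lmeas_step0.
  - by apply: laeW => x _; apply: cvgM; [exact: step_cvg|exact: cvg_cst].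
  - by apply: lintD => //; exact: (hg i).2.
  - by apply: laeW => x Kx k; rewrite indicE mem_set//; exact: ones (step_itv (w x) (e0 k)).
split => //; have e k := step_e _ (e0 k).
rewrite -(cvg_lim (@norm_hausdorff _ R^o) c1); under eq_fun do rewrite e.
exact: (cvg_lim (@norm_hausdorff _ R^o) (cvgN c2)).
Qed.

Lemma cvg_sum_fin (I : finType) (F : I -> nat -> R) (l : I -> R) :
  (forall i, F i k @[k --> \oo] --> l i) ->
  \sum_i F i k @[k --> \oo] --> \sum_i l i.
Proof.
move=> Fl; elim: (index_enum I) => [|i s ih].
  by rewrite big_nil; under eq_fun do rewrite big_nil; exact: cvg_cst.
by rewrite big_cons; under eq_fun do rewrite big_cons; apply: cvgD.
Qed.

(** The integrand of the bilinear form, with [f] the flux tested by the gradient and [q] the terms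
    tested by [psi] itself. In this shape the comparison is independent of the operator. *)
Definition form (f : 'I_n -> Rn -> R) (q : Rn -> R) psi x : R :=
  \sum_(i < n) f i x * partial i psi x - q x * psi x.

Lemma form_lint K (f : 'I_n -> Rn -> R) q psi : (forall i, l2 (f i)) -> lint q -> Ccinf K psi ->
  lint (form f q psi).
Proof.
move=> hf lq hp; apply: lintB; last exact: lint_Ccinf hp.
apply: lint_sum => i; apply: l2M => //.
have hpp := Ccinf_partial i hp; split; first exact/lmeas_cont/(Ccinf_cont hpp).
exact: Ccinf_sqr_lint hpp.
Qed.

Lemma form_out K (f : 'I_n -> Rn -> R) q psi x : Ccinf K psi -> ~ K x -> form f q psi x = 0.
Proof.
move=> hp nK; rewrite /form (Ccinf_out hp nK) mulr0 subr0 big1// => i _.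
by rewrite (Ccinf_out (Ccinf_partial i hp) nK) mulr0.
Qed.

(** The product rule: the two cutoffs sum to 1, so their gradients are opposite, and what falls on
    the step is the difference of the fluxes paired with the gradient of [W]. *)
Lemma form_step (fu fv : 'I_n -> Rn -> R) qu qv phi W e x : 0 < e -> smooth phi -> smooth W ->
  form fu qu (fun y => phi y * step e (W y)) x +
  form fv qv (fun y => phi y * (1 - step e (W y))) x =
  step e (W x) * form fu qu phi x + (1 - step e (W x)) * form fv qv phi x
  - phi x * dstep e (W x) * \sum_(i < n) (fv i x - fu i x) * partial i W x.
Proof.
move=> e0 sp sW; have D := @smooth_diff R n; have ss := smooth_step e0 sW.
have s1 : smooth (fun y => 1 - step e (W y)) by apply: smoothB => //; exact: smooth_cst.
have p1 i : partial i (fun y => phi y * step e (W y)) x =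
    phi x * (dstep e (W x) * partial i W x) + step e (W x) * partial i phi x.
  by rewrite (partialM i (D _ sp) (D _ ss)) partial_step.
have p2 i : partial i (fun y => phi y * (1 - step e (W y))) x =
    - (phi x * (dstep e (W x) * partial i W x)) + (1 - step e (W x)) * partial i phi x.
  rewrite (partialM i (D _ sp) (D _ s1)) (partialD i (D _ (smooth_cst 1)) (D _ (smoothN ss))).
  by rewrite partial_cst (partialN i (D _ ss)) partial_step// add0r mulrN.
have e1 : \sum_(i < n) fu i x * partial i (fun y => phi y * step e (W y)) x =
    phi x * dstep e (W x) * (\sum_(i < n) fu i x * partial i W x) +
    step e (W x) * \sum_(i < n) fu i x * partial i phi x.
  by rewrite !mulr_sumr -big_split/=; apply: eq_bigr => i _; rewrite p1; ring.
have e2 : \sum_(i < n) fv i x * partial i (fun y => phi y * (1 - step e (W y))) x =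
    - (phi x * dstep e (W x) * (\sum_(i < n) fv i x * partial i W x)) +
    (1 - step e (W x)) * \sum_(i < n) fv i x * partial i phi x.
  rewrite !mulr_sumr -sumrN -big_split/=; apply: eq_bigr => i _; rewrite p2; ring.
have e3 : \sum_(i < n) (fv i x - fu i x) * partial i W x =
    \sum_(i < n) fv i x * partial i W x - \sum_(i < n) fu i x * partial i W x.
  by rewrite -sumrB; apply: eq_bigr => i _; rewrite mulrBl.
rewrite /form e1 e2 e3; ring.
Qed.

(** Here [F0] stands for [F phi]. The pointwise inequality is what ellipticity gives for
    [fv - fu = A grad w + w b], with [g] for [grad w]: the quadratic part is nonnegative and is
    dropped. It is used between the two limits. *)
Lemma form_comparison K phi w (g fu fv b : 'I_n -> Rn -> R) qu qv (F0 : R) :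
  compact K -> Ccinf K phi -> (forall x, 0 <= phi x) -> l2 w ->
  (forall i, [/\ l2 (g i), l2 (fu i), l2 (fv i) & l2 (b i)]) -> lint qu -> lint qv ->
  (exists W G, smooth_approx K w g W G) ->
  lae (fun x => K x -> w x * (\sum_(i < n) b i x * g i x) <=
     \sum_(i < n) (fv i x - fu i x) * g i x) ->
  (forall psi psi', Ccinf K psi -> Ccinf K psi' -> (forall x, 0 <= psi x) ->
     (forall x, 0 <= psi' x) -> (forall x, psi x + psi' x = phi x) ->
     F0 <= intg (form fu qu psi) + intg (form fv qv psi')) ->
  F0 <= intg (fun x => step0 (w x) * form fu qu phi x + (1 - step0 (w x)) * form fv qv phi x).
Proof.
move=> cK hp p0 hw hb lqu lqv [W [G [sW Ww Wg lG WG]]] hell hF.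
have sp := Ccinf_smooth hp.
have hg i : l2 (g i) by have [] := hb i.
have hfu i : l2 (fu i) by have [] := hb i.
have hfv i : l2 (fv i) by have [] := hb i.
have hbi i : l2 (b i) by have [] := hb i.
have [B B0 hB] := Ccinf_bounded hp.
have mp : lmeas phi by exact/lmeas_cont/smooth_continuous.
have mW j : lmeas (W j) by exact/lmeas_cont/smooth_continuous.
have mWi i j : lmeas (partial i (W j)) by exact/lmeas_cont/smooth_continuous/smooth_partial.
have mg i : lmeas (g i) := (hg i).1.
have mw : lmeas w := hw.1.
have mone : lmeas (fun=> 1 : R) := lmeas_cst 1.
pose X := form fu qu phi; pose Y := form fv qv phi.
have lX : lint X := form_lint hfu lqu hp.
have lY : lint Y := form_lint hfv lqv hp.
have mX := lint_meas lX; have mY := lint_meas lY.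
have X0 x : ~ K x -> X x = 0 by exact: form_out hp.
have Y0 x : ~ K x -> Y x = 0 by exact: form_out hp.
have phi0 x : ~ K x -> phi x = 0 by exact: Ccinf_out hp.
pose df i x := fv i x - fu i x.
have hdf i : l2 (df i) by exact: l2B.
have mS (s : Rn -> R) : lmeas s -> lmeas (fun x => s x * X x + (1 - s x) * Y x).
  by move=> ms; apply: lmeasD; apply: lmeasM => //; exact: lmeasB.
have bS (s a c : R) : 0 <= s <= 1 -> `|s * a + (1 - s) * c| <= `|a| + `|c|.
  move=> /andP[s0 s1]; apply: le_trans (ler_normD _ _) _; rewrite !normrM.
  rewrite (ger0_norm s0) [`|1 - s|]ger0_norm ?subr_ge0//.
  have := normr_ge0 a; have := normr_ge0 c; nra.
(* The limit in [j] for fixed [e]. The factor [dstep e] is bounded by [1/e], and each product of a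
   flux difference with a derivative of [W_j] by a square plus [G]. *)
have key e : 0 < e ->
   lint (fun x => step e (w x) * X x + (1 - step e (w x)) * Y x
      - phi x * dstep e (w x) * \sum_(i < n) df i x * g i x) /\
   F0 <= intg (fun x => step e (w x) * X x + (1 - step e (w x)) * Y x
      - phi x * dstep e (w x) * \sum_(i < n) df i x * g i x).
  move=> e0.
  pose Phi j x := step e (W j x) * X x + (1 - step e (W j x)) * Y x
    - phi x * dstep e (W j x) * \sum_(i < n) df i x * partial i (W j) x.
  have lbd : lint (fun x => `|X x| + `|Y x| + B * e^-1 * \sum_(i < n) (df i x ^+ 2 + `|G x|)).
    apply: lintD; first by apply: lintD; exact: lint_norm.
    by apply: lintZ; apply: lint_sum => i; apply: lintD; [exact: (hdf i).2|exact: lint_norm].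
  have [] // := @intg_dct R n Phi (fun x => step e (w x) * X x + (1 - step e (w x)) * Y x
      - phi x * dstep e (w x) * \sum_(i < n) df i x * g i x) _ _ _ _ lbd _.
  - move=> j; apply: lmeasB; first exact/mS/lmeas_step.
    apply: lmeasM; first by apply: lmeasM => //; exact: lmeas_comp (dstep_continuous e0) _.
    by apply: lmeas_sum => i; apply: lmeasM => //; exact: (hdf i).1.
  - apply: lmeasB; first exact/mS/lmeas_step.
    apply: lmeasM; first by apply: lmeasM => //; exact: lmeas_comp (dstep_continuous e0) _.
    by apply: lmeas_sum => i; apply: lmeasM => //; exact: (hdf i).1.
  - apply: lae_imp2 Ww (lae_fin Wg) => x Wx Wgx; have [Kx|nK] := pselect (K x); last first.
      rewrite /Phi (X0 x nK) (Y0 x nK) (phi0 x nK) !mulr0 !mul0r.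
      by under eq_fun do rewrite !mulr0 !mul0r; exact: cvg_cst.
    have cs := cvg_comp_real (step_continuous e0) (Wx Kx).
    have cd := cvg_comp_real (dstep_continuous e0) (Wx Kx).
    apply: cvgB.
      apply: cvgD; first by apply: cvgM; [exact: cs|exact: cvg_cst].
      apply: cvgM; last exact: cvg_cst.
      by apply: cvgB; [exact: cvg_cst|exact: cs].
    apply: cvgM; first by apply: cvgM; [exact: cvg_cst|exact: cd].
    apply: cvg_sum_fin => i; apply: cvgM; first exact: cvg_cst.
    exact: Wgx.
  - move=> j; apply: lae_imp WG => x Gx.
    apply: le_trans (ler_normB _ _) _; apply: lerD; first by apply: bS; exact: step_itv.
    have S0 : 0 <= \sum_(i < n) (df i x ^+ 2 + `|G x|).
      by apply: sumr_ge0 => i _; rewrite addr_ge0// sqr_ge0.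
    have [Kx|nK] := pselect (K x); last first.
      by rewrite (phi0 x nK) !mul0r normr0 !mulr_ge0// invr_ge0 ltW.
    rewrite [leLHS]normrM [`|phi x * _|]normrM; apply: ler_pM => //.
      by apply: ler_pM => //; rewrite ger0_norm; [exact: dstep_le|exact: dstep_ge0].
    apply: le_trans (ler_norm_sum _ _ _) _; apply: ler_sum => i _.
    have [_ /(_ i) h] := Gx Kx j; have := ler_norm (G x).
    move: h; set p := partial i (W j) x; set q := df i x => h hG.
    rewrite ler_norml; have h1 := sqr_ge0 (p + q); have h2 := sqr_ge0 (p - q).
    by have := sqr_ge0 q; have := sqr_ge0 p; move=> *; apply/andP; split; nra.
  move=> lPhi cPhi; split => //; apply: (cvgr_to_ge cPhi); apply: nearW => j.
  have ss := smooth_step e0 (sW j).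
  have hs1 : Ccinf K (fun y => phi y * step e (W j y)) := Ccinf_mulr hp ss.
  have hs2 : Ccinf K (fun y => phi y * (1 - step e (W j y))).
    by apply: Ccinf_mulr hp _; apply: smoothB => //; exact: smooth_cst.
  have := hF _ _ hs1 hs2 _ _ _; rewrite -intgD; [|exact: form_lint hs1|exact: form_lint hs2].
  move=> h; apply: (le_trans (h _ _ _)).
  - by move=> x; rewrite mulr_ge0//; have /andP[] := step_itv (W j x) e0.
  - by move=> x; rewrite mulr_ge0// subr_ge0; have /andP[] := step_itv (W j x) e0.
  - by move=> x; ring.
  rewrite le_eqVlt; apply/orP; left; apply/eqP; apply: eq_intg => x.
  by rewrite form_step.
pose bg x := \sum_(i < n) b i x * g i x.
have lbg : lint bg by apply: lint_sum => i; exact: l2M.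
have mbg := lint_meas lbg.
(* Once the quadratic part is gone, the step enters through [w * dstep e w], which is bounded by 1;
   the dominating function below therefore no longer depends on [e]. *)
pose Psi e x := step e (w x) * X x + (1 - step e (w x)) * Y x - phi x * (w x * dstep e (w x)) * bg x.
have e0 k : (0 : R) < k.+1%:R^-1 by rewrite invr_gt0.
have mPsi k : lmeas (Psi k.+1%:R^-1).
  apply: lmeasB; first exact/mS/lmeas_step.
  apply: lmeasM => //; apply: lmeasM => //; apply: lmeasM => //.
  exact: lmeas_comp (dstep_continuous (e0 k)) _.
have lbd : lint (fun x => `|X x| + `|Y x| + B * `|bg x|).
  by apply: lintD; [apply: lintD; exact: lint_norm|exact/lintZ/lint_norm].
have dPsi k x : `|Psi k.+1%:R^-1 x| <= `|X x| + `|Y x| + B * `|bg x|.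
  apply: le_trans (ler_normB _ _) _; apply: lerD; first exact/bS/step_itv.
  rewrite normrM ler_wpM2r// normrM -[leRHS]mulr1 ler_pM//.
  exact: dstepM_le.
have lPsi k : lint (Psi k.+1%:R^-1) by apply: (lint_dom (mPsi k) lbd); exact: laeW.
have FPsi k : F0 <= intg (Psi k.+1%:R^-1).
  have [lk Fk] := key _ (e0 k); apply: (le_trans Fk); apply: le_intg => //.
  apply: lae_imp hell => x hx; rewrite /Psi lerD2l lerN2.
  have [Kx|nK] := pselect (K x); last by rewrite (phi0 x nK) !mul0r.
  have := hx Kx; rewrite -/(bg x) => h.
  rewrite (_ : _ * bg x = phi x * dstep k.+1%:R^-1 (w x) * (w x * bg x)); last by ring.
  by rewrite ler_wpM2l// mulr_ge0// dstep_ge0.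
have [] // := @intg_dct R n (fun k => Psi k.+1%:R^-1)
    (fun x => step0 (w x) * X x + (1 - step0 (w x)) * Y x) _ mPsi _ _ lbd _.
- exact/mS/lmeas_step0.
- apply: laeW => x; rewrite -[X in _ --> X]subr0; apply: cvgB.
    apply: cvgD; first by apply: cvgM; [exact: step_cvg|exact: cvg_cst].
    apply: cvgM; last exact: cvg_cst.
    by apply: cvgB; [exact: cvg_cst|exact: step_cvg].
  have -> : 0 = phi x * 0 * bg x by rewrite mulr0 mul0r.
  apply: cvgM; last exact: cvg_cst.
  by apply: cvgM; [exact: cvg_cst|exact: dstepM_cvg].
- by move=> k; exact: laeW.
by move=> _ c; apply: (cvgr_to_ge c); apply: nearW.
Qed.

End PassingToTheLimit.

(** * The minimum as a Sobolev function *)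

Section Minimum.
Context {R : realType} {n : nat}.
Local Notation Rn := 'rV[R]_n.
Local Notation T := (lebRn R n).
Implicit Types (f h u v w phi psi : Rn -> R) (g gu gv : Rn -> Rn) (x y z : Rn) (K U : set Rn).

Lemma restrictB f h K : (fun x => f x - h x) \_ K = (fun x => (f \_ K) x - (h \_ K) x).
Proof. by apply/funext => x; rewrite !restrictE mulrBl. Qed.

Lemma Ccinf_closure U phi : Ccinf U phi -> exists K, [/\ compact K, K `<=` U & Ccinf K phi].
Proof.
by move=> [s c i]; exists (closure [set x | phi x != 0]); split => //; split => // x.
Qed.

Lemma L1loc_dom U f f1 f2 : open U -> measurable_on U f -> L1loc U f1 -> L1loc U f2 ->
  (forall x, U x -> `|f x| <= `|f1 x| + `|f2 x|) -> L1loc U f.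
Proof.
move=> oU mf hg hh fgh; have mU : measurable (U : set T) by exact: open_measurable_leb.
split => // K cK KU; have mK : measurable (K : set T) by exact: compact_measurable_leb.
have lg := L1loc_lint hg cK KU; have lh := L1loc_lint hh cK KU.
apply/(Lp1P _ mK); apply: (lint_dom _ (lintD (lint_norm lg) (lint_norm lh))).
  exact: lmeas_restrictW mU mK KU mf.
apply: laeW => x; have [Kx|nK] := pselect (K x).
  by rewrite !restrict_in//; exact/fgh/KU.
by rewrite !restrict_out// normr0 addr0.
Qed.

Lemma measurable_onB U f h : measurable (U : set T) -> measurable_on U f -> measurable_on U h ->
  measurable_on U (fun x => f x - h x).
Proof.
move=> mU mf mh; apply/(lmeas_restrict _ mU); rewrite restrictB.
by apply: lmeasB; exact/(lmeas_restrict _ mU).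
Qed.

Lemma L1locB U f h : open U -> L1loc U f -> L1loc U h -> L1loc U (fun x => f x - h x).
Proof.
move=> oU hf hh; apply: (L1loc_dom oU _ hf hh); last by move=> x _; exact: ler_normB.
by apply: measurable_onB; [exact: open_measurable_leb|exact: hf.1|exact: hh.1].
Qed.

Lemma lint_L1loc_test U K f psi : L1loc U f -> compact K -> K `<=` U -> Ccinf K psi ->
  lint (fun x => (f \_ K) x * psi x).
Proof. by move=> hf cK KU hp; apply: lint_Ccinf hp; exact: L1loc_lint hf cK KU. Qed.

Lemma is_wgradB U u v gu gv : open U -> is_wgrad U u gu -> is_wgrad U v gv ->
  is_wgrad U (fun x => v x - u x) (fun x => gv x - gu x).
Proof.
move=> oU [hu hgu wu] [hv hgv wv]; have eg i : (fun x => (gv x - gu x) 0 i) = (fun x => gv x 0 i - gu x 0 i).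
  by apply/funext => x; rewrite !mxE.
split; first exact: L1locB.
  by move=> i; rewrite eg; exact: L1locB.
move=> phi i hp; have [K [cK KU hK]] := Ccinf_closure hp.
have hpp := Ccinf_partial i hK.
rewrite (@intg_test _ _ K U (fun x => v x - u x) _ KU hpp).
rewrite (@intg_test _ _ K U (fun x => (gv x - gu x) 0 i) _ KU hK) eg !restrictB.
have e (f h psi : Rn -> R) : (fun x => (f x - h x) * psi x) = (fun x => f x * psi x - h x * psi x).
  by apply/funext => x; rewrite mulrBl.
rewrite !e !intgB; [|exact: (lint_L1loc_test (hgv i) cK KU hK)
  |exact: (lint_L1loc_test (hgu i) cK KU hK)
  |exact: (lint_L1loc_test hv cK KU hpp)|exact: (lint_L1loc_test hu cK KU hpp)].
have := wv _ i hp; have := wu _ i hp.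
rewrite (@intg_test _ _ K U u _ KU hpp) (@intg_test _ _ K U v _ KU hpp).
rewrite (@intg_test _ _ K U (fun x => gu x 0 i) _ KU hK).
rewrite (@intg_test _ _ K U (fun x => gv x 0 i) _ KU hK) => -> ->.
by rewrite opprB opprK addrC.
Qed.

Definition l2loc U u g := forall K, compact K -> K `<=` U ->
  l2 (u \_ K) /\ forall i, l2 ((fun x => g x 0 i) \_ K).

Lemma l2locB U u v gu gv : l2loc U u gu -> l2loc U v gv ->
  l2loc U (fun x => v x - u x) (fun x => gv x - gu x).
Proof.
move=> hu hv K cK KU; have [u2 gu2] := hu K cK KU; have [v2 gv2] := hv K cK KU.
split; first by rewrite restrictB; exact: l2B.
move=> i; rewrite (_ : (fun x => (gv x - gu x) 0 i) = (fun x => gv x 0 i - gu x 0 i)).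
  by rewrite restrictB; exact: l2B.
by apply/funext => x; rewrite !mxE.
Qed.

Lemma l2loc_lint U u g : l2loc U u g -> forall K', compact K' -> K' `<=` U ->
  lint (fun x => (u \_ K') x ^+ 2) /\ forall i, lint (fun x => ((fun y => g y 0 i) \_ K') x ^+ 2).
Proof.
by move=> h K cK KU; have [[_ l] hg] := h K cK KU; split => // i; have [] := hg i.
Qed.

Lemma smooth_approx_ex U u g K : open U -> is_wgrad U u g -> compact K -> K `<=` U ->
  l2loc U u g -> exists W G, smooth_approx K (u \_ K) (fun i => (fun x => g x 0 i) \_ K) W G.
Proof.
move=> oU wg cK KU h2.
have [W [sW Wu Wg [G lG WG]]] := wgrad_smooth_approx oU wg cK KU (l2loc_lint h2).
exists W, G; split => //.
  by apply: lae_imp Wu => x h Kx; rewrite restrict_in//; exact: h.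
by move=> i; apply: lae_imp (Wg i) => x h Kx; rewrite restrict_in//; exact: h.
Qed.

(** The minimum is [v] minus the positive part of [v - u], and [ramp_byparts] provides the gradient
    of the positive part. *)
Definition min_grad u v gu gv x : Rn := gv x - step0 (v x - u x) *: (gv x - gu x).

Lemma min_gradE u v gu gv x i : min_grad u v gu gv x 0 i =
  step0 (v x - u x) * gu x 0 i + (1 - step0 (v x - u x)) * gv x 0 i.
Proof. by rewrite /min_grad !mxE; ring. Qed.

Lemma is_wgrad_min U u v gu gv : open U -> is_wgrad U u gu -> is_wgrad U v gv ->
  l2loc U u gu -> l2loc U v gv ->
  is_wgrad U (fun x => Num.min (u x) (v x)) (min_grad u v gu gv).
Proof.
move=> oU wu wv u2 v2; have mU : measurable (U : set T) by exact: open_measurable_leb.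
have [hu hgu iu] := wu; have [hv hgv iv] := wv.
have mres f : L1loc U f -> lmeas (f \_ U) by move=> [mf _]; exact/(lmeas_restrict _ mU).
split.
- apply: (L1loc_dom oU _ hu hv).
    apply/(lmeas_restrict _ mU).
    rewrite (_ : _ \_ U = fun x => Num.min ((u \_ U) x) ((v \_ U) x)).
      by apply: lmeas_min; exact: mres.
    apply/funext => x; have [Ux|nU] := pselect (U x); first by rewrite !restrict_in.
    by rewrite !restrict_out// minxx.
  by move=> x _; rewrite minEle; case: ifP => _; rewrite ?lerDl ?lerDr.
- move=> i; apply: (L1loc_dom oU _ (hgu i) (hgv i)).
    apply/(lmeas_restrict _ mU).
    rewrite (_ : _ \_ U = fun x => step0 ((v \_ U) x - (u \_ U) x) * ((fun y => gu y 0 i) \_ U) x +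
      (1 - step0 ((v \_ U) x - (u \_ U) x)) * ((fun y => gv y 0 i) \_ U) x).
      have ms : lmeas (fun x => step0 ((v \_ U) x - (u \_ U) x)).
        by apply: lmeas_step0; apply: lmeasB; exact: mres.
      apply: lmeasD; apply: lmeasM => //; try exact: mres.
      by apply: lmeasB => //; exact: lmeas_cst.
    apply/funext => x; have [Ux|nU] := pselect (U x).
      by rewrite !restrict_in// min_gradE.
    by rewrite !restrict_out// !mulr0 addr0.
  move=> x _; rewrite min_gradE; have /andP[s0 s1] := step0_itv (v x - u x).
  move: (step0 _) s0 s1 => s s0 s1; apply: le_trans (ler_normD _ _) _.
  rewrite !normrM (ger0_norm s0) [`|1 - s|]ger0_norm ?subr_ge0//.
  have := normr_ge0 (gu x 0 i); have := normr_ge0 (gv x 0 i); nra.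
move=> psi i hpsi; have [K [cK KU hK]] := Ccinf_closure hpsi.
have hpp := Ccinf_partial i hK.
have mK : measurable (K : set T) by exact: compact_measurable_leb.
have [W [G WG]] := smooth_approx_ex oU (is_wgradB oU wu wv) cK KU (l2locB u2 v2).
have [w2 g2] := l2locB u2 v2 cK KU.
set w := (fun x => v x - u x) \_ K in WG w2.
pose g i := (fun x => (gv x - gu x) 0 i) \_ K.
have [l1 l3 e] := @ramp_byparts _ _ K w g psi i cK w2.1 g2 w2 (ex_intro _ W (ex_intro _ G WG)) hK.
rewrite (@intg_test _ _ K U (fun x => Num.min (u x) (v x)) _ KU hpp).
rewrite (@intg_test _ _ K U (fun x => min_grad u v gu gv x 0 i) _ KU hK).
rewrite (@eq_intg _ _ _ (fun x => (v \_ K) x * partial i psi x - w x * step0 (w x) * partial i psi x)).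
  rewrite [in RHS](@eq_intg _ _ _ (fun x => ((fun y => gv y 0 i) \_ K) x * psi x -
    step0 (w x) * g i x * psi x)).
    rewrite intgB; [|exact: (lint_L1loc_test hv cK KU hpp)|exact: l1].
    rewrite intgB; [|exact: (lint_L1loc_test (hgv i) cK KU hK)|exact: l3].
    have := iv _ i hpsi; rewrite (@intg_test _ _ K U v _ KU hpp).
    by rewrite (@intg_test _ _ K U (fun x => gv x 0 i) _ KU hK) e => ->; rewrite opprD.
  move=> x; have [Kx|nK] := pselect (K x).
    by rewrite /w /g !restrict_in// !mxE; ring.
  by rewrite (Ccinf_out hK nK) !mulr0 subrr.
move=> x; have [Kx|nK] := pselect (K x).
  by rewrite /w !restrict_in// min_step0; ring.
by rewrite (Ccinf_out hpp nK) !mulr0 subrr.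
Qed.

Lemma Y12loc_wgrad U u : Y12loc U u -> is_wgrad U u (wgrad U u).
Proof. by move=> [[g wg] _]; exact: wgradP wg. Qed.

Lemma Y12loc_l2loc U u : (2 < n)%N -> open U -> Y12loc U u -> l2loc U u (wgrad U u).
Proof. by move=> n2 oU hu K cK KU; exact: Y12loc_l2. Qed.

Lemma wgrad_min U u v : (2 < n)%N -> open U -> Y12loc U u -> Y12loc U v ->
  lae (fun x => U x -> wgrad U (fun x => Num.min (u x) (v x)) x =
    min_grad u v (wgrad U u) (wgrad U v) x).
Proof.
move=> n2 oU hu hv; apply: wgrad_ae => //.
by apply: is_wgrad_min => //; [exact: Y12loc_wgrad..|exact: Y12loc_l2loc|exact: Y12loc_l2loc].
Qed.

Lemma Y12loc_min U u v : (2 < n)%N -> open U -> Y12loc U u -> Y12loc U v ->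
  Y12loc U (fun x => Num.min (u x) (v x)).
Proof.
move=> n2 oU hu hv; have mU : measurable (U : set T) by exact: open_measurable_leb.
have wm : is_wgrad U (fun x => Num.min (u x) (v x)) (min_grad u v (wgrad U u) (wgrad U v)).
  by apply: is_wgrad_min => //; [exact: Y12loc_wgrad..|exact: Y12loc_l2loc|exact: Y12loc_l2loc].
split; first by exists (min_grad u v (wgrad U u) (wgrad U v)).
move=> K cK KU; have mK : measurable (K : set T) by exact: compact_measurable_leb.
have p0 : two_star (R := R) (n := n) != 0.
  by rewrite gt_eqF// (lt_le_trans _ (two_star_gt2 n2)).
have [hu1 _] := hu.2 K cK KU; have [hv1 _] := hv.2 K cK KU.
have [mu lu] := (LpP u mK p0).1 hu1; have [mv lv] := (LpP v mK p0).1 hv1.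
split.
  have e : (fun x => Num.min (u x) (v x)) \_ K = fun x => Num.min ((u \_ K) x) ((v \_ K) x).
    apply/funext => x; have [Kx|nK] := pselect (K x); first by rewrite !restrict_in.
    by rewrite !restrict_out// minxx.
  apply/(LpP _ mK p0); rewrite e; have mm := lmeas_min mu mv; split => //.
  apply: (lint_dom _ (lintD lu lv)).
    by apply: (lmeas_mcomp (measurable_powR _)); exact: lmeas_norm.
  apply: laeW => x; rewrite ger0_norm ?powR_ge0//.
  by rewrite minEle; case: ifP => _; rewrite ?lerDl ?lerDr powR_ge0.
have [_ gu2] := Y12loc_l2loc n2 oU hu cK KU; have [_ gv2] := Y12loc_l2loc n2 oU hv cK KU.
have wm' := wgradP wm.
apply: (@Lp2_ae _ _ K _ (fun x => \sum_i (((fun y => wgrad U u y 0 i) \_ K) x ^+ 2 +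
   ((fun y => wgrad U v y 0 i) \_ K) x ^+ 2)) mK).
- apply: (enorm_restrict_meas mK) => i; apply/(lmeas_restrict _ mK).
  exact: lmeas_restrictW mU mK KU (is_wgrad_meas i wm').
- by apply: lint_sum => i; apply: lintD; [exact: (gu2 i).2|exact: (gv2 i).2].
apply: lae_imp (wgrad_min n2 oU hu hv) => x ex Kx; rewrite (ex (KU _ Kx)) enorm_sqr.
apply: ler_sum => i _; rewrite !restrict_in// -expr2 min_gradE.
have /andP[s0 s1] := step0_itv (v x - u x); move: s0 s1; set s := step0 _ => s0 s1.
set p := wgrad U u x 0 i; set q := wgrad U v x 0 i.
(* These three terms are the exact defect between [p^2 + q^2] and the square of the convex
   combination [s p + (1 - s) q]. *)
have h : 0 <= s * (1 - s) * (p - q) ^+ 2 by apply: mulr_ge0; [apply: mulr_ge0 => //; rewrite subr_ge0|exact: sqr_ge0].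
have h1 : 0 <= (1 - s) * p ^+ 2 by apply: mulr_ge0; [rewrite subr_ge0|exact: sqr_ge0].
have h2 : 0 <= s * q ^+ 2 by apply: mulr_ge0 => //; exact: sqr_ge0.
rewrite -subr_ge0 (_ : _ - _ = s * (1 - s) * (p - q) ^+ 2 + (1 - s) * p ^+ 2 + s * q ^+ 2).
  by rewrite !addr_ge0.
by ring.
Qed.

End Minimum.

(** * Integrability of the terms of the operator *)

Section Operator.
Context {R : realType} {n : nat}.
Local Notation Rn := 'rV[R]_n.
Local Notation T := (lebRn R n).
Implicit Types (f h u v w d phi psi : Rn -> R) (A : Rn -> 'M[R]_n) (b c g : Rn -> Rn).
Implicit Types (x y z : Rn) (K U : set Rn).

(** Each factor is restricted to [K] separately, which makes it a measurable function on all of R^n;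
    test functions supported in [K] do not see the restriction. *)
Definition flux A b u g K i x : R :=
  \sum_(j < n) ((fun y => A y i j) \_ K) x * ((fun y => g y 0 j) \_ K) x +
  (u \_ K) x * ((fun y => b y 0 i) \_ K) x.

Definition reaction c d u g K x : R :=
  \sum_(j < n) ((fun y => c y 0 j) \_ K) x * ((fun y => g y 0 j) \_ K) x + (d \_ K) x * (u \_ K) x.

Lemma mulvE (M : 'M[R]_n) x i : mulv M x 0 i = \sum_j M i j * x 0 j.
Proof. by rewrite /mulv !mxE; apply: eq_bigr => j _; rewrite mxE. Qed.

Lemma bilinL_form U A b c d u psi K : K `<=` U -> Ccinf K psi ->
  bilinL U A b c d u psi =
  intg (form (flux A b u (wgrad U u) K) (reaction c d u (wgrad U u) K) psi).
Proof.
move=> KU hp; have p0 x : ~ K x -> forall y, dotv y (grad psi x) = 0.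
  by move=> nK y; rewrite /dotv big1// => i _; rewrite mxE (Ccinf_out (Ccinf_partial i hp) nK) mulr0.
rewrite /bilinL Rintegral_supp; last first.
  move=> x nU; have nK : ~ K x by move=> /KU.
  by rewrite (p0 x nK) (Ccinf_out hp nK) mulr0 subrr.
apply: eq_intg => x; have [Kx|nK] := pselect (K x); last first.
  by rewrite (form_out _ _ hp nK) (p0 x nK) (Ccinf_out hp nK) mulr0 subrr.
rewrite /form /reaction /dotv; congr (_ - _).
  apply: eq_bigr => i _; rewrite mxE [grad _ _ _ _]mxE mulvE mxE /flux.
  congr ((_ + _) * _); last by rewrite !restrict_in.
  by apply: eq_bigr => j _; rewrite !restrict_in.
rewrite !restrict_in//; congr ((_ + _) * _).
by apply: eq_bigr => j _; rewrite !restrict_in.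
Qed.

(** The upper bound is applied to the basis vectors [e_j] and plus or minus [e_i]; the two signs
    give the absolute value of the entry. *)
Lemma elliptic_bounded U A (la La : R) i j : elliptic U A la La ->
  lae (fun x => U x -> `|A x i j| <= La).
Proof.
apply: lae_imp => x h Ux; have hx := h Ux.
have ed k : enorm (delta_mx 0 k : Rn) = 1.
  rewrite /enorm /dotv (bigD1 k)//= big1; last first.
    by move=> l lk; rewrite !mxE /= (negbTE lk) mulr0.
  by rewrite !mxE !eqxx mulr1 addr0 sqrtr1.
have em s : dotv (mulv (A x) (delta_mx 0 j)) (s *: delta_mx 0 i) = s * A x i j.
  rewrite /dotv (bigD1 i)//= big1; last first.
    by move=> l li; rewrite !mxE /= (negbTE li) !mulr0.
  rewrite mulvE !mxE !eqxx/= mulr1 addr0 (bigD1 j)//= big1; last first.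
    by move=> l lj; rewrite !mxE (negbTE lj) mulr0.
  by rewrite !mxE !eqxx mulr1 addr0 mulrC.
have en s : enorm (s *: delta_mx 0 i : Rn) = `|s|.
  rewrite /enorm (_ : dotv _ _ = s ^+ 2 * dotv (delta_mx 0 i : Rn) (delta_mx 0 i)).
    by rewrite -enorm_sqr ed expr1n mulr1 sqrtr_sqr.
  by rewrite /dotv mulr_sumr; apply: eq_bigr => l _; rewrite !mxE expr2; ring.
have [_ h1] := hx (delta_mx 0 j) (1 *: delta_mx 0 i).
have [_ h2] := hx (delta_mx 0 j) (-1 *: delta_mx 0 i).
move: h1 h2; rewrite !em !en ed normrN normr1 !mulr1 => h1 h2.
by rewrite ler_norml; apply/andP; split; lra.
Qed.

Lemma elliptic_ge0 U A (la La : R) : 0 < la -> elliptic U A la La ->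
  lae (fun x => U x -> forall y, 0 <= \sum_i (\sum_j A x i j * y 0 j) * y 0 i).
Proof.
move=> la0; apply: lae_imp => x h Ux y; have [h1 _] := h Ux y y.
rewrite (_ : \sum_i _ = dotv (mulv (A x) y) y); last first.
  by apply: eq_bigr => i _; rewrite mulvE.
by apply: le_trans h1; rewrite mulr_ge0 ?sqr_ge0// ltW.
Qed.

(** The trace inequality for [|b|^2] puts [u b] in [L^2], and [c] is in [L^2] on [K], so
    [<c, grad u>] is integrable. For the last term [|d u| <= |d| (1 + u^2)], and the trace
    inequality for [|d|] applies. *)
Lemma flux_reaction U A b c d u K (la La : R) : (2 < n)%N -> open U ->
  (forall i j, measurable_on U (fun x => A x i j)) -> vmeasurable_on U b -> vmeasurable_on U c ->
  measurable_on U d -> elliptic U A la La -> compact K -> K `<=` U ->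
  trace_class (fun x => enorm (b x) ^+ 2 * \1_K x) ->
  trace_class (fun x => enorm (c x) ^+ 2 * \1_K x) ->
  trace_class (fun x => `|d x| * \1_K x) -> Y12loc U u ->
  [/\ forall i, l2 ((fun x => b x 0 i) \_ K), forall i, l2 (flux A b u (wgrad U u) K i) &
    lint (reaction c d u (wgrad U u) K)].
Proof.
move=> n2 oU mA mb mc md hell cK KU tb tc td hu.
have mU : measurable (U : set T) by exact: open_measurable_leb.
have mK : measurable (K : set T) by exact: compact_measurable_leb.
have [u2 g2] := Y12loc_l2loc n2 oU hu cK KU.
have wg := Y12loc_wgrad hu.
have mr f : measurable_on U f -> lmeas (f \_ K) by exact: lmeas_restrictW.
have l2c e i : vmeasurable_on U e -> trace_class (fun x => enorm (e x) ^+ 2 * \1_K x) ->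
    l2 ((fun x => e x 0 i) \_ K).
  move=> me [lV _ _ _]; apply: (l2_dom (mr _ (me i)) lV); apply: laeW => x.
  have [Kx|nK] := pselect (K x).
    by rewrite restrict_in// indicE mem_set// mulr1 enorm_sqr coord_dotv_le.
  by rewrite restrict_out// expr0n/= indicE memNset// mulr0.
have sob V : trace_class V -> (forall x, ~ K x -> V x = 0) -> lint (fun x => V x * u x ^+ 2).
  exact: trace_sobolev oU wg cK KU (l2loc_lint (Y12loc_l2loc n2 oU hu)).
have l2b i : l2 ((fun x => b x 0 i) \_ K) by exact: l2c.
have V0 f x : ~ K x -> f x * \1_K x = 0 by move=> nK; rewrite indicE memNset// mulr0.
split => // [i|].
  apply: l2D.
    apply: l2_sum => j; apply: (@l2_bounded _ _ `|La|); [exact: mr|apply: lae_imp (elliptic_bounded i j hell) => x h|exact: g2].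
    have [Kx|nK] := pselect (K x); first by rewrite restrict_in// (le_trans (h (KU _ Kx)))// ler_norm.
    by rewrite restrict_out// normr0.
  have lVu := sob _ tb (V0 (fun x => enorm (b x) ^+ 2)).
  apply: (l2_dom _ lVu); first by apply: lmeasM; [exact: u2.1|exact: (l2b i).1].
  apply: laeW => x; have [Kx|nK] := pselect (K x).
    rewrite !restrict_in// indicE mem_set// mulr1 exprMn mulrC ler_wpM2r ?sqr_ge0//.
    by rewrite enorm_sqr coord_dotv_le.
  by rewrite !restrict_out// mul0r expr0n/= indicE memNset// mulr0 mul0r.
apply: lintD.
  by apply: lint_sum => j; apply: l2M => //; exact: l2c.
have lVu := sob _ td (V0 (fun x => `|d x|)); have [lV _ _ _] := td.
apply: (lint_dom _ (lintD lV lVu)); first by apply: lmeasM; [exact: mr|exact: u2.1].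
apply: laeW => x; have [Kx|nK] := pselect (K x); last first.
  by rewrite !restrict_out// mul0r normr0 indicE memNset// mulr0 mul0r addr0.
rewrite !restrict_in// indicE mem_set// mulr1 normrM -{2}[`|d x|]mulr1 -mulrDr.
by rewrite ler_wpM2l// le1sqr.
Qed.

End Operator.

(** * From supersolutions to the comparison of forms *)

Section Comparison.
Context {R : realType} {n : nat}.
Local Notation Rn := 'rV[R]_n.
Local Notation T := (lebRn R n).
Implicit Types (u v w d phi psi : Rn -> R) (A : Rn -> 'M[R]_n) (b c g : Rn -> Rn).
Implicit Types (x y z : Rn) (K U : set Rn) (F : (Rn -> R) -> R).

Lemma Wm12_add U F phi psi : open U -> Wm12 U F -> Ccinf U phi -> Ccinf U psi ->
  F (fun x => phi x + psi x) = F phi + F psi.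
Proof.
move=> oU [linF _] hp hq; rewrite -[F phi]mul1r -linF; [|exact: Ccinf_W012..].
by congr F; apply/funext => x; rewrite mul1r.
Qed.

(** The comparison yields a combination of the forms of [u] and [v] with weights [step0 (v - u)] and
    its complement. The minimum and its gradient are the same combinations almost everywhere, and
    flux and reaction are linear in the function and its gradient, so this is the form of the
    minimum. *)
Theorem supersolution_min U A b c d (la La : R) F u v : (2 < n)%N -> open U ->
  (forall i j, measurable_on U (fun x => A x i j)) -> vmeasurable_on U b -> vmeasurable_on U c ->
  measurable_on U d -> 0 < la -> elliptic U A la La ->
  (forall K, compact K -> K `<=` U -> [/\ trace_class (fun x => enorm (b x) ^+ 2 * \1_K x),
    trace_class (fun x => enorm (c x) ^+ 2 * \1_K x) & trace_class (fun x => `|d x| * \1_K x)]) ->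
  Wm12 U F -> supersolution U A b c d F u -> supersolution U A b c d F v ->
  supersolution U A b c d F (fun x => Num.min (u x) (v x)).
Proof.
move=> n2 oU mA mb mc md la0 hell htr hF [hu su] [hv sv].
have hm := Y12loc_min n2 oU hu hv; split => // phi [hp p0].
have [K [cK KU hK]] := Ccinf_closure hp.
have [tb tc td] := htr K cK KU.
have data w (hw : Y12loc U w) := flux_reaction n2 oU mA mb mc md hell cK KU tb tc td hw.
have [hb fu ru] := data _ hu; have [_ fv rv] := data _ hv; have [_ fm rm] := data _ hm.
set gu := wgrad U u in fu ru; set gv := wgrad U v in fv rv.
pose m x := Num.min (u x) (v x).
have u2 := Y12loc_l2loc n2 oU hu; have v2 := Y12loc_l2loc n2 oU hv.
have wd := is_wgradB oU (Y12loc_wgrad hu) (Y12loc_wgrad hv).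
have d2 := l2locB u2 v2.
have [w2 g2] := d2 K cK KU.
have hW := smooth_approx_ex oU wd cK KU d2.
pose w := (fun x => v x - u x) \_ K.
pose g i := (fun x => (gv x - gu x) 0 i) \_ K.
rewrite (bilinL_form A b c d m KU hK).
pose fluxu := flux A b u gu K; pose fluxv := flux A b v gv K.
pose reacu := reaction c d u gu K; pose reacv := reaction c d v gv K.
have cmp : F phi <= intg (fun x => step0 (w x) * form fluxu reacu phi x +
    (1 - step0 (w x)) * form fluxv reacv phi x).
  apply: (@form_comparison _ _ K phi w g fluxu fluxv (fun i => (fun x => b x 0 i) \_ K)) => //.
    by move=> i; split; [exact: g2|exact: fu|exact: fv|exact: hb].
    apply: lae_imp (elliptic_ge0 la0 hell) => x hx Kx.
    (* The matrix [A] enters the difference of the fluxes through [S = <A grad w, grad w> >= 0]; the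
       remaining part is [w <b, grad w>]. *)
    have := hx (KU _ Kx) (gv x - gu x); set S := \sum_i _ => S0.
    rewrite (_ : \sum_(i < n) (fluxv i x - fluxu i x) * g i x = S +
      w x * \sum_(i < n) ((fun y => b y 0 i) \_ K) x * g i x); first by rewrite lerDr.
    rewrite /S mulr_sumr -big_split/=; apply: eq_bigr => i _.
    rewrite /fluxu /fluxv /flux /g /w !restrict_in//.
    have e : \sum_j ((fun y => A y i j) \_ K) x * ((fun y => gv y 0 j) \_ K) x -
        \sum_j ((fun y => A y i j) \_ K) x * ((fun y => gu y 0 j) \_ K) x =
        \sum_j A x i j * (gv x - gu x) 0 j.
      have eB j : (gv x - gu x) 0 j = gv x 0 j - gu x 0 j by rewrite !mxE.
      by rewrite -sumrB; apply: eq_bigr => j _; rewrite !restrict_in// eB mulrBr.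
    by rewrite -e; ring.
  move=> psi psi' h1 h2 psi0 psi0' hs.
  have -> : phi = (fun x => psi x + psi' x) by apply/funext.
  have H1 := CcinfW KU h1; have H2 := CcinfW KU h2.
  rewrite (Wm12_add oU hF H1 H2) -(bilinL_form A b c d u KU h1) -(bilinL_form A b c d v KU h2).
  by apply: lerD; [apply: su|apply: sv].
apply: (le_trans cmp); rewrite le_eqVlt; apply/orP; left; apply/eqP.
have ms : lmeas (fun x => step0 (w x)) by apply: lmeas_step0; exact: w2.1.
apply: intg_ae_eq.
- apply: lmeasD; apply: lmeasM => //; try by apply: lint_meas; exact: form_lint hK.
  by apply: lmeasB => //; exact: lmeas_cst.
- by apply: lint_meas; exact: form_lint hK.
apply: lae_imp (wgrad_min n2 oU hu hv) => x ex.
have [Kx|nK] := pselect (K x); last by rewrite !(form_out _ _ hK nK) !mulr0 addr0.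
have {}ex := ex (KU _ Kx); set s := step0 (w x).
have em : m x = s * u x + (1 - s) * v x by rewrite /s /w restrict_in// /m min_step0.
have eg i : wgrad U m x 0 i = s * gu x 0 i + (1 - s) * gv x 0 i.
  by rewrite ex min_gradE /s /w restrict_in.
have ef i : flux A b m (wgrad U m) K i x = s * fluxu i x + (1 - s) * fluxv i x.
  rewrite /flux /fluxu /fluxv /flux !mulrDr !mulr_sumr addrACA -big_split/=; congr (_ + _).
    by apply: eq_bigr => j _; rewrite !restrict_in// eg; ring.
  by rewrite !restrict_in// em; ring.
have er : reaction c d m (wgrad U m) K x = s * reacu x + (1 - s) * reacv x.
  rewrite /reaction /reacu /reacv /reaction !mulrDr !mulr_sumr addrACA -big_split/=; congr (_ + _).
    by apply: eq_bigr => j _; rewrite !restrict_in// eg; ring.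
  by rewrite !restrict_in// em; ring.
rewrite /form er !mulrBr !mulr_sumr addrACA -big_split/=; congr (_ + _); last by ring.
by apply: eq_bigr => i _; rewrite ef; ring.
Qed.

End Comparison.

Theorem corollary5p7 (R : realType) (n : nat) (hn : (3 <= n)%N)
  (Omega : set 'rV[R]_n) (hOmega : open Omega)
  (A : 'rV[R]_n -> 'M[R]_n) (b c : 'rV[R]_n -> 'rV[R]_n) (d : 'rV[R]_n -> R)
  (mA : forall i j, measurable_on Omega (fun x => A x i j))
  (mb : vmeasurable_on Omega b) (mc : vmeasurable_on Omega c) (md : measurable_on Omega d)
  (lambda Lambda : R) (hlambda : 0 < lambda) (hLambda : lambda < Lambda)
  (hA : elliptic Omega A lambda Lambda)
  (hbcd :
    [/\ Kato Omega (fun x => enorm (b x) ^+ 2),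
        Kato Omega (fun x => enorm (c x) ^+ 2)
      & Kato Omega (fun x => `|d x|)] \/
    [/\ weak_Lorentz n%:R Omega (fun x => enorm (b x)),
        weak_Lorentz n%:R Omega (fun x => enorm (c x))
      & weak_Lorentz (n%:R / 2) Omega d])
  (hdiv : divD_le0 Omega b d \/ divD_le0 Omega (fun x => - c x) d)
  (hbc :
    (exists q : R, n%:R <= q /\ Lorentz n%:R q Omega (fun x => enorm (b x + c x)))
    \/ Kato Omega (fun x => enorm (b x + c x) ^+ 2))
  (F : ('rV[R]_n -> R) -> R) (hF : Wm12 Omega F)
  (u v : 'rV[R]_n -> R)
  (hu : supersolution Omega A b c d F u)
  (hv : supersolution Omega A b c d F v) :
  supersolution Omega A b c d F (fun x => Num.min (u x) (v x)).
Proof.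
apply: (supersolution_min hn hOmega mA mb mc md hlambda hA _ hF hu hv) => K cK KU.
have norm2 (e : 'rV[R]_n -> 'rV[R]_n) :
    (fun x => enorm (e x) ^+ 2 * \1_K x) = (fun x => `|enorm (e x) ^+ 2| * \1_K x).
  by apply/funext => x; rewrite ger0_norm// sqr_ge0.
case: hbcd => -[hb hc hd]; split.
- by rewrite norm2; exact: kato_trace_class hb cK KU.
- by rewrite norm2; exact: kato_trace_class hc cK KU.
- have := kato_trace_class hn hOmega hd cK KU.
  by under eq_fun do rewrite normr_id.
- by apply: weak_Lorentz_trace_class hb _ cK KU => // x; exact: sqrtr_ge0.
- by apply: weak_Lorentz_trace_class hc _ cK KU => // x; exact: sqrtr_ge0.
- exact: weak_Lorentz_half_trace_class hd cK KU.
Qed.
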